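(* Let $I$ be a non-empty open interval of $\mathbb{R}$, $\gamma:I\to\mathbb{R}$ convex and $\phi:[0,\infty)\to\mathbb{R}$ concave. Let $\mu_1,\mu_2$ be probability measures on $\mathcal{B}_I$ of finite mean, in convex order, with $\int\gamma^+\,d\mu_1<\infty$ and $\int\gamma^+\,d\mu_2<\infty$. Let $\mathcal{M}$ be the set of martingale transports of $\mu_1$ to $\mu_2$ and $J(\nu):=E_\nu\big[\phi\big(E_\nu[\gamma(X_2)\mid X_1]-\gamma(X_1)\big)\big]$. Assume that: (a) $\gamma$ is bounded; and (b) $\phi|_{[0,2\|\gamma\|_\infty]}$ is nondecreasing and continuous, while $\phi|_{(0,2\|\gamma\|_\infty]}$ is locally Lipschitz. Then there exists a sequence $(\mu_1^n)_{n\in\mathbb{N}}$ of finitely supported probability measures on $\mathcal{B}_I$, nondecreasing in convex order, converging weakly to $\mu_1$, and each preceding $\mu_1$ in convex order, such that if, for each $n\in\mathbb{N}$, $\nu^n$ is a maximizer of $J$ over the set of martingale transports of $\mu_1^n$ to $\mu_2$, then: (I) $J(\nu^n)$ is nonincreasing in $n$, and $\lim_{n\to\infty}J(\nu^n)=\max_{\nu\in\mathcal{M}}J(\nu)$ (in particular the latter maximum is attained); (II) the sequence $(\nu^n)_{n\in\mathbb{N}}$ is tight; (III) any weak accumulation point $\nu^0$ of the sequence $(\nu^n)_{n\in\mathbb{N}}$ is a maximizer of $J$ over $\mathcal{M}$, i.e. $\nu^0\in\mathcal{M}$ and $J(\nu^0)=\max_{\nu\in\mathcal{M}}J(\nu)$.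 Such a sequence of maximizers $(\nu^n)_{n\in\mathbb{N}}$ and an associated weak accumulation point $\nu^0$ exist.
   Context: $\mathcal{B}_A$ denotes the Borel $\sigma$-field of $A$. $X_1,X_2$ are the canonical projections of $I^2$ onto the first and second coordinate. $\|\gamma\|_\infty$ is the supremum norm of $\gamma$ on $I$. Convex order: probability measures $\lambda_1,\lambda_2$ on $\mathcal{B}_I$ of finite mean are in convex order ($\lambda_1$ precedes $\lambda_2$) if $\int\psi\,d\lambda_1\le\int\psi\,d\lambda_2$ for all convex $\psi:I\to\mathbb{R}$. A sequence is nondecreasing in convex order if each term precedes the next. A martingale transport of $\lambda_1$ to $\lambda_2$ is a probability measure $\nu$ on $\mathcal{B}_{I^2}$ with first marginal $\lambda_1$, second marginal $\lambda_2$ and $E_\nu[X_2\mid X_1]=X_1$ $\nu$-a.s. The functional $J(\nu)$ is defined by the same displayed formula for every martingale transport $\nu$ between any two marginals for which the expression is well-defined (in particular for $\nu=\nu^n$). *)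

(* Defs.v *)
(* The interval I (resp. the square I^2) is a subset of R (resp. of R * R): a
   probability measure on the Borel sets of I is a probability measure on R that
   is carried by I, and a function on I is a function on R of which only the
   values on I matter. *)
From HB Require Import structures.
From mathcomp Require Import all_boot all_order all_algebra.
From mathcomp Require Import all_classical all_reals all_analysis.

Set Implicit Arguments.
Unset Strict Implicit.
Unset Printing Implicit Defensive.

Import Order.TTheory GRing.Theory Num.Theory.
Import numFieldNormedType.Exports.

Local Open Scope classical_set_scope.
Local Open Scope ring_scope.
Local Open Scope ereal_scope.


Definition carried_by d (T : measurableType d) (R : realType)
    (P : probability T R) (D : set T) : Prop :=
  P (~` D) = 0.

Definition finite_mean (R : realType) (mu : probability R R) : Prop :=
  mu.-integrable [set: R] (fun x : R => x%:E).

Definition finitely_supported (R : realType) (mu : probability R R) :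
    Prop :=
  exists2 F : set R, finite_set F & carried_by mu F.

Definition concave_function (R : realType) (D : set R) (f : R -> R) : Prop :=
  convex_function (D : set R^o) (fun x : R^o => (- f x)%R : R^o).

(* A convex psi is bounded below by an affine function, so for measures of
   finite mean the integrals exist in ]-oo, +oo]. *)
Definition convex_order (R : realType) (I : set R)
    (la1 la2 : probability R R) : Prop :=
  forall psi : R -> R, convex_function (I : set R^o) (psi : R^o -> R^o) ->
    \int[la1]_(x in I) (psi x)%:E <= \int[la2]_(x in I) (psi x)%:E.

Section conditional_expectation.
Context d d' (T : measurableType d) (T' : measurableType d') (R : realType).
Variable P : probability T R.

(* Z is a version of E_P[Y | X]. *)
Definition is_cond_exp (X : T -> T') (Y Z : T -> R) : Prop :=
  [/\ P.-integrable [set: T] (EFin \o Y),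
      P.-integrable [set: T] (EFin \o Z),
      measurable_fun [set: g_sigma_algebra_preimageType X] Z &
      forall B : set T', measurable B ->
        \int[P]_(w in X @^-1` B) (Z w)%:E = \int[P]_(w in X @^-1` B) (Y w)%:E].

(* A version of E_P[Y | X], chosen once and for all; the value 0 when there is
   none, i.e. when Y is not integrable. *)
Definition cond_exp (X : T -> T') (Y : T -> R) : T -> R :=
  xget (cst 0%R) [set Z | is_cond_exp X Y Z].

End conditional_expectation.

Definition martingale_transport (R : realType) (I : set R)
    (la1 la2 : probability R R) : set (probability (R * R)%type R) :=
  [set nu | [/\ carried_by nu (I `*` I),
      forall B : set R, measurable B -> nu (fst @^-1` B) = la1 B,
      forall B : set R, measurable B -> nu (snd @^-1` B) = la2 B &
      is_cond_exp nu (fst : R * R -> R) snd fst]].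

(* [gamma \_ I] is gamma on I and 0 elsewhere.  For a martingale transport and
   gamma convex, the argument of phi is nonnegative nu-a.s. (Jensen); [Num.max 0]
   only keeps the exceptional null set inside the domain [0, +oo[ of phi. *)
Definition J (R : realType) (I : set R) (gamma phi : R -> R)
    (nu : probability (R * R)%type R) : \bar R :=
  'E_nu[fun p : R * R => phi (Num.max 0
    (cond_exp nu (fst : R * R -> R) ((gamma \_ I) \o snd) p
     - (gamma \_ I) p.1))%R].

Definition maximizer (T : Type) (R : realType) (f : T -> \bar R) (A : set T) :
    set T :=
  [set x | A x /\ forall y, A y -> f y <= f x].

Definition supnorm (R : realType) (I : set R) (f : R -> R) : R :=
  sup [set `|f x|%R | x in I].

Definition locally_lipschitz (R : realType) (A : set R) (f : R -> R) : Prop :=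
  forall x, A x -> exists2 U : set R, nbhs x U &
    [lipschitz (f y : R^o) | y in (U `&` A : set R^o)].

Definition Cb (T : topologicalType) (R : realType) (D : set T) :
    set (T -> R) :=
  [set f | {within D, continuous f} /\ [bounded (f x : R^o) | x in D]].

(* Weak convergence on D, to be used with the class C := Cb D of test functions
   (T has no joint topological and measurable structure here). *)
Definition weak_cvg d (T : measurableType d) (R : realType) (D : set T)
    (C : set (T -> R)) (P_ : nat -> probability T R) (P : probability T R) :
    Prop :=
  forall f, C f ->
    \int[P_ n]_(x in D) (f x)%:E @[n --> \oo] --> \int[P]_(x in D) (f x)%:E.

Definition weak_cvg1 (R : realType) (I : set R) :=
  @weak_cvg _ R R I (@Cb R R I).

Definition weak_cvg2 (R : realType) (I : set R) :=
  @weak_cvg _ (R * R)%type R (I `*` I) (@Cb (R * R)%type R (I `*` I)).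

(* Limit of a subsequence, in the (metrizable) weak topology on the probability
   measures on I^2. *)
Definition weak_accumulation_point (R : realType) (I : set R)
    (nu_ : nat -> probability (R * R)%type R) (nu0 : probability (R * R)%type R) : Prop :=
  carried_by nu0 (I `*` I) /\
  exists2 k : nat -> nat, (forall n, (k n < k n.+1)%N) &
    weak_cvg2 I (nu_ \o k) nu0.

(* Tightness in I^2: the compact sets are taken inside I^2. *)
Definition tight (R : realType) (I : set R)
    (nu_ : nat -> probability (R * R)%type R) : Prop :=
  forall eps : R, (0 < eps)%R -> exists K : set (R * R),
    [/\ compact K, K `<=` I `*` I & forall n, nu_ n (~` K) <= eps%:E].

(* Main.v *)
(** Write phi^*(p) for the supremum of phi(s) - p s over 0 <= s <= 2 ||gamma||.
    Concave duality turns J(nu) into the infimum, over the bounded continuous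
    p >= 0, of the integral of p(x) (gamma(y) - gamma(x)) + phi^*(p(x)) with
    respect to nu(dx, dy).  Each of these integrals depends continuously on nu,
    so J is upper semicontinuous.  Each of them, p being a function of T(x), can
    only increase when x is replaced by the barycentre T(x) of its cell in a
    finite partition of I, by convexity of gamma; so J(nu) is at most J of the
    law of (T(X_1), X_2).  Now let mu_1^n be the law of the barycentre map T_n of
    the partition of I cut out by the first n rational numbers.  Coarsening gives
    the monotonicity and J(nu^n) >= max J; the couplings with second marginal mu_2
    are weakly relatively compact, and weak limits of martingale transports are
    martingale transports, so that upper semicontinuity gives the rest.
    For the existence of a transport of mu_1^n to mu_2, split mu_2 into pieces, one
    for each atom: if no splitting had nearly the right masses and barycentres,
    then a nearly smallest error vector would provide a maximum of affine functions
    that violates the convex order. *)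

Require Import Defs.
From HB Require Import structures.
From mathcomp Require Import all_boot all_order all_algebra.
From mathcomp Require Import all_classical all_reals all_analysis.
From mathcomp Require Import measurable_realfun.
From mathcomp Require Import ring lra.

Set Implicit Arguments.
Unset Strict Implicit.
Unset Printing Implicit Defensive.

Import Order.TTheory GRing.Theory Num.Theory.
Import numFieldNormedType.Exports.

Local Open Scope classical_set_scope.
Local Open Scope ring_scope.
Local Open Scope ereal_scope.

(** * Integrals with respect to a probability measure *)

(** [J] contains a conditional expectation, which is not continuous under weak convergence; the dual
    formula trades it for functions of the pair that are bounded and continuous on I x I, as a
    convex function is continuous on an open interval and [gamma] is bounded. By Jensen the argument
    of [phi] lies in [0, 2 ||gamma||], the range over which the conjugate is taken. Because the
    second marginal is fixed, the set functions B |-> nu(A x B) are all dominated by mu_2(B): along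
    a diagonal subsequence they converge on every Borel set B, and their limits have densities, from
    which the limit law is rebuilt by a quantile construction. The same domination controls the
    tails of X_2, so the martingale identity, whose integrand is unbounded, survives weak limits.
    Compactness and closedness serve a second time in the existence of a transport of mu_1^n to
    mu_2, where splittings with errors tending to 0 replace an exact one. In the partition, cells
    are intervals, so that a barycentre stays in its own cell; hence T_{n+1} followed by T_n gives
    T_n, and comparison with the rationals forces T_n(x) to converge to x, for almost all x. *)

Lemma measurable_preimage d1 d2 (T1 : measurableType d1) (T2 : measurableType d2)
    (f : T1 -> T2) (B : set T2) :
  measurable_fun [set: T1] f -> measurable B -> measurable (f @^-1` B).
Proof. by move=> mf mB; rewrite -[X in measurable X]setTI; exact: mf. Qed.

Lemma integrable_measurable d (T : measurableType d) (R : realType)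
    (P : probability T R) (f : T -> R) :
  P.-integrable [set: T] (EFin \o f) -> measurable_fun [set: T] f.
Proof. by move=> fi; apply/measurable_EFinP; case/integrableP : fi. Qed.

Lemma open_interval_setI (R : realType) : setI_closed (@RGenOpens.G R).
Proof.
move=> _ _ [a [b ->]] [a' [b' ->]]; exists (Num.max a a'), (Num.min b b').
apply/seteqP; split => x /=; rewrite !in_itv/= gt_max lt_min.
  by case=> /andP[-> ->] /andP[-> ->].
by move=> /andP[/andP[-> ->] /andP[-> ->]].
Qed.

Definition pr d (T : measurableType d) (R : realType) (P : probability T R)
  (A : set T) : R := fine (P A).

Section bounded_integrals.
Local Open Scope ring_scope.
Context d (T : measurableType d) (R : realType).
Variable P : probability T R.
Implicit Types f g : T -> R.

Lemma bounded_fun_integrable f (M : R) :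
  measurable_fun [set: T] f -> (forall x, `|f x| <= M) ->
  P.-integrable [set: T] (EFin \o f).
Proof.
move=> mf fM; apply: measurable_bounded_integrable => //.
- by apply: (le_lt_trans (probability_le1 P measurableT)); rewrite ltry.
- exists M; split; first exact: num_real.
  by move=> r Mr x _ /=; exact: le_trans (fM x) (ltW Mr).
Qed.

Lemma EFin_Rintegral f : P.-integrable [set: T] (EFin \o f) ->
  (\int[P]_x (f x)%:E)%E = (\int[P]_x f x)%:E.
Proof. by move=> fi; rewrite /Rintegral fineK//; exact: integrable_fin_num. Qed.

Lemma integrable_subr f g : P.-integrable [set: T] (EFin \o f) ->
  P.-integrable [set: T] (EFin \o g) ->
  P.-integrable [set: T] (EFin \o (fun x => f x - g x)).
Proof. by move=> fi gi; have := integrableB measurableT fi gi. Qed.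

Lemma integrable_addr f g : P.-integrable [set: T] (EFin \o f) ->
  P.-integrable [set: T] (EFin \o g) ->
  P.-integrable [set: T] (EFin \o (fun x => f x + g x)).
Proof. by move=> fi gi; have := integrableD measurableT fi gi. Qed.

Lemma integrable_mulr (k : R) f : P.-integrable [set: T] (EFin \o f) ->
  P.-integrable [set: T] (EFin \o (fun x => k * f x)).
Proof. by move=> fi; have := integrableZl measurableT k fi. Qed.

Lemma Rintegral_dist f g : P.-integrable [set: T] (EFin \o f) ->
  P.-integrable [set: T] (EFin \o g) ->
  `|\int[P]_x f x - \int[P]_x g x| <= \int[P]_x `|f x - g x|.
Proof.
move=> fi gi; rewrite -RintegralB//; apply: le_normr_Rintegral => //.
exact: integrable_subr.
Qed.

Lemma Rintegral_cst1 (r : R) : \int[P]_x r = r.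
Proof. by rewrite Rintegral_cst//= (@probability_setT _ _ _ P) mulr1. Qed.

Lemma Rintegral_indic (A : set T) : measurable A ->
  \int[P]_x \1_A x = pr P A.
Proof. by move=> mA; rewrite /Rintegral /pr integral_indic// setIT. Qed.

Lemma Rintegral_cvg (f_ : nat -> T -> R) f g :
  (forall n, measurable_fun [set: T] (f_ n)) ->
  measurable_fun [set: T] f ->
  (forall x, f_ ^~ x @ \oo --> f x) ->
  P.-integrable [set: T] (EFin \o g) ->
  (forall n x, `|f_ n x| <= g x) ->
  \int[P]_x f_ n x @[n --> \oo] --> \int[P]_x f x.
Proof.
move=> mf_ mf ff gi fg.
have [||||| fi _ cv] := @dominated_convergence _ _ _ P _ measurableT
  (fun n => EFin \o f_ n) (EFin \o f) (EFin \o g).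
- by move=> n; exact/measurable_EFinP.
- exact/measurable_EFinP.
- by apply: aeW => x _; apply: cvg_EFin; [near=> n|exact: ff].
- exact: gi.
- by apply: aeW => x n _ /=; rewrite lee_fin.
apply: fine_cvg; rewrite fineK//; last exact: integrable_fin_num.
Unshelve. all: by end_near. Qed.

Lemma Rintegral_cvg_bounded (f_ : nat -> T -> R) f (M : R) :
  (forall n, measurable_fun [set: T] (f_ n)) ->
  measurable_fun [set: T] f ->
  (forall x, f_ ^~ x @ \oo --> f x) ->
  (forall n x, `|f_ n x| <= M) ->
  \int[P]_x f_ n x @[n --> \oo] --> \int[P]_x f x.
Proof.
move=> mf_ mf ff fM; apply: (@Rintegral_cvg _ _ (cst M)) => //.
by apply: (@bounded_fun_integrable _ `|M|).
Qed.

Lemma ae_eq_Rintegral f g : measurable_fun [set: T] f ->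
  measurable_fun [set: T] g -> {ae P, forall x, f x = g x} ->
  \int[P]_x f x = \int[P]_x g x.
Proof.
move=> mf mg fg; congr fine; apply: ae_eq_integral => //.
- exact/measurable_EFinP.
- exact/measurable_EFinP.
- by apply: filterS fg => x -> _.
Qed.

Lemma ae_eq_integrable f g : measurable_fun [set: T] g ->
  {ae P, forall x, f x = g x} ->
  P.-integrable [set: T] (EFin \o f) -> P.-integrable [set: T] (EFin \o g).
Proof.
move=> mg fg /integrableP[mf fi]; apply/integrableP; split.
  exact/measurable_EFinP.
move: fi; congr (_ < _)%E; apply: ae_eq_integral => //.
- exact: measurableT_comp.
- by apply: measurableT_comp => //; exact/measurable_EFinP.
- by apply: filterS fg => x /= -> _.
Qed.

Lemma ae_le_Rintegral f g : P.-integrable [set: T] (EFin \o f) ->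
  P.-integrable [set: T] (EFin \o g) -> {ae P, forall x, f x <= g x} ->
  \int[P]_x f x <= \int[P]_x g x.
Proof.
move=> fi gi fg.
have mf := integrable_measurable fi.
have mg := integrable_measurable gi.
(* [min f g] is almost everywhere [f] and is below [g] at every point, which reduces the claim to a
   pointwise comparison. *)
have mm : measurable_fun setT (fun x => Num.min (f x) (g x)).
  exact: measurable_minr.
have e : {ae P, forall x, f x = Num.min (f x) (g x)}.
  by apply: filterS fg => x fg; rewrite min_l.
rewrite (ae_eq_Rintegral mf mm e); apply: le_Rintegral => //.
  exact: ae_eq_integrable e fi.
by move=> x _; rewrite ge_min lexx orbT.
Qed.

Lemma integrableMbounded f g (M : R) : measurable_fun [set: T] f ->
  (forall x, `|f x| <= M) -> P.-integrable [set: T] (EFin \o g) ->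
  P.-integrable [set: T] (EFin \o (fun x => f x * g x)).
Proof.
move=> mf fM gi.
have fb : [bounded f x | x in setT].
  exists M; split; first exact: num_real.
  by move=> r Mr x _ /=; exact: le_trans (fM x) (ltW Mr).
by have := integrableMr measurableT mf fb gi.
Qed.

Lemma Rintegral_restrict (A : set T) f :
  \int[P]_(x in A) f x = \int[P]_x (\1_A x * f x).
Proof.
rewrite Rintegral_mkcond; apply: eq_Rintegral => x _.
by rewrite patchE indicE; case: ifP => _; rewrite ?mul1r ?mul0r.
Qed.

End bounded_integrals.

Lemma Rintegral_distribution d d' (T : measurableType d)
    (T' : measurableType d') (R : realType) (P : probability T R)
    (X : {mfun T >-> T'}) (f : T' -> R) : measurable_fun [set: T'] f ->
  P.-integrable [set: T] (EFin \o (f \o X)) ->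
  (\int[distribution P X]_y f y = \int[P]_x f (X x))%R.
Proof.
move=> mf fi; congr fine; rewrite integral_pushforward//.
exact/measurable_EFinP.
Qed.

Lemma integrable_distribution d d' (T : measurableType d)
    (T' : measurableType d') (R : realType) (P : probability T R)
    (X : {mfun T >-> T'}) (f : T' -> R) : measurable_fun [set: T'] f ->
  P.-integrable [set: T] (EFin \o (f \o X)) ->
  (distribution P X).-integrable [set: T'] (EFin \o f).
Proof.
move=> mf fi; apply: integrable_pushforward => //; exact/measurable_EFinP.
Qed.

Section simple_function_induction.
Import HBSimple HBNNSimple.

(** A functional monotone class argument: linear combinations of indicators give the simple
    functions, bounded limits give the nonnegative functions, and a shift by the bound gives the
    rest. The uniform bound in the limit clause is there for dominated convergence. *)
Lemma bounded_measurable_ind d (T : measurableType d) (R : realType)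
    (C : (T -> R) -> Prop) :
  (forall A, measurable A -> C \1_A) ->
  (forall (k : R) f g, C f -> C g -> C (fun x => k * f x + g x)%R) ->
  (forall (f_ : nat -> T -> R) (f : T -> R) (M : R),
    (forall n, measurable_fun [set: T] (f_ n)) -> measurable_fun [set: T] f ->
    (forall n x, `|f_ n x| <= M)%R -> (forall x, f_ ^~ x @ \oo --> f x) ->
    (forall n, C (f_ n)) -> C f) ->
  forall (f : T -> R) (M : R), measurable_fun [set: T] f -> (forall x, `|f x| <= M)%R ->
    C f.
Proof.
move=> C1 CL Clim.
have C0 : C (fun=> 0%R).
  by have := C1 set0 measurable0; rewrite indic0.
have pos (f : T -> R) (M : R) : measurable_fun [set: T] f -> (forall x, 0 <= f x <= M)%R ->
    C f.
  move=> mf fM; have mEf : measurable_fun setT (EFin \o f).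
    exact/measurable_EFinP.
  pose g := nnsfun_approx measurableT mEf.
  have gf (x : T) : g n x @[n --> \oo] --> f x.
    have := @cvg_nnsfun_approx _ _ _ _ measurableT _ mEf _ x I.
    move=> /(_ (fun x _ => _)) h.
    apply: (@fine_cvg _ _ _ _ (fun n => (g n x)%:E)); apply: h => y.
    by rewrite lee_fin; case/andP: (fM y).
  apply: (Clim (fun n => g n : T -> R) f M) => //.
    move=> n x; rewrite ger0_norm; last exact: fun_ge0.
    have [_ fxM] := andP (fM x); apply: le_trans fxM.
    have nd : nondecreasing_seq (fun n => g n x).
      by move=> m k mk; exact/lefP/nd_nnsfun_approx.
    have -> : f x = limn (fun n => g n x) by apply/esym/cvg_lim => //; exact: gf.
    by apply: nondecreasing_cvgn_le => //; apply/cvg_ex; exists (f x); exact: gf.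
  move=> n; pose s := finmap.enum_fset (fset_set (range (g n))).
  have -> : (g n : T -> R) = (fun x => \sum_(i < size s)
      (s`_i * \1_(g n @^-1` [set s`_i]) x))%R.
    by apply/funext => x; exact: fimfunEord.
  elim: (index_enum _) => [|y r ih].
    by rewrite (_ : (fun x => _) = (fun=> 0%R))//; apply/funext => x; rewrite big_nil.
  rewrite (_ : (fun x => _) = (fun x => (s`_y * \1_(g n @^-1` [set s`_y]) x) +
    \sum_(i <- r) (s`_i * \1_(g n @^-1` [set s`_i]) x))%R).
    by apply: CL => //; exact: C1.
  by apply/funext => x; rewrite big_cons.
move=> f M mf fM.
have CM : C (fun x => f x + M)%R.
  apply: (pos _ (M + M)%R); first exact: measurable_funD.
  by move=> x; have := fM x; rewrite ler_norml; lra.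
have := CL (- M)%R _ _ (C1 setT measurableT) CM; congr C; apply/funext => x.
by rewrite indicT /=; lra.
Qed.

End simple_function_induction.

(** The hypothesis says that [h] has conditional mean 0 given [X]; induction on bounded measurable
    functions extends the orthogonality from indicators to all bounded factors [a (X x)]. *)
Lemma Rintegral_pull_out d d' (T : measurableType d) (T' : measurableType d')
    (R : realType) (P : probability T R) (X : T -> T') (h : T -> R) :
  measurable_fun [set: T] X -> P.-integrable [set: T] (EFin \o h) ->
  (forall B, measurable B -> \int[P]_x (\1_B (X x) * h x) = 0)%R ->
  forall (a : T' -> R) (M : R), measurable_fun [set: T'] a ->
    (forall x, `|a x| <= M)%R -> (\int[P]_x (a (X x) * h x) = 0)%R.
Proof.
move=> mX hi h0 a M ma aM.
pose C (a : T' -> R) := P.-integrable setT (EFin \o (fun x => a (X x) * h x)%R)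
  /\ (\int[P]_x (a (X x) * h x) = 0)%R.
suff [] : C a by [].
apply: (@bounded_measurable_ind _ _ _ C _ _ _ a M) => //.
- move=> A mA; split; last exact: h0.
  apply: (@integrableMbounded _ _ _ _ (\1_A \o X) _ 1%R) => //.
    exact: measurableT_comp.
  by move=> x /=; rewrite indicE; case: (_ \in _); rewrite ?normr1 ?normr0.
- move=> k f g [fi f0] [gi g0]; split.
    have := integrable_addr (integrable_mulr k fi) gi.
    by congr (_.-integrable _ _); apply/funext => x /=; congr EFin; lra.
  rewrite (_ : (fun x => _) = (fun x =>
      k * (f (X x) * h x) + (g (X x) * h x))%R); last first.
    by apply/funext => x; lra.
  rewrite RintegralD//; last exact: integrable_mulr.
  by rewrite RintegralZl// f0 g0 mulr0 addr0.
- move=> f_ f N mf_ mf fN ff C_; split.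
    apply: (@integrableMbounded _ _ _ _ (f \o X) _ N) => //.
      exact: measurableT_comp.
    move=> x /=; have c : `|f_ n (X x)|%R @[n --> \oo] --> `|f (X x)|%R.
      exact: cvg_norm (ff (X x)).
    rewrite -(cvg_lim _ c)//; apply: limr_le; first by apply/cvg_ex; eexists; exact: c.
    exact: nearW.
  have mh := integrable_measurable hi.
  have : (\int[P]_x (f_ n (X x) * h x) @[n --> \oo] -->
          \int[P]_x (f (X x) * h x))%R.
    apply: (@Rintegral_cvg _ _ _ _ _ _ (fun x => N * `|h x|)%R).
    + by move=> n; apply: measurable_funM => //; exact: measurableT_comp.
    + by apply: measurable_funM => //; exact: measurableT_comp.
    + by move=> x; apply: cvgMl; exact: ff.
    + by apply: integrable_mulr; exact: integrable_norm.
    + by move=> n x; rewrite normrM ler_wpM2r.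
  under eq_fun do rewrite (C_ _).2.
  by move=> /cvg_lim <- //; rewrite lim_cst.
Qed.

(** On the tested set [f - g] is positive, so an integral at most 0 makes this set null. Testing
    this single set permits the comparison of functions measurable for a smaller sigma-field, where
    integrals are known only over the sets of that field. *)
Lemma ae_le_of_level_set d (T : measurableType d) (R : realType)
    (P : probability T R) (f g : T -> R) :
  P.-integrable [set: T] (EFin \o f) -> P.-integrable [set: T] (EFin \o g) ->
  (\int[P]_x (\1_[set y | g y < f y] x * f x) <=
    \int[P]_x (\1_[set y | g y < f y] x * g x))%R ->
  {ae P, forall x, f x <= g x}%R.
Proof.
move=> fi gi fg.
have mf := integrable_measurable fi.
have mg := integrable_measurable gi.
pose B := [set x | (g x < f x)%R].
have mB : measurable B.
  by have := measurable_fun_ltr mg mf measurableT (Y := [set true]) Logic.I; rewrite setTI.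
have m1 : measurable_fun setT (\1_B : T -> R) by exact: measurable_indic.
have b1 x : (`|\1_B x : R| <= 1)%R.
  by rewrite indicE; case: (_ \in _); rewrite ?normr1 ?normr0.
have i1 : P.-integrable setT (EFin \o (fun x => \1_B x * f x)%R).
  exact: integrableMbounded b1 fi.
have i2 : P.-integrable setT (EFin \o (fun x => \1_B x * g x)%R).
  exact: integrableMbounded b1 gi.
pose h x := (\1_B x * f x - \1_B x * g x)%R.
have h0 x : (0 <= h x)%R.
  rewrite /h indicE; case: (boolP (x \in B)) => [|_]; last first.
    by rewrite !mul0r subrr.
  by rewrite inE /B /= => /ltW; rewrite !mul1r subr_ge0.
have ih : P.-integrable setT (EFin \o h) by exact: integrable_subr.
have : (\int[P]_x `|(h x)%:E| = 0)%E.
  rewrite (eq_integral (fun x => (h x)%:E)); last first.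
    by move=> x _; rewrite gee0_abs// lee_fin.
  rewrite (EFin_Rintegral ih); congr EFin; apply/eqP; rewrite eq_le.
  by rewrite Rintegral_ge0// andbT RintegralB// subr_le0.
move/ae_eq_integral_abs => /(_ measurableT).
have mh : measurable_fun setT (EFin \o h) by case/integrableP : ih.
move=> /(_ mh); apply: filterS => x /(_ Logic.I)[].
rewrite /h indicE; case: (boolP (x \in B)); rewrite ?inE ?notin_setE /B /=.
  by move=> gf /eqP; rewrite !mul1r subr_eq0 => /eqP ->.
by move=> /negP; rewrite -leNgt.
Qed.

Lemma ae_le_of_indic d (T : measurableType d) (R : realType)
    (P : probability T R) (f g : T -> R) :
  P.-integrable [set: T] (EFin \o f) -> P.-integrable [set: T] (EFin \o g) ->
  (forall B, measurable B ->
    \int[P]_x (\1_B x * f x) <= \int[P]_x (\1_B x * g x))%R ->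
  {ae P, forall x, f x <= g x}%R.
Proof.
move=> fi gi fg; apply: ae_le_of_level_set => //; apply: fg.
have mf := integrable_measurable fi.
have mg := integrable_measurable gi.
by have := measurable_fun_ltr mg mf measurableT (Y := [set true]) Logic.I; rewrite setTI.
Qed.

(** * Densities and setwise limits *)

Lemma pr_le d (T : measurableType d) (R : realType)
    (P : probability T R) (A B : set T) : measurable A -> measurable B ->
  A `<=` B -> (pr P A <= pr P B)%R.
Proof.
by move=> mA mB AB; rewrite /pr fine_le ?fin_num_measure// le_measure ?inE.
Qed.

Lemma prU d (T : measurableType d) (R : realType)
    (P : probability T R) (A B : set T) : measurable A -> measurable B ->
  [disjoint A & B] -> (pr P (A `|` B) = pr P A + pr P B)%R.
Proof.
move=> mA mB /disj_setPS AB.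
rewrite /pr measureU// ?fineD ?fin_num_measure//.
by apply/seteqP; split.
Qed.

Lemma pr_sigma_additive d (T : measurableType d) (R : realType)
    (P : probability T R) (F : (set T)^nat) : (forall i, measurable (F i)) ->
  trivIset setT F ->
  (\sum_(0 <= i < n) pr P (F i))%R @[n --> \oo] -->
    pr P (\bigcup_n F n).
Proof.
move=> mF tF.
have mU : measurable (\bigcup_n F n) by exact: bigcupT_measurable.
have h : \sum_(0 <= i < n) P (F i) @[n --> \oo] --> P (\bigcup_n F n).
  exact: measure_semi_sigma_additive.
have e : P (\bigcup_n F n) = (pr P (\bigcup_n F n))%:E.
  by rewrite fineK// fin_num_measure.
rewrite e in h; rewrite /pr.
rewrite (_ : (fun n => _) = fine \o (fun n => \sum_(0 <= i < n) P (F i))%E).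
  exact: fine_cvg h.
apply/funext => n /=; rewrite (eq_bigr (fun i => (pr P (F i))%:E)).
  by rewrite sumEFin.
by move=> i _; rewrite fineK// fin_num_measure.
Qed.

Section dominated_density.
Context d (T : measurableType d) (R : realType).
Variables (P : probability T R) (L : set T -> R).
Hypothesis L_ge0 : forall A, measurable A -> (0 <= L A)%R.
Hypothesis L_le : forall A, measurable A -> (L A <= pr P A)%R.
Hypothesis L_add : forall A B, measurable A -> measurable B ->
  [disjoint A & B] -> (L (A `|` B) = L A + L B)%R.

(** The hypotheses on [L] concern measurable sets, whereas the nonnegativity of a measure is
    required of every set; hence the value 0 elsewhere. *)
Let m (A : set T) : \bar R := (if `[< measurable A >] then L A else 0%R)%:E.

Let mE A : measurable A -> m A = (L A)%:E.
Proof. by move=> mA; rewrite /m; case: asboolP. Qed.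

Let L0 : L set0 = 0%R.
Proof.
have := L_le measurable0; have := L_ge0 measurable0.
by rewrite /pr measure0 /= => ? ?; apply/eqP; rewrite eq_le; apply/andP.
Qed.

Let m0 : m set0 = 0.
Proof. by rewrite mE// L0. Qed.

Let m_ge0 A : 0 <= m A.
Proof. by rewrite /m; case: asboolP => // mA; rewrite lee_fin L_ge0. Qed.

Let sumL (F : (set T)^nat) n : (forall i, measurable (F i)) ->
  trivIset setT F ->
  L (\big[setU/set0]_(i < n) F i) = (\sum_(0 <= i < n) L (F i))%R.
Proof.
move=> mF tF; rewrite big_mkord; elim: n => [|n ih]; first by rewrite !big_ord0.
rewrite !big_ord_recr/= -ih L_add//; first exact: bigsetU_measurable.
apply/disj_setPS => x; rewrite -bigcup_mkord => -[[k /= kn Fkx] Fnx].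
have kn' : k = n by apply: tF => //; exists x.
by rewrite kn' ltnn in kn.
Qed.

(** Finite additivity suffices: the tail of [L] over a disjoint union lies between 0 and the tail of
    [P], which vanishes. *)
Let m_sigma_additive : semi_sigma_additive m.
Proof.
move=> F mF tF mU.
rewrite (_ : (fun n => _) = (fun n => (\sum_(0 <= i < n) L (F i))%R%:E)); last first.
  by apply/funext => n; rewrite -sumEFin; apply: eq_bigr => i _; rewrite mE.
rewrite mE//; apply: cvg_EFin; first exact: nearW.
have PF := @pr_sigma_additive _ _ _ P _ mF tF.
set l := L (\bigcup_n F n).
have tail n : (0 <= l - \sum_(0 <= i < n) L (F i) <=
    pr P (\bigcup_n F n) - \sum_(0 <= i < n) pr P (F i))%R.
  have mS : measurable (\big[setU/set0]_(i < n) F i) by exact: bigsetU_measurable.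
  pose D := \bigcup_n F n `\` \big[setU/set0]_(i < n) F i.
  have mD : measurable D by exact: measurableD.
  have UD : \bigcup_n F n = \big[setU/set0]_(i < n) F i `|` D.
    rewrite setUDr setDv setD0 setUidr// -bigcup_mkord => x [k _ Fkx].
    by exists k.
  have dis : [disjoint \big[setU/set0]_(i < n) F i & D].
    by apply/disj_setPS => x [? []].
  have -> : (\sum_(0 <= i < n) pr P (F i) =
      pr P (\big[setU/set0]_(i < n) F i))%R.
    rewrite big_mkord /pr measure_bigsetU//.
    rewrite [in RHS](eq_bigr (fun i : 'I_n => (pr P (F i))%:E)) ?sumEFin//.
    by move=> i _; rewrite fineK// fin_num_measure.
  rewrite /l UD L_add// prU// sumL//.
  by have := L_ge0 mD; have := L_le mD; lra.
have h0 : (pr P (\bigcup_n F n) - \sum_(0 <= i < n) pr P (F i))%R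
    @[n --> \oo] --> 0%R.
  by rewrite -[X in _ --> X](subrr (pr P (\bigcup_n F n))); apply: cvgB => //; exact: cvg_cst.
suff lim_l : (\sum_(0 <= i < n) L (F i))%R @[n --> \oo] --> l by exact: lim_l.
apply/cvgrPdist_le => /= e e0; move/cvgrPdist_le : h0 => /(_ e e0) h0.
apply: filterS h0 => n; rewrite sub0r normrN /=; apply: le_trans.
have /andP[t0 t1] := tail n.
by rewrite ger0_norm// (le_trans t1)// ler_norm.
Qed.

HB.instance Definition _ := isMeasure.Build _ _ _ m m0 m_ge0 m_sigma_additive.

Let m_fin : fin_num_fun m.
Proof. by move=> A mA; rewrite /m. Qed.

HB.instance Definition _ := Measure_isFinite.Build _ _ _ m m_fin.

(** Domination by [P] gives absolute continuity, hence a Radon-Nikodym density; comparing integrals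
    over all measurable sets shows that it is at most 1 almost everywhere. *)
Lemma dominated_density : exists F : T -> R,
  [/\ measurable_fun [set: T] F, forall x, (0 <= F x <= 1)%R &
    forall A, measurable A -> L A = (\int[P]_x (\1_A x * F x))%R].
Proof.
have mP : m `<< P.
  apply/null_content_dominatesP => A mA PA0; rewrite mE//.
  have := L_le mA; rewrite /pr PA0 /= => LA; congr EFin.
  by apply/eqP; rewrite eq_le LA L_ge0.
have [f [f0 ff fi fE]] := radon_nikodym_sigma_finite mP.
pose g := fine \o f.
have gE : EFin \o g = f by apply/funext => x /=; rewrite fineK.
have gi : P.-integrable setT (EFin \o g) by rewrite gE.
have mg := integrable_measurable gi.
have LE A : measurable A -> L A = (\int[P]_x (\1_A x * g x))%R.
  move=> mA; rewrite -Rintegral_restrict; apply: EFin_inj.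
  rewrite -mE// [LHS]fE// /Rintegral fineK; last first.
    apply: integrable_fin_num => //; apply: integrableS gi => //.
  by rewrite -gE.
have g1 : {ae P, forall x, g x <= 1}%R.
  have i1 : P.-integrable setT (EFin \o cst 1%R).
    by apply: (@bounded_fun_integrable _ _ _ _ _ 1%R) => // x; rewrite normr1.
  apply: (ae_le_of_indic gi i1) => B mB.
  rewrite -LE// (le_trans (L_le mB))// -Rintegral_indic//.
  by under [leRHS]eq_Rintegral do rewrite mulr1.
(* The bounds are wanted at every point, so the density is cut at 1, which changes it on a null set
   only. *)
exists (fun x => Num.min (g x) 1%R); split.
- exact: measurable_minr.
- by move=> x; rewrite ge_min lexx orbT le_min ler01 fine_ge0.
- move=> A mA; rewrite LE//; apply: ae_eq_Rintegral.
  + by apply: measurable_funM => //; exact: measurable_indic.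
  + by apply: measurable_funM; [exact: measurable_indic|exact: measurable_minr].
  + by apply: filterS g1 => x g1; rewrite min_l.
Qed.

End dominated_density.

Local Open Scope ring_scope.

(** The points (u i n)_i lie in a product of unit intervals, compact by Tychonoff, and thus have a
    cluster point [l]. The index [k n] is chosen so that the coordinates up to [n] are within
    1/(n+1) of those of [l]. *)
Lemma diagonal_extraction (R : realType) (u : nat -> nat -> R) :
  (forall i n, 0 <= u i n <= 1)%R ->
  exists2 k : nat -> nat, (forall n, (k n < k n.+1)%N) &
    forall i, cvgn (fun n => u i (k n)).
Proof.
move=> u01.
pose A (i : nat) : set R := `[0%R, 1%R]%classic.
have cA : compact [set f : prod_topology (fun _ : nat => R) | forall i, A i (f i)].
  by apply: tychonoff => i; exact: segment_compact.
pose v (n : nat) : prod_topology (fun _ : nat => R) := fun i => u i n.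
have Av : (v @ \oo) [set f | forall i, A i (f i)].
  by exists 0%N => // n _ i; rewrite /A /= in_itv /= u01.
have [l [_ ll]] := cA (v @ \oo) _ Av.
have pick m N : exists n, (N < n)%N /\
    forall i, (i <= m)%N -> (`|l i - u i n| < m.+1%:R^-1)%R.
  pose B := [set f : prod_topology (fun _ : nat => R) |
    forall i, (i <= m)%N -> (`|l i - f i| < m.+1%:R^-1)%R].
  have nB : nbhs l B.
    suff h M : nbhs l [set f : prod_topology (fun _ : nat => R) |
        forall i, (i < M)%N -> (`|l i - f i| < m.+1%:R^-1)%R] by exact: (h m.+1).
    elim: M => [|M ih]; first by apply: filterS filterT => f _ i; rewrite ltn0.
    have hM : nbhs l [set f : prod_topology (fun _ : nat => R) |
        (`|l M - f M| < m.+1%:R^-1)%R].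
      have nb : nbhs (l M : R) [set y : R | `|l M - y| < m.+1%:R^-1].
        by apply/nbhs_ballP; exists m.+1%:R^-1 => //=; rewrite invr_gt0.
      exact: (@proj_continuous _ (fun _ : nat => R) M l _ nb).
    apply: filterS (filterI ih hM) => f [h1 h2] i; rewrite ltnS leq_eqVlt.
    by case/predU1P => [->|]; [exact: h2|exact: h1].
  have nA : (v @ \oo) (v @` [set n | (N < n)%N]).
    by exists N.+1 => // n /= Nn; exists n.
  have [_ [[n Nn <-] Bn]] := ll _ _ nA nB.
  by exists n; split => // i im; exact: Bn.
have {pick}[f fP] : exists f : nat -> nat -> nat, forall m N, (N < f m N)%N /\
    forall i, (i <= m)%N -> (`|l i - u i (f m N)| < m.+1%:R^-1)%R.
  have h m N := cid (pick m N).
  by exists (fun m N => projT1 (h m N)) => m N; exact: projT2 (h m N).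
pose fix k n := if n is n'.+1 then f n (k n') else f 0%N 0%N.
exists k; first by move=> n; have [] := fP n.+1 (k n).
have kP n i : (i <= n)%N -> `|l i - u i (k n)| < n.+1%:R^-1.
  by case: n => [|n] hn /=; apply: (fP _ _).2.
move=> i; apply/cvg_ex; exists (l i); apply/cvgrPdist_lt => e e0.
near=> n; apply: (@lt_trans _ _ n.+1%:R^-1%R); last first.
  by near: n; exact: near_infty_natSinv_lt (PosNum e0).
by apply: kP; near: n; exact: nbhs_infty_ge.
Unshelve. all: by end_near. Qed.

Lemma cvgn_approx (R : realType) (a : nat -> R) :
  (forall e : R, 0 < e -> exists2 b : nat -> R, cvgn b &
    forall n, `|a n - b n| <= e)%R -> cvgn a.
Proof.
move=> h; apply: cauchy_cvg; apply: cauchy_exP => e e0.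
have [|b /cvg_ex[l bl] ab] := h (e / 2)%R; first by rewrite divr_gt0.
exists l; rewrite /ball /=; near=> n.
change (`|l - a n| < e)%R; rewrite (_ : l - a n = (l - b n) - (a n - b n))%R; last by lra.
rewrite (le_lt_trans (ler_normB _ _))// [ltRHS]splitr ltr_leD//.
by near: n; move/cvgrPdist_lt : bl; apply; rewrite divr_gt0.
Unshelve. all: by end_near. Qed.

Definition rational_rays (R : realType) : set (set R) :=
  [set A | exists q : rat, A = `]-oo, ratr q]%classic].

Lemma measurable_rational_rays (R : realType) :
  @measurable _ R = <<s @rational_rays R >>.
Proof.
apply/seteqP; split; last first.
  apply: smallest_sub; first exact: sigma_algebra_measurable.
  by move=> _ [q ->]; exact: measurable_itv.
have -> : @measurable _ R = <<s @RGenCInfty.G R >> := RGenCInfty.measurableE R.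
apply: smallest_sub.
  exact: smallest_sigma_algebra.
move=> _ [x ->].
have -> : `[x, +oo[%classic = ~` \bigcup_(q in [set q : rat | ratr q < x])
    `]-oo, (ratr q : R)]%classic.
  apply/seteqP; split => y /=; rewrite in_itv /= ?andbT.
    by move=> xy [q /= qx]; rewrite in_itv /=; lra.
  move=> h; rewrite leNgt; apply/negP => yx; apply: h.
  have [q] := rat_in_itvoo yx; rewrite in_itv /= => /andP[yq qx].
  by exists q => //=; rewrite in_itv /= ltW.
rewrite bigcup_mkcond.
pose S : measurableType _ := g_sigma_algebraType (@rational_rays R).
apply: (@measurableC _ S); apply: (@bigcupT_measurable_rat _ S) => q.
case: ifPn => _; last exact: measurable0.
by apply: sub_sigma_algebra; exists q.
Qed.

Lemma rational_rays_setI (R : realType) : setI_closed (@rational_rays R).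
Proof.
move=> _ _ [q ->] [r ->]; exists (Num.min q r); apply/seteqP; split => y /=;
  rewrite !in_itv /=.
  by case=> yq yr; case: (leP q r).
move=> h; split; apply: (le_trans h); rewrite ler_rat ge_min lexx ?orbT//.
Qed.

Lemma pr_tail d (T : measurableType d) (R : realType) (P : probability T R)
    (F : (set T)^nat) : (forall i, measurable (F i)) -> trivIset setT F ->
  pr P (\bigcup_n F n `\` \big[setU/set0]_(i < n) F i) @[n --> \oo] --> 0%R.
Proof.
move=> mF tF.
have PF := @pr_sigma_additive _ _ _ P _ mF tF.
rewrite (_ : (fun n => _) = (fun n => pr P (\bigcup_n F n) -
    \sum_(0 <= i < n) pr P (F i))%R).
  rewrite -[X in _ --> X](subrr (pr P (\bigcup_n F n))).
  by apply: cvgB => //; exact: cvg_cst.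
apply/funext => n.
have mU : measurable (\bigcup_n F n) by exact: bigcupT_measurable.
have mS : measurable (\big[setU/set0]_(i < n) F i) by exact: bigsetU_measurable.
have -> : (\sum_(0 <= i < n) pr P (F i) =
    pr P (\big[setU/set0]_(i < n) F i))%R.
  rewrite big_mkord /pr measure_bigsetU//.
  rewrite [in RHS](eq_bigr (fun i : 'I_n => (pr P (F i))%:E)) ?sumEFin//.
  by move=> i _; rewrite fineK// fin_num_measure.
apply/eqP; rewrite eq_sym subr_eq addrC -prU//; last 2 first.
- exact: measurableD.
- by apply/disj_setPS => x [? []].
apply/eqP; congr (pr P _).
rewrite setUDr setDv setD0 setUidr// -bigcup_mkord => x [k _ Fkx].
by exists k.
Qed.

Section setwise_convergence.
Local Open Scope ring_scope.
Context (R : realType) (P : probability R R) (L_ : nat -> set R -> R).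
Hypothesis L_bd : forall n A, measurable A -> 0 <= L_ n A <= pr P A.
Hypothesis L_add : forall n A B, measurable A -> measurable B ->
  [disjoint A & B] -> L_ n (A `|` B) = L_ n A + L_ n B.
Hypothesis L_setT : cvgn (L_ ^~ [set: R]).
Hypothesis L_rays : forall q : rat, cvgn (L_ ^~ `]-oo, ratr q]%classic).

(** The sets on which the sequence converges form a Dynkin system. For a countable disjoint union,
    the tails are bounded by those of [P], uniformly in [n], so the sequence is uniformly close to
    convergent ones. *)
Lemma setwise_cvg B : measurable B -> cvgn (L_ ^~ B).
Proof.
move=> mB.
apply: (@dynkin_induction _ R (@rational_rays R) (fun B => cvgn (L_ ^~ B))) => //.
- exact: measurable_rational_rays.
- exact: rational_rays_setI.
- by move=> _ [q ->]; exact: L_rays.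
- move=> S mS cS.
  have -> : L_ ^~ (~` S) = (fun n => L_ n [set: R] - L_ n S).
    apply/funext => n; have := L_add n mS (measurableC mS).
    rewrite setUv => ->; first by rewrite addrAC subrr add0r.
    by apply/disj_setPS => x [].
  exact: is_cvgB.
- move=> F mF tF cF; apply: cvgn_approx => e e0.
  have /cvgrPdist_le/(_ e e0)[N _ /(_ N (leqnn N))] := pr_tail P mF tF.
  rewrite sub0r normrN /= => hN.
  have mU : measurable (\bigcup_n F n) by exact: bigcupT_measurable.
  have mS : measurable (\big[setU/set0]_(i < N) F i) by exact: bigsetU_measurable.
  have mD := measurableD mU mS.
  have L0 n : L_ n set0 = 0.
    have := L_bd n measurable0; rewrite /pr measure0 /= => h.
    by apply/eqP; rewrite eq_le andbC.
  exists (L_ ^~ (\big[setU/set0]_(i < N) F i)).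
    have -> : L_ ^~ (\big[setU/set0]_(i < N) F i) =
        (fun n => \sum_(i < N) L_ n (F i)).
      apply/funext => n; elim: N {hN mS mD} => [|N ih]; first by rewrite !big_ord0.
      rewrite !big_ord_recr/= -ih L_add//; first exact: bigsetU_measurable.
      apply/disj_setPS => x; rewrite -bigcup_mkord => -[[k /= kn Fkx] Fnx].
      have kn' : k = N by apply: tF => //; exists x.
      by rewrite kn' ltnn in kn.
    elim: N {hN mS mD} => [|N ih].
      by under eq_fun do rewrite big_ord0; exact: is_cvg_cst.
    by under eq_fun do rewrite big_ord_recr/=; exact: is_cvgD.
  move=> n; set S := \big[setU/set0]_(i < N) F i in hN mS mD *.
  have -> : \bigcup_n F n = S `|` (\bigcup_n F n `\` S).
    rewrite setUDr setDv setD0 setUidr// /S -bigcup_mkord => x [k _ Fkx].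
    by exists k.
  rewrite L_add//; last by apply/disj_setPS => x [? []].
  rewrite addrAC subrr add0r; have /andP[h1 h2] := L_bd n mD.
  by rewrite ger0_norm// (le_trans h2)// (le_trans (ler_norm _)).
- by rewrite -measurable_rational_rays.
Qed.

End setwise_convergence.

(** * Topology and measurability in the plane *)

Section product_topology_measurability.
Local Open Scope ring_scope.
Variable R : realType.

Lemma nbhs_prodP (p : R * R) (A : set (R * R)) : nbhs p A ->
  exists2 e : R, 0 < e & forall p' : R * R, `|p.1 - p'.1| < e ->
    `|p.2 - p'.2| < e -> A p'.
Proof.
move=> /nbhs_ballP[e /= e0 eA]; exists e => // p' h1 h2; apply: eA.
by split; rewrite /= /ball /=.
Qed.

(** The product topology and the product sigma-field meet in the boxes with rational corners:
    countably many of them fill an open set. *)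
Lemma open_prod_measurable (U : set (R * R)) : open U -> measurable U.
Proof.
move=> oU.
pose box (t : rat * rat * (rat * rat)) : set (R * R) :=
  `]ratr t.1.1, ratr t.1.2[%classic `*` `]ratr t.2.1, ratr t.2.2[%classic.
have -> : U = \bigcup_t (if `[< box t `<=` U >] then box t else set0).
  apply/seteqP; split => [p Up|p [t _]]; last by case: asboolP => // + bp; exact.
  have [e e0 eU] := nbhs_prodP (open_nbhs_nbhs (conj oU Up)).
  have pe x : x - e < x by lra.
  have ep x : x < x + e by lra.
  have [q1 /[!in_itv]/= /andP[a1 a2]] := rat_in_itvoo (pe p.1).
  have [q2 /[!in_itv]/= /andP[a3 a4]] := rat_in_itvoo (ep p.1).
  have [q3 /[!in_itv]/= /andP[a5 a6]] := rat_in_itvoo (pe p.2).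
  have [q4 /[!in_itv]/= /andP[a7 a8]] := rat_in_itvoo (ep p.2).
  exists ((q1, q2), (q3, q4)) => //; case: asboolP => [_|].
    by split => /=; rewrite in_itv /=; apply/andP.
  case=> -[x y] [/= ] /[!in_itv]/= /andP[b1 b2] /andP[b3 b4].
  by apply: eU => /=; rewrite ltr_norml; apply/andP; split; lra.
apply: countable_bigcupT_measurable; first exact: countableP.
move=> t; case: asboolP => _ //.
by apply: measurableX; exact: measurable_itv.
Qed.

Lemma continuous_in_measurable (D : set (R * R)) (f : R * R -> R) : open D ->
  {within D, continuous f} -> measurable_fun [set: R * R] (f \_ D).
Proof.
move=> oD; rewrite continuous_open_subspace// => cf.
apply/(measurable_restrictT _ (open_prod_measurable oD)).
apply: (measurability _ (RGenOpens.measurableE R)).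
move=> _ [_ [a [b ->] <-]]; apply: open_prod_measurable.
by move/(continuous_inP _ oD) : cf; apply; exact: interval_open.
Qed.

(** Heine's argument, with a separate condition on each coordinate because test functions are later
    compared with step functions on a grid of rectangles. *)
Lemma box_uniform_continuity (D : set (R * R)) (f : R * R -> R) (K : set (R * R)) :
  open D -> {within D, continuous f} -> compact K -> K `<=` D ->
  forall e : R, 0 < e -> exists2 r : R, 0 < r & forall p p', K p ->
    `|p.1 - p'.1| < r -> `|p.2 - p'.2| < r -> `|f p - f p'| < e.
Proof.
move=> oD; rewrite continuous_open_subspace// => cf cK KD e e0.
move/compact_near_coveringP : cK => cK.
pose Q (r : R) (p : R * R) := forall p' : R * R, `|p.1 - p'.1| < r ->
  `|p.2 - p'.2| < r -> `|f p - f p'| < e.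
have cov p : K p -> \forall p' \near p & r \near (0 : R)^'+, Q r p'.
  move: p => p0 Kp0.
  have /cvgrPdist_lt/(_ (e / 2)) : f @ p0 --> f p0.
    by apply: cf; rewrite inE; exact: KD.
  rewrite divr_gt0// => /(_ isT)/nbhs_prodP[d d0 hd].
  have d2 : 0 < d / 2 by rewrite divr_gt0.
  exists (ball p0 (d / 2), [set r : R | r < d / 2]); first split => /=.
  - exact: nbhsx_ballx.
  - exact: nbhs_right_lt.
  move=> [p r] [/= [+ +] rd] p'; rewrite /ball /= => h1 h2 h3 h4.
  rewrite (_ : f p - f p' = (f p0 - f p') - (f p0 - f p)); last by ring.
  rewrite (le_lt_trans (ler_normB _ _))// [ltRHS]splitr ltrD//.
    apply: hd.
      rewrite (_ : p0.1 - p'.1 = (p0.1 - p.1) + (p.1 - p'.1)); last by ring.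
      by rewrite (le_lt_trans (ler_normD _ _))// [ltRHS]splitr ltrD// (lt_trans h3).
    rewrite (_ : p0.2 - p'.2 = (p0.2 - p.2) + (p.2 - p'.2)); last by ring.
    by rewrite (le_lt_trans (ler_normD _ _))// [ltRHS]splitr ltrD// (lt_trans h4).
  by apply: hd; [apply: lt_trans h1 _|apply: lt_trans h2 _];
    rewrite ltr_pdivrMr// ltr_pMr// ltr1n.
have [r [r0 hr]] : exists r : R, 0 < r /\ K `<=` Q r.
  have h := cK R _ Q _ cov.
  near (0 : R)^'+ => r; exists r; split; near: r; first exact: nbhs_right_gt.
  exact: h.
by exists r => // p p' Kp; exact: hr.
Unshelve. all: by end_near. Qed.

End product_topology_measurability.

Definition rat_ray (R : realType) (q : rat) : set R := `]-oo, ratr q]%classic.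
Arguments rat_ray : clear implicits.

Lemma measurable_rat_ray (R : realType) q : measurable (rat_ray R q).
Proof. exact: measurable_itv. Qed.

Lemma indic_norm_le1 (T : Type) (R : realType) (A : set T) (x : T) :
  `|\1_A x : R| <= 1.
Proof. by rewrite indicE; case: (_ \in _); rewrite ?normr1 ?normr0. Qed.

Lemma integrable_indicr d (T : measurableType d) (R : realType)
    (P : probability T R) (A : set T) : measurable A ->
  P.-integrable setT (EFin \o (\1_A : T -> R)).
Proof.
move=> mA; apply: (@bounded_fun_integrable _ _ _ _ _ 1).
  exact: measurable_indic.
exact: indic_norm_le1.
Qed.

Lemma integrable_cstr d (T : measurableType d) (R : realType)
    (P : probability T R) (r : R) : P.-integrable setT (EFin \o (fun=> r)).
Proof. by apply: (@bounded_fun_integrable _ _ _ _ _ `|r|). Qed.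

Lemma Rintegral_sum_indic d (T : measurableType d) (R : realType)
    (P : probability T R) (J : finType) (C : J -> set T) (a : J -> R) :
  (forall j, measurable (C j)) ->
  P.-integrable setT (EFin \o (fun z => \sum_j a j * \1_(C j) z)) /\
  \int[P]_z (\sum_j a j * \1_(C j) z) = \sum_j a j * pr P (C j).
Proof.
move=> mC; have i1 j := integrable_indicr P (mC j).
elim: (index_enum J) => [|j s [ih1 ih2]].
  rewrite big_nil (_ : (fun z => _) = cst 0); last first.
    by apply/funext => z; rewrite big_nil.
  by split; [exact: integrable0|rewrite Rintegral_cst1].
rewrite big_cons (_ : (fun z => _) = (fun z => a j * \1_(C j) z +
    \sum_(i <- s) a i * \1_(C i) z)); last first.
  by apply/funext => z; rewrite big_cons.
split; first by apply: integrable_addr => //; exact: integrable_mulr.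
rewrite RintegralD//; last exact: integrable_mulr.
by rewrite RintegralZl// Rintegral_indic// ih2.
Qed.

Lemma pr_le_sum d (T : measurableType d) (R : realType)
    (P : probability T R) (J : finType) (C : J -> set T) (Q : set T) :
  (forall j, measurable (C j)) -> measurable Q ->
  (forall z, Q z -> exists j, C j z) -> pr P Q <= \sum_j pr P (C j).
Proof.
move=> mC mQ QC; have [is1 s1] := Rintegral_sum_indic P (fun=> 1) mC.
under [leRHS]eq_bigr do rewrite -[pr _ _]mul1r.
rewrite -s1 -Rintegral_indic//; apply: le_Rintegral => //.
  exact: integrable_indicr.
move=> z _; have s0 (K : pred J) : 0 <= \sum_(j | K j) 1 * \1_(C j) z :> R.
  by apply: sumr_ge0 => j _; rewrite mul1r indicE.
rewrite indicE; case: (boolP (z \in Q)) => [|_]; last exact: s0.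
rewrite inE => /QC[j Cjz].
by rewrite (bigD1 j)//= indicE mem_set// mul1r lerDl.
Qed.

Lemma pr_setI_ge d (T : measurableType d) (R : realType)
    (P : probability T R) (A B : set T) : measurable A -> measurable B ->
  pr P A + pr P B - 1 <= pr P (A `&` B).
Proof.
move=> mA mB; have mAB := measurableI _ _ mA mB.
have iA := integrable_indicr P mA; have iB := integrable_indicr P mB.
rewrite -!Rintegral_indic// -[X in _ - X](Rintegral_cst1 P) -RintegralD//.
rewrite -RintegralB//; last 2 first.
- exact: integrable_addr.
- exact: integrable_cstr.
apply: le_Rintegral => //.
- by apply: integrable_subr; [exact: integrable_addr|exact: integrable_cstr].
- exact: integrable_indicr.
move=> z _; rewrite !indicE in_setI.
by case: (z \in A); case: (z \in B) => /=; lra.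
Qed.

(** The term [e] is the error on the cells; off the cells the step function is 0, so [M] times the
    missing mass covers the rest. *)
Lemma Rintegral_step_approx d (T : measurableType d) (R : realType)
    (P : probability T R) (h : T -> R) (M e : R) (J : finType)
    (C : J -> set T) (c : J -> R) :
  measurable_fun [set: T] h -> (forall z, `|h z| <= M) -> 0 <= e ->
  (forall j, measurable (C j)) ->
  (forall i j z, C i z -> C j z -> i = j) ->
  (forall j z, C j z -> `|h z - c j| <= e) ->
  `|\int[P]_z h z - \sum_j c j * pr P (C j)| <=
    e + M * (1 - \sum_j pr P (C j)).
Proof.
move=> mh hM e0 mC dC hc.
have ih : P.-integrable setT (EFin \o h) by exact: bounded_fun_integrable hM.
have sumi a := Rintegral_sum_indic P a mC.
have ic := integrable_cstr P.
rewrite -(sumi c).2; apply: (le_trans (Rintegral_dist ih (sumi c).1)).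
have -> : e + M * (1 - \sum_j pr P (C j)) =
    \int[P]_z (e + M * (1 - \sum_j 1 * \1_(C j) z)).
  rewrite RintegralD//; last first.
    by apply: integrable_mulr; apply: integrable_subr => //; exact: (sumi _).1.
  rewrite Rintegral_cst1 RintegralZl//; last first.
    by apply: integrable_subr => //; exact: (sumi _).1.
  rewrite RintegralB//; last exact: (sumi _).1.
  rewrite Rintegral_cst1 (sumi (fun=> 1)).2.
  by under [X in _ = _ + _ * (_ - X)]eq_bigr do rewrite mul1r.
apply: le_Rintegral => //.
- by apply: integrable_norm; apply: integrable_subr => //; exact: (sumi _).1.
- apply: integrable_addr => //; apply: integrable_mulr.
  by apply: integrable_subr => //; exact: (sumi _).1.
move=> z _.
have [[j Cjz]|nC] := pselect (exists j, C j z).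
  have sE (a : J -> R) : \sum_i a i * \1_(C i) z = a j.
    rewrite (bigD1 j)//= indicE mem_set// mulr1 big1 ?addr0// => i ij.
    rewrite indicE memNset ?mulr0// => Ciz.
    by rewrite (dC _ _ _ Ciz Cjz) eqxx in ij.
  by rewrite !sE subrr mulr0 addr0; exact: hc.
have sE (a : J -> R) : \sum_i a i * \1_(C i) z = 0.
  rewrite big1// => i _; rewrite indicE memNset ?mulr0// => Ciz.
  by apply: nC; exists i.
by rewrite !sE !subr0 mulr1 (le_trans (hM z))// lerDr.
Qed.

(** * Weak compactness of couplings *)

(* A version of nu_ (k n) disintegrated along the second coordinate: F q y is
   the limit conditional probability of {x <= q} given y. *)
Lemma coupling_subsequence (R : realType) (P : probability R R)
    (nu_ : nat -> probability (R * R)%type R) :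
  (forall n B, measurable B -> nu_ n (snd @^-1` B) = P B) ->
  exists k : nat -> nat, exists F : rat -> R -> R,
  [/\ forall n, (k n < k n.+1)%N,
      forall q, measurable_fun [set: R] (F q),
      forall q y, 0 <= F q y <= 1,
      forall q q' y, q <= q' -> F q y <= F q' y &
      forall q B, measurable B ->
        pr (nu_ (k n)) (rat_ray R q `*` B) @[n --> \oo] -->
          \int[P]_y (\1_B y * F q y)].
Proof.
move=> nuP.
(* An enumeration of the countably many rectangles used in the extraction: the code (q, None) stands
   for a ray times the whole line, (q, Some r) for a product of two rays. *)
pose c (i : nat) : rat * option rat := odflt (0, None) (unpickle i).
have cE p : c (pickle p) = p by rewrite /c pickleK.
pose E (o : option rat) : set R :=
  if o is Some r then rat_ray R r else setT.
have mE o : measurable (E o).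
  by case: o => [r|] //=; exact: measurable_rat_ray.
pose u i n := pr (nu_ n) (rat_ray R (c i).1 `*` E (c i).2).
have pr01 n (A : set (R * R)) : measurable A -> 0 <= pr (nu_ n) A <= 1.
  move=> mA; apply/andP; split; first by rewrite /pr fine_ge0.
  rewrite -lee_fin /pr fineK ?fin_num_measure//; exact: probability_le1.
have [|k kS kc] := @diagonal_extraction _ u.
  move=> i n; apply: pr01; apply: measurableX => //.
  exact: measurable_rat_ray.
have mrect (q : rat) (B : set R) : measurable B ->
    measurable (rat_ray R q `*` B) by move=> mB; apply: measurableX => //; exact: measurable_rat_ray.
have dom n (q : rat) (B : set R) : measurable B ->
    pr (nu_ n) (rat_ray R q `*` B) <= pr P B.
  move=> mB; rewrite /pr -(nuP n)//; apply: pr_le => //.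
  - exact: mrect.
  - exact: (measurable_preimage measurable_snd).
  - by move=> z [].
have add n (q : rat) (A B : set R) : measurable A -> measurable B ->
    [disjoint A & B] -> pr (nu_ n) (rat_ray R q `*` (A `|` B)) =
    pr (nu_ n) (rat_ray R q `*` A) + pr (nu_ n) (rat_ray R q `*` B).
  move=> mA mB /disj_setPS AB; rewrite -prU.
  - congr (pr _ _); apply/seteqP; split => z /=.
      by case=> h [?|?]; [left|right].
    by case=> -[h ?]; split => //; [left|right].
  - exact: mrect.
  - exact: mrect.
  - by apply/disj_setPS => z [[_ ?] [_ ?]]; apply: (AB z.2).
have cv q B : measurable B ->
    cvgn (fun n => pr (nu_ (k n)) (rat_ray R q `*` B)).
  (* For fixed [q] the masses are additive in [B] and at most [P B], by the second marginal, so
     convergence on rays extends to all Borel sets. *)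
  move=> mB; apply: (@setwise_cvg _ P
    (fun n B => pr (nu_ (k n)) (rat_ray R q `*` B))) => //.
  - move=> n A mA; rewrite dom// andbT.
    by have /andP[] := pr01 (k n) _ (mrect q _ mA).
  - by move=> n A B' mA mB'; exact: add.
  - by have := kc (pickle (q, None : option rat)); rewrite /u cE.
  - by move=> r; have := kc (pickle (q, Some r)); rewrite /u cE.
pose L q B := limn (fun n => pr (nu_ (k n)) (rat_ray R q `*` B)).
have Lc q B : measurable B ->
    pr (nu_ (k n)) (rat_ray R q `*` B) @[n --> \oo] --> L q B.
  by move=> mB; exact: cv.
have dens q : exists F : R -> R, [/\ measurable_fun [set: R] F,
    forall x, 0 <= F x <= 1 &
    forall B, measurable B -> L q B = \int[P]_x (\1_B x * F x)].
  apply: dominated_density.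
  - move=> A mA; apply: limr_ge; first exact: cv.
    by apply: nearW => n; have /andP[] := pr01 (k n) _ (mrect q _ mA).
  - move=> A mA; apply: limr_le; first exact: cv.
    by apply: nearW => n; exact: dom.
  - move=> A B mA mB AB; rewrite /L -limD//; try exact: cv.
    by congr (limn _); apply/funext => n; rewrite add.
have [F FP] := choice dens.
have mF q : measurable_fun setT (F q) by have [] := FP q.
have F01 q x : 0 <= F q x <= 1 by have [_ ] := FP q.
have FE q B : measurable B -> L q B = \int[P]_x (\1_B x * F q x).
  by move=> mB; have [_ _ ->] := FP q.
have iF q : P.-integrable setT (EFin \o F q).
  apply: (@bounded_fun_integrable _ _ _ _ _ 1) => // x.
  by have /andP[h1 h2] := F01 q x; rewrite ger0_norm.
(* There are countably many pairs of rationals, so one null set serves for all of them. *)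
have mono : {ae P, forall y, forall q q', q <= q' -> F q y <= F q' y}.
  pose d (i : nat) : rat * rat := odflt (0, 0) (unpickle i).
  have : {ae P, forall y, forall i, (d i).1 <= (d i).2 ->
      F (d i).1 y <= F (d i).2 y}.
    apply/ae_foralln => i; case: (d i) => q q' /=.
    case: (leP q q') => [qq'|_]; last by apply: aeW.
    have : {ae P, forall y, F q y <= F q' y}.
      apply: ae_le_of_indic => // B mB; rewrite -!FE//.
      apply: ler_lim; [exact: cv|exact: cv|apply: nearW => n].
      apply: pr_le; [exact: mrect|exact: mrect|].
      move=> z [h Bz]; split => //; move: h; rewrite /rat_ray /= !in_itv/=.
      by move=> h; rewrite (le_trans h)// ler_rat.
    by apply: filterS.
  apply: filterS => y h q q' qq'.
  by have := h (pickle (q, q')); rewrite /d pickleK; exact.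
have [N [mN N0 NE]] := mono.
(* Setting every [F q] to 0 on the exceptional null set makes the monotonicity in [q] hold at every
   point. *)
pose G q y := \1_(~` N) y * F q y.
have mG q : measurable_fun setT (G q).
  by apply: measurable_funM => //; apply: measurable_indic; exact: measurableC.
exists k, G; split => //.
- move=> q y; rewrite /G indicE.
  by case: (_ \in _); rewrite ?mul1r ?mul0r ?lexx ?ler01.
- move=> q q' y qq'; rewrite /G indicE.
  case: (boolP (y \in ~` N)); rewrite ?mul0r// !mul1r inE => yN.
  apply: contrapT => h; apply: yN; apply: NE => h'; apply: h; exact: h'.
- move=> q B mB; have := Lc q B mB; rewrite FE//.
  suff -> : \int[P]_x (\1_B x * F q x) = \int[P]_x (\1_B x * G q x) by [].
  apply: ae_eq_Rintegral.
  + by apply: measurable_funM => //; exact: measurable_indic.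
  + by apply: measurable_funM => //; exact: measurable_indic.
  + exists N; split => // y h; apply: contrapT => yN; apply: h => /=.
    by rewrite /G [\1_(~` N) y]indicE mem_set// mul1r.
Qed.

Section quantile_coupling.
Context (R : realType) (P : probability R R) (F : rat -> R -> R).
Hypothesis mF : forall q, measurable_fun [set: R] (F q).
Hypothesis F01 : forall q y, 0 <= F q y <= 1.
Hypothesis F_nd : forall q q' y, q <= q' -> F q y <= F q' y.

(** The uniform law lives on [measurableTypeR R]; its image under the identity is a probability on
    [R]. *)
Let idTR : measurableTypeR R -> R := idfun.

#[local] HB.instance Definition _ :=
  @isMeasurableFun.Build _ _ _ _ idTR (@measurable_id _ _ setT).

Let U : probability R R :=
  distribution (uniform_prob (@ltr01 R) : probability _ R) idTR.
Let Om : set (R * R) -> \bar R := (P \x U)%E.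

HB.instance Definition _ := Measure.on Om.

Let Om_setT : Om [set: R * R] = 1%E.
Proof.
have P1 : P setT = 1%E by exact: probability_setT.
have U1 : U setT = 1%E by exact: probability_setT.
transitivity (P setT * U setT)%E; last by rewrite P1 U1 mule1.
by rewrite /Om -setXTT; exact: product_measure1E.
Qed.

HB.instance Definition _ := Measure_isProbability.Build _ _ _ Om Om_setT.

Let OmP : probability (R * R)%type R := Om.

Let enum_rat (n : nat) : rat := odflt 0 (unpickle n).

(** The value +oo discards the rationals that do not enter the infimum. Nothing is assumed on the
    limits of [F] as [q] goes to either infinity, so the infimum may be infinite; [H] is then 0, and
    its value is used only on the events [S] below. *)
Let H0 (n : nat) (z : R * R) : \bar R :=
  if z.2 <= F (enum_rat n) z.1 then (ratr (enum_rat n))%:E else +oo%E.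

(* The generalized inverse of q |-> F q y, evaluated at z = (y, v). *)
Let H (z : R * R) : R := fine (einfs (H0 ^~ z) 0%N).

Let mH : measurable_fun [set: R * R] H.
Proof.
apply: (measurableT_comp (@fine_measurable _ _ measurableT)).
apply: measurable_fun_einfs => n; apply: measurable_fun_ifT => //.
by apply: measurable_fun_ler => //; exact: measurableT_comp.
Qed.

Let A q := [set z : R * R | z.2 <= F q z.1].

Let mA q : measurable (A q).
Proof.
have mb : measurable_fun setT (fun z : R * R => z.2 <= F q z.1).
  by apply: measurable_fun_ler => //; exact: measurableT_comp.
by have := mb measurableT [set true] (Logic.I : measurable [set true]); rewrite setTI.
Qed.

(** The events F q y < v <= F q' y stand in for q < H <= q'. The two may differ at end points, since
    [F] need not be right-continuous in [q], but the mass of the former is computed exactly. *)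
Let S q q' := A q' `\` A q.

Let H_bounds q q' z : S q q' z -> ratr q <= H z <= ratr q'.
Proof.
move=> [Aq' nAq].
have le1 : (einfs (H0 ^~ z) 0%N <= (ratr q')%:E)%E.
  apply: ereal_inf_lbound; exists (pickle q') => //.
  rewrite /H0 /enum_rat pickleK /=; move: Aq'; by rewrite /A /= => ->.
have le2 : ((ratr q)%:E <= einfs (H0 ^~ z) 0%N)%E.
  apply: le_ereal_inf_tmp => _ [n _ <-]; rewrite /H0; case: ifPn => h; last first.
    by rewrite leey.
  rewrite lee_fin ler_rat leNgt; apply/negP => nq; apply: nAq.
  by rewrite /A /= (le_trans h)// F_nd// ltW.
by rewrite /H -!lee_fin fineK ?le1 ?le2// fin_numElt; apply/andP; split;
  [exact: lt_le_trans (ltNyr _) le2|exact: le_lt_trans le1 (ltry _)].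
Qed.

Let U_ray (c : R) : 0 <= c <= 1 -> U `]-oo, c]%classic = c%:E.
Proof.
move=> /andP[c0 c1]; rewrite /U /distribution /pushforward /= /uniform_prob integral_uniform_pdf.
have -> : `]-oo, c] `&` `[0, 1] = `[0, c]%classic :> set R.
  apply/seteqP; split => x /=; rewrite !in_itv /=.
    by case=> -> /andP[->].
  by move=> /andP[-> xc]; rewrite xc (le_trans xc).
rewrite (eq_integral (fun=> 1%E)); last first.
  move=> x; rewrite inE /= in_itv /= => /andP[x0 xc].
  by rewrite /uniform_pdf x0 (le_trans xc)// subr0 invr1.
rewrite integral_cst//= mul1e lebesgue_measure_itv/= lte_fin sube0.
by case: ltP => // c0'; congr EFin; apply/eqP; rewrite eq_le c0 c0'.
Qed.

Let mfst (B : set R) : measurable B -> measurable (fst @^-1` B : set (R * R)).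
Proof. exact: (measurable_preimage measurable_fst). Qed.

Let pr_A q B : measurable B ->
  pr OmP (A q `&` fst @^-1` B) = \int[P]_y (\1_B y * F q y).
Proof.
move=> mB; rewrite /pr /Rintegral; congr fine.
apply: eq_integral => y _ /=.
rewrite (_ : xsection _ y = if y \in B then `]-oo, F q y]%classic else set0).
  case: ifPn => yB; last first.
    by rewrite measure0 indicE (negbTE yB) mul0r.
  by rewrite U_ray ?F01// indicE yB mul1r.
apply/seteqP; split => v; rewrite /xsection /= inE.
  by case=> /= h By; rewrite mem_set// /= in_itv.
case: ifPn => //; rewrite inE /= in_itv /= => By h; split => //.
Qed.

Let pr_S q q' B : q <= q' -> measurable B ->
  pr OmP (S q q' `&` fst @^-1` B) =
    \int[P]_y (\1_B y * F q' y) - \int[P]_y (\1_B y * F q y).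
Proof.
move=> qq' mB; rewrite -!pr_A//; apply/eqP; rewrite eq_sym subr_eq -prU.
- apply/eqP; congr (pr _ _); apply/seteqP; split => z.
    move=> [Aq' Bz]; have [Aq|nAq] := pselect (A q z); first by right.
    by left.
  move=> [[[]]|[]]//; rewrite /A /= => h Bz; split => //=.
  by rewrite (le_trans h)// F_nd.
- by apply: measurableI; [exact: measurableD|exact: mfst].
- by apply: measurableI => //; exact: mfst.
- by apply/disj_setPS => z [[[_ +] _] [+ _]]; exact.
Qed.

(** A uniform variable [v] independent of [y] and a generalized inverse turn conditional
    distribution functions into a first coordinate. This serves for the weak limit of couplings and
    also for realizing a splitting as a coupling. *)
Lemma quantile_coupling : exists (Om : probability (R * R)%type R)
    (h : R * R -> R) (S : rat -> rat -> set (R * R)),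
  [/\ measurable_fun [set: R * R] h,
      forall q q', measurable (S q q'),
      forall q q' z, S q q' z -> ratr q <= h z <= ratr q',
      forall q1 q2 q3 q4 z, q2 <= q3 -> S q1 q2 z -> ~ S q3 q4 z &
      (forall B, measurable B -> pr Om (fst @^-1` B) = pr P B) /\
      forall q q' B, q <= q' -> measurable B ->
        pr Om (S q q' `&` fst @^-1` B) =
          \int[P]_y (\1_B y * F q' y) - \int[P]_y (\1_B y * F q y)].
Proof.
exists OmP, H, S; split => //.
- by move=> q q'; exact: measurableD.
- move=> q1 q2 q3 q4 z q23 [h1 _] [_ h2]; apply: h2.
  by move: h1; rewrite /A /= => h1; rewrite (le_trans h1)// F_nd.
split => [B mB|]; last exact: pr_S.
rewrite /pr; congr fine.
rewrite (_ : fst @^-1` B = B `*` setT); last first.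
  by apply/seteqP; split => z //= [].
have U1 : U setT = 1%E by exact: probability_setT.
by transitivity (P B * U setT)%E; [exact: product_measure1E|rewrite U1 mule1].
Qed.

End quantile_coupling.

Lemma open_setX (T U : topologicalType) (A : set T) (B : set U) :
  open A -> open B -> open (A `*` B).
Proof.
move=> oA oB; rewrite openE => z [Az Bz]; exists (A, B) => //=.
by split; apply: open_nbhs_nbhs.
Qed.

Lemma Cb_restrict (R : realType) (D : set (R * R)) (f : R * R -> R) :
  open D -> Cb D f -> measurable_fun [set: R * R] (f \_ D) /\
    exists2 M : R, 0 <= M & forall z, `|(f \_ D) z| <= M.
Proof.
move=> oD [cf [M [Mr fM]]]; split; first exact: continuous_in_measurable.
exists (`|M| + 1); first by rewrite addr_ge0.
move=> z; rewrite patchE; case: ifPn => [|_]; last by rewrite normr0 addr_ge0.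
by rewrite inE => Dz; apply: fM => //; rewrite ltr_pwDr// ler_norm.
Qed.

Lemma weak_cvg2P (R : realType) (I : set R)
    (nu_ : nat -> probability (R * R)%type R) (nu : probability (R * R)%type R) :
  open I ->
  weak_cvg2 I nu_ nu <-> forall f, @Cb (R * R)%type R (I `*` I) f ->
    \int[nu_ n]_z (f \_ (I `*` I)) z @[n --> \oo] -->
      \int[nu]_z (f \_ (I `*` I)) z.
Proof.
move=> oI; have oII : open (I `*` I) by exact: open_setX.
have E (Q : probability (R * R)%type R) f : @Cb (R * R)%type R (I `*` I) f ->
    (\int[Q]_(x in I `*` I) (f x)%:E)%E = (\int[Q]_z (f \_ (I `*` I)) z)%:E.
  move=> /(Cb_restrict oII)[mf [M M0 fM]].
  rewrite integral_mkcond -EFin_Rintegral; last exact: bounded_fun_integrable fM.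
  by apply: eq_integral => x _; rewrite restrict_EFin.
split => h f Cf; have := h f Cf.
  rewrite E//; under eq_fun do rewrite E//.
  by move/fine_cvg.
move=> hf; rewrite E//; under eq_fun do rewrite E//.
by apply: cvg_EFin; [exact: nearW|exact: hf].
Qed.

Section rational_grid.
Variable R : realType.

Lemma rational_grid (a b : rat) (r : R) : a < b -> 0 < r ->
  exists N (q : nat -> rat), [/\ q 0%N = a, q N = b,
    forall i, q i < q i.+1 & forall i, ratr (q i.+1) - ratr (q i) < r].
Proof.
move=> ab r0; pose N := Num.bound (ratr (b - a) / r).
have ba0 : 0 <= ratr (b - a) / r.
  by apply: divr_ge0; [rewrite ler0q subr_ge0 ltW|exact: ltW].
have N0 : (0 < N)%N.
  rewrite lt0n; apply/negP => /eqP N0.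
  by have := archi_boundP ba0; rewrite -/N N0 ltNge ba0.
have Nq : N%:R != 0 :> rat by rewrite pnatr_eq0 -lt0n.
pose q i : rat := a + (b - a) * i%:R / N%:R.
have qS i : q i.+1 - q i = (b - a) / N%:R by rewrite /q -natr1; field.
exists N, q; split.
- by rewrite /q mulr0 mul0r addr0.
- by rewrite /q mulfK// addrC subrK.
- by move=> i; rewrite -subr_gt0 qS divr_gt0 ?subr_gt0// ltr0n.
- move=> i; rewrite -rmorphB qS fmorph_div rmorph_nat ltr_pdivrMr ?ltr0n//.
  by rewrite mulrC -ltr_pdivrMr//; exact: archi_boundP.
Qed.

Lemma grid_le (q : nat -> rat) : (forall i, q i < q i.+1) ->
  {homo q : i j / (i <= j)%N >-> i <= j}.
Proof. by move=> qS; apply: homo_leq => // [x y z|i]; [exact: le_trans|exact: ltW]. Qed.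

Lemma grid_locate (q : nat -> rat) N (x : R) :
  `]ratr (q 0%N), ratr (q N)]%classic x ->
  exists i : 'I_N, `]ratr (q i), ratr (q i.+1)]%classic x.
Proof.
rewrite /= in_itv/= => /andP[x0 xN].
have ex : exists j, x <= ratr (q j) by exists N.
case: (ex_minnP ex) => j xj jmin.
have jN : (j <= N)%N by exact: jmin.
case: j => [|j] in xj jmin jN *; first by rewrite ltNge xj in x0.
exists (Ordinal jN) => /=; rewrite in_itv/= xj andbT ltNge.
by apply/negP => /jmin; rewrite ltnn.
Qed.

Lemma grid_uniq (q : nat -> rat) (i j : nat) (x : R) :
  (forall i, q i < q i.+1) ->
  `]ratr (q i), ratr (q i.+1)]%classic x ->
  `]ratr (q j), ratr (q j.+1)]%classic x -> i = j.
Proof.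
move=> qS; rewrite /= !in_itv/= => /andP[i1 i2] /andP[j1 j2].
apply/eqP; rewrite eqn_leq; apply/andP; split; rewrite leqNgt; apply/negP => ij.
  have : ratr (q j.+1) <= ratr (q i) :> R by rewrite ler_rat; exact: grid_le.
  by lra.
have : ratr (q i.+1) <= ratr (q j) :> R by rewrite ler_rat; exact: grid_le.
by lra.
Qed.

End rational_grid.

Section coupling_compactness.
Context (R : realType) (I : set R) (P : probability R R).
Variable nu_ : nat -> probability (R * R)%type R.
Hypothesis I_open : open I.
Hypothesis I_itv : is_interval I.
Hypothesis nuP : forall n B, measurable B -> nu_ n (snd @^-1` B) = P B.
Hypothesis tight1 : forall e : R, 0 < e -> exists a b : rat,
  [/\ I (ratr a), I (ratr b), a < b & forall n,
    1 - e <= pr (nu_ n) (fst @^-1` `]ratr a, ratr b])].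
Hypothesis tight2 : forall e : R, 0 < e -> exists c d : rat,
  [/\ I (ratr c), I (ratr d), c < d & 1 - e <= pr P `]ratr c, ratr d]].

Let mitv (a b : rat) : measurable (`]ratr a, ratr b]%classic : set R).
Proof. exact: measurable_itv. Qed.

Let mfst (B : set R) : measurable B -> measurable (fst @^-1` B : set (R * R)).
Proof. exact: (measurable_preimage measurable_fst). Qed.

Let msnd (B : set R) : measurable B -> measurable (snd @^-1` B : set (R * R)).
Proof. exact: (measurable_preimage measurable_snd). Qed.

Let itv_in (a b : rat) (x : R) : I (ratr a) -> I (ratr b) ->
  ratr a <= x <= ratr b -> I x.
Proof. by move=> Ia Ib; exact: I_itv Ia Ib x. Qed.

Let pr_rect n (a b : rat) (B : set R) : a <= b -> measurable B ->
  pr (nu_ n) (`]ratr a, ratr b] `*` B) =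
    pr (nu_ n) (rat_ray R b `*` B) - pr (nu_ n) (rat_ray R a `*` B).
Proof.
move=> ab mB; apply/eqP; rewrite eq_sym subr_eq -prU.
- apply/eqP; congr (pr _ _); rewrite /rat_ray; apply/seteqP.
  split => z /=; rewrite !in_itv/=.
    by move=> [h Bz]; case: (leP z.1 (ratr a)) => h'; [right|left; rewrite h].
  case=> -[h Bz]; split => //; first by case/andP: h.
  by rewrite (le_trans h)// ler_rat.
- exact: measurableX.
- by apply: measurableX => //; exact: measurable_rat_ray.
- apply/disj_setPS => z [[]]; rewrite /rat_ray /= !in_itv/= => /andP[h _] _ [h' _].
  by rewrite ltNge h' in h.
Qed.

(** The limit is the law of (h, y) on the quantile space. The masses of rational rectangles converge
    to those of the matching events, and on a box of nearly full mass a test function is nearly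
    constant on the rectangles of a fine grid. *)
Lemma coupling_weak_compact : exists (k : nat -> nat)
    (nu : probability (R * R)%type R),
  [/\ forall n, (k n < k n.+1)%N, carried_by nu (I `*` I) &
      weak_cvg2 I (nu_ \o k) nu].
Proof.
have [k [F [kS mF F01 F_nd Fcv]]] := coupling_subsequence nuP.
have [Om [h [S [mh mS Sh Sdis [OmP OmS]]]]] := @quantile_coupling _ P _ mF F01 F_nd.
pose g (z : R * R) := (h z, z.1).
have mg : measurable_fun setT g by exact: measurable_fun_pair.
pose Om_g : {mfun (R * R)%type >-> (R * R)%type} := MeasurableFun.Pack
  (MeasurableFun.Class (isMeasurableFun.Build _ _ _ _ _ mg)).
pose nu : probability (R * R)%type R := distribution Om Om_g.
have cell_cvg (a b : rat) B : a <= b -> measurable B ->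
    pr (nu_ (k n)) (`]ratr a, ratr b] `*` B) @[n --> \oo] -->
      pr Om (S a b `&` fst @^-1` B).
  move=> ab mB; rewrite OmS//.
  under eq_fun do rewrite pr_rect//.
  by apply: cvgB; exact: Fcv.
have mII : measurable (I `*` I) by apply: measurableX; exact: open_measurable.
(* One box inside I x I carries almost all the mass of every coupling, and the bound passes to the
   limit events. *)
have box e : 0 < e -> exists a b c d : rat,
  [/\ [/\ I (ratr a), I (ratr b), I (ratr c) & I (ratr d)], a < b, c < d,
    forall n, 1 - e <= pr (nu_ n) (`]ratr a, ratr b] `*` `]ratr c, ratr d]) &
    1 - e <= pr Om (S a b `&` fst @^-1` `]ratr c, ratr d])].
  move=> e0; have e2 : 0 < e / 2 by rewrite divr_gt0.
  have [a [b [Ia Ib ab h1]]] := tight1 e2.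
  have [c [d [Ic Id cd h2]]] := tight2 e2.
  have ge n : 1 - e <= pr (nu_ n) (`]ratr a, ratr b] `*` `]ratr c, ratr d]).
    have := pr_setI_ge (nu_ n) (mfst (mitv a b)) (msnd (mitv c d)).
    have : pr (nu_ n) (snd @^-1` `]ratr c, ratr d]) = pr P `]ratr c, ratr d].
      by rewrite /pr nuP.
    move: (h1 n) => h1n -> h3.
    by have := h3; rewrite (_ : _ `&` _ = `]ratr a, ratr b] `*` `]ratr c, ratr d])//; lra.
  exists a, b, c, d; split => //.
  have cv := cell_cvg _ _ _ (ltW ab) (mitv c d).
  rewrite -(cvg_lim _ cv)//; apply: limr_ge; first by apply/cvg_ex; eexists; exact: cv.
  exact: nearW.
exists k, nu; split => //.
- rewrite /carried_by; suff : pr nu (I `*` I) = 1.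
    move=> h1; rewrite [LHS]probability_setC// -(@fineK _ (nu (I `*` I))) ?fin_num_measure//.
    by rewrite -[fine _]/(pr nu _) h1 subee.
  apply/eqP; rewrite eq_le; apply/andP; split.
    by rewrite -lee_fin /pr fineK ?fin_num_measure//; exact: probability_le1.
  apply/ler_addgt0Pr => e e0; have [a [b [c [d [[Ia Ib Ic Id] ab cd _ he]]]]] := box e e0.
  rewrite -lerBlDr (le_trans he)//.
  apply: (@pr_le _ _ _ Om _ (g @^-1` (I `*` I))).
  + by apply: measurableI => //; exact: mfst.
  + by have := mg measurableT _ mII; rewrite setTI.
  + move=> z [/Sh hz]; rewrite /= in_itv/= => /andP[z1 z2]; split => /=.
      exact: itv_in Ia Ib hz.
    by apply: itv_in Ic Id _; rewrite ltW.
apply/(weak_cvg2P _ _ I_open) => f Cf.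
have oII : open (I `*` I) by exact: open_setX.
have [mf [M M0 fM]] := Cb_restrict oII Cf.
set f' := f \_ (I `*` I) in mf fM *.
have -> : \int[nu]_z f' z = \int[Om]_z f' (g z).
  apply: (Rintegral_distribution (X := Om_g)) => //.
  by apply: bounded_fun_integrable => [|z]; [exact: measurableT_comp|exact: fM].
apply/cvgrPdist_le => e e0.
(* The two step approximations cost at most [(1 + M) * e1] each and the convergence of the sums
   costs [e1], which is within [(5 + 2 * M) * e1]. *)
pose e1 := e / (5 + 2 * M).
have M5 : 0 < 5 + 2 * M by lra.
have e10 : 0 < e1 by rewrite divr_gt0.
have [a [b [c [d [[Ia Ib Ic Id] ab cd he he']]]]] := box e1 e10.
pose K := `[ratr a, ratr b]%classic `*` `[ratr c, ratr d]%classic : set (R * R).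
have cK : compact K by apply: compact_setX; exact: segment_compact.
have KI : K `<=` I `*` I.
  move=> z [/=]; rewrite !in_itv/= => h1 h2; split.
    exact: itv_in Ia Ib h1.
  exact: itv_in Ic Id h2.
have [r r0 hr] := box_uniform_continuity oII Cf.1 cK KI e10.
have [N1 [q [q0 qN qS qr]]] := rational_grid ab r0.
have [N2 [s [s0 sN sS sr]]] := rational_grid cd r0.
have q_in i : (i <= N1)%N -> I (ratr (q i)).
  move=> iN; apply: itv_in Ia Ib _; rewrite !ler_rat -q0 -qN.
  by rewrite !grid_le.
have s_in i : (i <= N2)%N -> I (ratr (s i)).
  move=> iN; apply: itv_in Ic Id _; rewrite !ler_rat -s0 -sN.
  by rewrite !grid_le.
pose J := ('I_N1 * 'I_N2)%type.
pose v (j : J) : R := f' (ratr (q j.1.+1), ratr (s j.2.+1)).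
pose B (j : J) : set R := `]ratr (s j.2), ratr (s j.2.+1)]%classic.
have mB j : measurable (B j) by exact: mitv.
pose C1 (j : J) : set (R * R) := `]ratr (q j.1), ratr (q j.1.+1)] `*` B j.
(* The counterpart of [C1] on the quantile space; its mass is the limit of the masses of [C1]. *)
pose C2 (j : J) : set (R * R) := S (q j.1) (q j.1.+1) `&` fst @^-1` B j.
have mC1 j : measurable (C1 j) by apply: measurableX.
have mC2 j : measurable (C2 j) by apply: measurableI => //; exact: mfst.
have f'E (x x' y y' : R) : I x -> I y -> ratr a <= x' <= ratr b ->
    ratr c <= y' <= ratr d -> `|x - x'| < r -> `|y - y'| < r ->
    `|f' (x', y') - f' (x, y)| <= e1.
  move=> Ix Iy x'ab y'cd xx' yy'; rewrite /f' !patchE !mem_set//; last first.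
    by apply: KI; split; rewrite /= in_itv/=.
  apply/ltW/hr; [by split; rewrite /= in_itv/=|by rewrite distrC|by rewrite distrC].
have near_grid (t : nat -> rat) N i (lo hi : rat) (x : R) :
    (forall i, t i < t i.+1) -> (forall i, ratr (t i.+1) - ratr (t i) < r) ->
    t 0%N = lo -> t N = hi -> (i < N)%N ->
    ratr (t i) <= x <= ratr (t i.+1) ->
    ratr lo <= x <= ratr hi /\ `|ratr (t i.+1) - x| < r.
  move=> tS tr <- <- iN /andP[x1 x2]; split.
    rewrite (le_trans _ x1) ?ler_rat ?grid_le//=.
    by rewrite (le_trans x2)// ler_rat grid_le.
  by rewrite ger0_norm ?subr_ge0//; have := tr i; lra.
have est1 n : `|\int[nu_ (k n)]_z f' z - \sum_j v j * pr (nu_ (k n)) (C1 j)| <=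
    e1 + M * (1 - \sum_j pr (nu_ (k n)) (C1 j)).
  apply: Rintegral_step_approx => //; first exact: ltW.
    move=> [i1 i2] [j1 j2] z [/= zi1 zi2] [/= zj1 zj2]; congr (_, _); apply: val_inj.
      exact: grid_uniq qS zi1 zj1.
    exact: grid_uniq sS zi2 zj2.
  move=> [i1 i2] [x y] [] /=; rewrite !in_itv/= => /andP[x1 x2] /andP[y1 y2].
  have [xab xr] := near_grid q N1 i1 a b x qS qr q0 qN (ltn_ord _) (introT andP (conj (ltW x1) x2)).
  have [ycd yr] := near_grid s N2 i2 c d y sS sr s0 sN (ltn_ord _) (introT andP (conj (ltW y1) y2)).
  by apply: f'E => //; [exact: q_in|exact: s_in].
have est2 : `|\int[Om]_z f' (g z) - \sum_j v j * pr Om (C2 j)| <=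
    e1 + M * (1 - \sum_j pr Om (C2 j)).
  apply: (@Rintegral_step_approx _ _ _ Om (f' \o g)) => //.
  - exact: measurableT_comp.
  - by move=> z; exact: fM.
  - exact: ltW.
  - move=> [i1 i2] [j1 j2] z [/= zi1 zi2] [/= zj1 zj2]; congr (_, _); apply: val_inj.
      apply/eqP; rewrite eqn_leq; apply/andP; split; rewrite leqNgt; apply/negP => ij.
        by apply: (Sdis _ _ _ _ _ _ zj1 zi1); exact: grid_le.
      by apply: (Sdis _ _ _ _ _ _ zi1 zj1); exact: grid_le.
    exact: grid_uniq sS zi2 zj2.
  move=> [i1 i2] [y w] [/Sh hz]; rewrite /B /= in_itv/= => /andP[y1 y2].
  have [xab xr] := near_grid q N1 i1 a b _ qS qr q0 qN (ltn_ord _) hz.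
  have [ycd yr] := near_grid s N2 i2 c d y sS sr s0 sN (ltn_ord _) (introT andP (conj (ltW y1) y2)).
  by rewrite /g /=; apply: f'E => //; [exact: q_in|exact: s_in].
have C_cvg j : pr (nu_ (k n)) (C1 j) @[n --> \oo] --> pr Om (C2 j).
  by apply: cell_cvg => //; exact/ltW/qS.
have sum_cvg (w : J -> R) : \sum_j w j * pr (nu_ (k n)) (C1 j) @[n --> \oo] -->
    \sum_j w j * pr Om (C2 j).
  elim: (index_enum J) => [|j t ih].
    by rewrite big_nil; under eq_fun do rewrite big_nil; exact: cvg_cst.
  rewrite big_cons; under eq_fun do rewrite big_cons.
  by apply: cvgD => //; apply: cvgMr; exact: C_cvg.
have mass1 n : 1 - e1 <= \sum_j pr (nu_ (k n)) (C1 j).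
  rewrite (le_trans (he (k n)))//; apply: pr_le_sum => //.
    by apply: measurableX.
  move=> z [z1 z2]; rewrite -q0 -qN in z1; rewrite -s0 -sN in z2.
  have [i1 hi1] := grid_locate z1; have [i2 hi2] := grid_locate z2.
  by exists (i1, i2).
have mass2 : 1 - e1 <= \sum_j pr Om (C2 j).
  have cv := sum_cvg (fun=> 1).
  under [leRHS]eq_bigr do rewrite -[pr _ _]mul1r.
  rewrite -(cvg_lim _ cv)//; apply: limr_ge; first by apply/cvg_ex; eexists; exact: cv.
  by apply: nearW => n; under eq_bigr do rewrite mul1r; exact: mass1.
have /cvgrPdist_le/(_ _ e10) := sum_cvg v.
apply: filterS => n hn.
have eE : e = (5 + 2 * M) * e1 by rewrite /e1; field; lra.
have m1 : M * (1 - \sum_j pr (nu_ (k n)) (C1 j)) <= M * e1.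
  by rewrite ler_wpM2l//; have := mass1 n; lra.
have m2 : M * (1 - \sum_j pr Om (C2 j)) <= M * e1.
  by rewrite ler_wpM2l//; lra.
have := est1 n; have := est2; move: hn; rewrite /= !ler_norml.
move: (\sum_j v j * _) (\sum_j v j * _) m1 m2 => S1 S2 m1 m2.
move=> /andP[h1 h2] /andP[h3 h4] /andP[h5 h6].
by apply/andP; split; rewrite eE mulrDl; lra.
Qed.

End coupling_compactness.

(** * Continuous cut-offs and the integrals they determine *)

Section plateau.
Variable R : realType.
Implicit Types (a b x : R) (n : nat).

(** A trapezoid approximating the indicator of ]a, b[. As it vanishes outside this interval, its
    product with the unbounded first coordinate is a bounded continuous function. *)
Definition plateau a b n x : R :=
  Num.max 0 (Num.min 1 (n%:R * Num.min (x - a) (b - x))).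

Lemma plateau_continuous a b n : continuous (plateau a b n).
Proof.
have c1 : continuous (fun x : R => x - a).
  by move=> x; apply: cvgB; [exact: cvg_id|exact: cvg_cst].
have c2 : continuous (fun x : R => b - x).
  by move=> x; apply: cvgB; [exact: cvg_cst|exact: cvg_id].
have c3 : continuous (fun x : R => n%:R * Num.min (x - a) (b - x)).
  move=> x; apply: cvgMr; exact: (continuous_min (c1 x) (c2 x)).
move=> x; apply: (continuous_max (@cvg_cst _ (0 : R^o) _ (nbhs x) _)).
exact: (continuous_min (@cvg_cst _ (1 : R^o) _ (nbhs x) _) (c3 x)).
Qed.

Lemma plateau_ge0_le1 a b n x : 0 <= plateau a b n x <= 1.
Proof. by rewrite /plateau le_max lexx/= ge_max ler01/= ge_min lexx. Qed.

Lemma plateau_norm_le1 a b n x : `|plateau a b n x| <= 1.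
Proof. by have /andP[h1 h2] := plateau_ge0_le1 a b n x; rewrite ger0_norm. Qed.

Lemma plateau_eq0 a b n x : ~ (a < x < b) -> plateau a b n x = 0.
Proof.
move=> /negP; rewrite negb_and -!leNgt => h; rewrite /plateau; apply/max_idPl.
rewrite ge_min; apply/orP; right; rewrite mulr_ge0_le0//.
by rewrite ge_min !subr_le0.
Qed.

Lemma plateau_le_indic a b n x : plateau a b n x <= \1_`]a, b[%classic x.
Proof.
rewrite indicE; case: (boolP (x \in _)) => [_|].
  by have /andP[] := plateau_ge0_le1 a b n x.
by rewrite notin_setE /= in_itv/= => h; rewrite plateau_eq0.
Qed.

Lemma plateau_cvg a b x :
  plateau a b n x @[n --> \oo] --> (\1_`]a, b[%classic x : R).
Proof.
rewrite indicE; case: (boolP (x \in _)); last first.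
  rewrite notin_setE /= in_itv/= => h.
  by under eq_fun do rewrite plateau_eq0//; exact: cvg_cst.
rewrite inE /= in_itv/= => /andP[ax xb].
pose d := Num.min (x - a) (b - x).
have d0 : 0 < d by rewrite /d lt_min !subr_gt0 ax.
apply: cvg_near_cst; near=> n; rewrite /plateau -/d.
rewrite (min_idPl _) ?(max_idPr _)//.
rewrite -ler_pdivrMr// mul1r; near: n; exact: nbhs_infty_ger.
Unshelve. all: by end_near. Qed.

End plateau.

Lemma Rintegral_indic_cvg d (T : measurableType d) (R : realType)
    (P : probability T R) (X : T -> R) (h : T -> R) (A_ : nat -> set R)
    (A : set R) :
  measurable_fun [set: T] X -> P.-integrable [set: T] (EFin \o h) ->
  (forall n, measurable (A_ n)) -> measurable A ->
  (forall x, \1_(A_ n) x @[n --> \oo] --> (\1_A x : R)) ->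
  \int[P]_x (\1_(A_ n) (X x) * h x) @[n --> \oo] -->
  \int[P]_x (\1_A (X x) * h x).
Proof.
move=> mX hi mA_ mA cA.
have mh := integrable_measurable hi.
have m1 (B : set R) : measurable B -> measurable_fun setT (fun x => \1_B (X x) : R).
  by move=> mB; apply: measurableT_comp => //; exact: measurable_indic.
apply: (@Rintegral_cvg _ _ _ _ _ _ (fun x => `|h x|)).
- by move=> n; apply: measurable_funM => //; exact: m1.
- by apply: measurable_funM => //; exact: m1.
- by move=> x; apply: cvgMl; exact: cA.
- exact: integrable_norm.
- by move=> n x; rewrite normrM ler_piMl// indic_norm_le1.
Qed.

(** Since [h] is signed, Dynkin's theorem is applied to the sets over which its integral vanishes,
    rather than uniqueness of measures. The whole line comes from the intervals ]-n, n[ by dominated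
    convergence. *)
Lemma Rintegral_indic_eq0_ext d (T : measurableType d) (R : realType)
    (P : probability T R) (X : T -> R) (h : T -> R) :
  measurable_fun [set: T] X -> P.-integrable [set: T] (EFin \o h) ->
  (forall a b, \int[P]_x (\1_`]a, b[%classic (X x) * h x) = 0) ->
  forall B, measurable B -> \int[P]_x (\1_B (X x) * h x) = 0.
Proof.
move=> mX hi h0 B mB.
have mh := integrable_measurable hi.
have m1 (A : set R) : measurable A -> measurable_fun setT (fun x => \1_A (X x) : R).
  by move=> mA; apply: measurableT_comp => //; exact: measurable_indic.
have i1 (A : set R) : measurable A ->
    P.-integrable setT (EFin \o (fun x => \1_A (X x) * h x)).
  move=> mA; apply: (@integrableMbounded _ _ _ _ _ _ 1) => //; first exact: m1.
  by move=> x; exact: indic_norm_le1.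
have lim_ A_ A := @Rintegral_indic_cvg _ _ _ P X h A_ A mX hi.
pose C (B : set R) := \int[P]_x (\1_B (X x) * h x) = 0.
have CT : C setT.
  pose A_ (n : nat) : set R := `]- n%:R, n%:R[%classic.
  have cv : \int[P]_x (\1_(A_ n) (X x) * h x) @[n --> \oo] -->
      \int[P]_x (\1_[set: R] (X x) * h x).
    apply: lim_ => // [n|x]; first exact: measurable_itv.
    apply: cvg_near_cst; near=> n; rewrite !indicE !mem_set//=.
    rewrite /A_ /= in_itv/= -ltr_norml; near: n; exact: nbhs_infty_gtr.
  rewrite /C -(cvg_lim _ cv)//; under eq_fun do rewrite h0.
  exact: lim_cst.
suff : C B by [].
apply: (@dynkin_induction _ R (@RGenOpens.G R) C) => //.
- exact: RGenOpens.measurableE.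
- exact: open_interval_setI.
- by move=> _ [a [b ->]]; exact: h0.
- move=> S mS CS; rewrite /C.
  rewrite (_ : (fun x => _) = (fun x => \1_[set: R] (X x) * h x -
      \1_S (X x) * h x)).
    rewrite RintegralB//; [|exact: i1|exact: i1].
    by rewrite [X in X - _]CT [X in _ - X]CS subrr.
  apply/funext => x; rewrite !indicE in_setT in_setC.
  by case: (X x \in S) => /=; ring.
- move=> F mF tF CF.
  pose S_ n := \big[setU/set0]_(i < n) F i.
  have cv : \int[P]_x (\1_(S_ n) (X x) * h x) @[n --> \oo] -->
      \int[P]_x (\1_(\bigcup_k F k) (X x) * h x).
    apply: lim_ => //.
    - by move=> n; exact: bigsetU_measurable.
    - exact: bigcupT_measurable.
    move=> x; have [[k _ Fkx]|nF] := pselect ((\bigcup_k F k) x).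
      apply: cvg_near_cst; near=> n; rewrite !indicE mem_set; last first.
        by rewrite /S_ -bigcup_mkord; exists k => //=; near: n; exact: nbhs_infty_gt.
      by rewrite mem_set//; exists k.
    rewrite indicE memNset//; apply: cvg_near_cst; apply: nearW => n.
    rewrite indicE memNset// /S_ -bigcup_mkord => -[k _ Fkx].
    by apply: nF; exists k.
  rewrite /C -(cvg_lim _ cv)//; under eq_fun => n.
    have -> : \int[P]_x (\1_(S_ n) (X x) * h x) = 0.
      elim: n => [|n ih].
        rewrite /S_ big_ord0; under eq_Rintegral do rewrite indic0 mul0r.
        exact: Rintegral_cst1.
      rewrite (_ : (fun x => _) = (fun x => \1_(S_ n) (X x) * h x +
          \1_(F n) (X x) * h x)).
        rewrite RintegralD//; [|apply: i1|exact: i1].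
          by rewrite ih [X in _ + X]CF addr0.
        exact: bigsetU_measurable.
      apply/funext => x; rewrite /S_ big_ord_recr/= -/(S_ n) !indicE in_setU.
      case: (boolP (X x \in F n)) => [/set_mem Fnx|_]; last first.
        by rewrite orbF mul0r addr0.
      rewrite orbT memNset /=; first by rewrite mul0r add0r.
      rewrite /S_ -bigcup_mkord => -[k /= kn Fkx].
      have kn' : k = n by apply: tF => //; exists (X x).
      by rewrite kn' ltnn in kn.
    over.
  exact: lim_cst.
- have e : @measurable _ R = <<s @RGenOpens.G R >> := RGenOpens.measurableE R.
  by rewrite -e.
Unshelve. all: by end_near. Qed.

Lemma Cb1_restrict (R : realType) (I : set R) (f : R -> R) :
  open I -> Cb I f -> measurable_fun [set: R] (f \_ I) /\
    exists2 M : R, 0 <= M & forall x, `|(f \_ I) x| <= M.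
Proof.
move=> oI [cf [M [Mr fM]]]; split.
  apply/(measurable_restrictT _ (open_measurable oI)).
  by apply: open_continuous_measurable_fun => //; rewrite -continuous_open_subspace.
exists (`|M| + 1); first by rewrite addr_ge0.
move=> z; rewrite patchE; case: ifPn => [|_]; last by rewrite normr0 addr_ge0.
by rewrite inE => Dz; apply: fM => //; rewrite ltr_pwDr// ler_norm.
Qed.

Lemma weak_cvg1P (R : realType) (I : set R)
    (la_ : nat -> probability R R) (la : probability R R) : open I ->
  weak_cvg1 I la_ la <-> forall f, @Cb R R I f ->
    \int[la_ n]_x (f \_ I) x @[n --> \oo] --> \int[la]_x (f \_ I) x.
Proof.
move=> oI.
have E (Q : probability R R) f : @Cb R R I f ->
    (\int[Q]_(x in I) (f x)%:E)%E = (\int[Q]_x (f \_ I) x)%:E.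
  move=> /(Cb1_restrict oI)[mf [M M0 fM]].
  rewrite integral_mkcond -EFin_Rintegral; last exact: bounded_fun_integrable fM.
  by apply: eq_integral => x _; rewrite restrict_EFin.
split => h f Cf; have := h f Cf.
  rewrite E//; under eq_fun do rewrite E//.
  by move/fine_cvg.
move=> hf; rewrite E//; under eq_fun do rewrite E//.
by apply: cvg_EFin; [exact: nearW|exact: hf].
Qed.

Lemma carried_ae d (T : measurableType d) (R : realType)
    (P : probability T R) (D : set T) : measurable D -> carried_by P D ->
  {ae P, forall x, D x}.
Proof. by move=> mD PD; exists (~` D); split => //; exact: measurableC. Qed.

Lemma Rintegral_carried d (T : measurableType d) (R : realType)
    (P : probability T R) (D : set T) (f : T -> R) :
  measurable D -> carried_by P D -> measurable_fun [set: T] f ->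
  \int[P]_x (f \_ D) x = \int[P]_x f x.
Proof.
move=> mD PD mf; apply: ae_eq_Rintegral => //.
  by apply/(measurable_restrictT _ mD); exact: measurable_funTS.
by apply: filterS (carried_ae mD PD) => x Dx; rewrite patchE mem_set.
Qed.

Lemma continuous_Cb1 (R : realType) (I : set R) (f : R -> R) (M : R) :
  continuous f -> (forall x, `|f x| <= M) -> @Cb R R I f.
Proof.
move=> cf fM; split; first exact: continuous_subspaceT.
by exists M; split => [|r Mr x _ /=]; [exact: num_real|exact: le_trans (fM x) (ltW Mr)].
Qed.

Lemma continuous_Cb2 (R : realType) (I : set R) (f : R * R -> R) (M : R) :
  continuous f -> (forall x, `|f x| <= M) -> @Cb (R * R)%type R (I `*` I) f.
Proof.
move=> cf fM; split; first exact: continuous_subspaceT.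
by exists M; split => [|r Mr x _ /=]; [exact: num_real|exact: le_trans (fM x) (ltW Mr)].
Qed.

(** Plateau functions recover the masses of open intervals, a generating class stable under
    intersection. *)
Lemma eq_probability_Cb (R : realType) (P Q : probability R R) :
  (forall f (M : R), continuous f -> (forall x, `|f x| <= M) ->
    \int[P]_x f x = \int[Q]_x f x) ->
  forall B, measurable B -> P B = Q B.
Proof.
move=> h; have e a b : pr P `]a, b[ = pr Q `]a, b[.
  rewrite -!Rintegral_indic//; [|exact: measurable_itv..].
  have cv (S : probability R R) : \int[S]_x plateau a b n x @[n --> \oo] -->
      \int[S]_x \1_`]a, b[%classic x.
    apply: (@Rintegral_cvg_bounded _ _ _ _ _ _ 1).
    - by move=> n; apply: continuous_measurable_fun; exact: plateau_continuous.
    - by apply: measurable_indic; exact: measurable_itv.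
    - exact: plateau_cvg.
    - by move=> n x; exact: plateau_norm_le1.
  rewrite -(cvg_lim _ (cv P))// -(cvg_lim _ (cv Q))//; congr (lim (_ @ \oo)).
  apply/funext => n; apply: (h _ 1); first exact: plateau_continuous.
  by move=> x; exact: plateau_norm_le1.
apply: (@measure_unique _ _ _ (@RGenOpens.G R) (fun n : nat => `]- n%:R, n%:R[%classic)).
- exact: RGenOpens.measurableE.
- exact: open_interval_setI.
- by move=> n; exists (- n%:R), n%:R.
- apply/seteqP; split => // x _; exists (Num.bound x) => //=.
  by rewrite in_itv/= -ltr_norml; have := archi_boundP (normr_ge0 x); rewrite /Num.bound normr_id.
- move=> _ [a [b ->]]; rewrite -[LHS]fineK ?fin_num_measure//.
  by rewrite -[RHS]fineK ?fin_num_measure//; congr EFin; exact: e.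
- by move=> n; rewrite (le_lt_trans (probability_le1 _ _)) ?ltry//; exact: measurable_itv.
Qed.

Lemma cvgn_ge_eventually (R : realType) (u : nat -> R) (l c : R) :
  u n @[n --> \oo] --> l -> c < l -> exists N, forall n, (N <= n)%N -> c <= u n.
Proof.
move=> ul cl; have lc : 0 < l - c by rewrite subr_gt0.
have /cvgrPdist_lt/(_ _ lc)[N _ hN] := ul; exists N => n Nn.
by have := hN n Nn; rewrite /= ltr_norml; lra.
Qed.

(** * Tightness and the martingale property *)

Section exhaustion.
Context (R : realType) (I : set R).
Hypotheses (I_nonempty : I !=set0) (I_open : open I) (I_itv : is_interval I).

Lemma open_rat_left x : I x -> exists q : rat, I (ratr q) /\ ratr q < x.
Proof.
move=> Ix; have /nbhs_ballP[e /= e0 eI] := open_nbhs_nbhs (conj I_open Ix).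
have xe : x - e < x by lra.
have [q /[!in_itv]/= /andP[q1 q2]] := rat_in_itvoo xe.
by exists q; split => //; apply: eI; rewrite /ball /= ltr_norml; apply/andP; split; lra.
Qed.

Lemma open_rat_right x : I x -> exists q : rat, I (ratr q) /\ x < ratr q.
Proof.
move=> Ix; have /nbhs_ballP[e /= e0 eI] := open_nbhs_nbhs (conj I_open Ix).
have xe : x < x + e by lra.
have [q /[!in_itv]/= /andP[q1 q2]] := rat_in_itvoo xe.
by exists q; split => //; apply: eI; rewrite /ball /= ltr_norml; apply/andP; split; lra.
Qed.

(** The end points are running minima and maxima of an enumeration of the rationals of [I], where a
    rational outside [I] is replaced by [c]. This treats bounded and unbounded intervals alike. *)
Lemma interval_exhaustion : exists a b : nat -> rat,
  [/\ forall n, I (ratr (a n)) /\ I (ratr (b n)),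
      forall m n, (m <= n)%N -> a n <= a m /\ b m <= b n,
      forall n, a n < b n &
      forall x, I x -> exists N, forall n, (N <= n)%N ->
        ratr (a n) < x < ratr (b n)].
Proof.
have [x0 Ix0] := I_nonempty.
have [c [Ic cx0]] := open_rat_left Ix0; have [d [Id xd0]] := open_rat_right Ix0.
have cd : c < d by rewrite -(@ltr_rat R) (lt_trans cx0).
pose en (n : nat) : rat := odflt c (unpickle n).
pose q n : rat := if `[< I (ratr (en n)) >] then en n else c.
have Iq n : I (ratr (q n)) by rewrite /q; case: asboolP.
pose fix a n := if n is n'.+1 then Num.min (q n') (a n') else c.
pose fix b n := if n is n'.+1 then Num.max (q n') (b n') else d.
have aS n : a n.+1 <= a n by rewrite /= ge_min lexx orbT.
have bS n : b n <= b n.+1 by rewrite /= le_max lexx orbT.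
have amon m n : (m <= n)%N -> a n <= a m.
  elim: n => [|n ih]; first by rewrite leqn0 => /eqP ->.
  by rewrite leq_eqVlt => /predU1P[->//|/ih h]; exact: le_trans (aS n) h.
have bmon m n : (m <= n)%N -> b m <= b n.
  elim: n => [|n ih]; first by rewrite leqn0 => /eqP ->.
  by rewrite leq_eqVlt => /predU1P[->//|/ih h]; exact: le_trans h (bS n).
exists a, b; split.
- move=> n; split; elim: n => [|n ih] //=; first by rewrite /Num.min; case: ifP.
  by rewrite /Num.max; case: ifP.
- by move=> m n mn; split; [exact: amon|exact: bmon].
- move=> n; rewrite (le_lt_trans (amon 0%N n isT))//.
  exact: lt_le_trans cd (bmon 0%N n isT).
move=> x Ix.
have [l [Il lx]] := open_rat_left Ix; have [r [Ir xr]] := open_rat_right Ix.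
have qE p : I (ratr p) -> q (pickle p) = p.
  by move=> Ip; rewrite /q /en pickleK /=; case: asboolP.
exists (maxn (pickle l).+1 (pickle r).+1) => n; rewrite geq_max => /andP[ln rn].
have al : a n <= l by rewrite (le_trans (amon _ _ ln))//= qE// ge_min lexx.
have br : r <= b n by rewrite (le_trans _ (bmon _ _ rn))//= qE// le_max lexx.
by apply/andP; split; [apply: le_lt_trans lx|apply: lt_le_trans xr _];
  rewrite ler_rat.
Qed.

Lemma carried_exhaustion (la : probability R R) (a b : nat -> rat) :
  carried_by la I ->
  (forall x, I x -> exists N, forall n, (N <= n)%N ->
        ratr (a n) < x < ratr (b n)) ->
  pr la `]ratr (a n), ratr (b n)[ @[n --> \oo] --> (1 : R).
Proof.
move=> laI ab; rewrite -[X in _ --> X](Rintegral_cst1 la).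
under eq_fun do rewrite -Rintegral_indic//.
have mI := open_measurable I_open.
have -> : \int[la]_x 1 = \int[la]_x \1_I x.
  apply: ae_eq_Rintegral => //.
  by apply: filterS (carried_ae mI laI) => x Ix; rewrite indicE mem_set.
have -> : (fun n => \int[la]_x \1_`]ratr (a n), ratr (b n)[%classic x) =
    (fun n => \int[la]_x (\1_I x * \1_`]ratr (a n), ratr (b n)[%classic x)).
  apply/funext => n; apply: ae_eq_Rintegral => //.
    by apply: measurable_funM; apply: measurable_indic.
  by apply: filterS (carried_ae mI laI) => x Ix; rewrite [\1_I x]indicE mem_set// mul1r.
apply: (@Rintegral_cvg_bounded _ _ _ _ _ _ 1).
- by move=> n; apply: measurable_funM; apply: measurable_indic.
- exact: measurable_indic.
- move=> x; rewrite [\1_I x]indicE; case: (boolP (x \in I)) => [/set_mem Ix|_].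
    have [N hN] := ab x Ix; apply: cvg_near_cst; exists N => // n /= Nn.
    by rewrite mul1r indicE mem_set//= in_itv/= hN.
  by under eq_fun do rewrite mul0r; exact: cvg_cst.
- by move=> n x; rewrite normrM mulr_ile1// indic_norm_le1.
Qed.

Lemma carried_tight1 (la : probability R R) : carried_by la I ->
  forall e : R, 0 < e -> exists a b : rat,
  [/\ I (ratr a), I (ratr b), a < b & 1 - e <= pr la `]ratr a, ratr b]].
Proof.
move=> laI e e0; have [a [b [Iab _ ab ex]]] := interval_exhaustion.
have e1 : 1 - e < 1 by lra.
have [N /(_ N (leqnn N)) hN] := cvgn_ge_eventually (carried_exhaustion laI ex) e1.
exists (a N), (b N); split; [exact: (Iab N).1|exact: (Iab N).2|exact: ab|].
apply: (le_trans hN); apply: pr_le => //; try exact: measurable_itv.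
by move=> x /=; rewrite !in_itv/= => /andP[-> /ltW ->].
Qed.

(** A plateau function with most of the mass of the limit bounds all but finitely many terms; each
    remaining term is tight by itself, and a larger interval of the exhaustion serves for all. *)
Lemma weak_cvg1_tight (la_ : nat -> probability R R) (la : probability R R) :
  (forall n, carried_by (la_ n) I) -> carried_by la I -> weak_cvg1 I la_ la ->
  forall e : R, 0 < e -> exists a b : rat,
  [/\ I (ratr a), I (ratr b), a < b & forall n, 1 - e <= pr (la_ n) `]ratr a, ratr b]].
Proof.
move=> la_I laI /(weak_cvg1P _ _ I_open) wc e e0.
have [a [b [Iab mon ab ex]]] := interval_exhaustion.
have le_N (Q : probability R R) M N : (M <= N)%N ->
    pr Q `]ratr (a M), ratr (b M)[ <= pr Q `]ratr (a N), ratr (b N)].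
  move=> MN; apply: pr_le; [exact: measurable_itv..|].
  move=> x /=; rewrite !in_itv/= => /andP[x1 x2]; have [h1 h2] := mon _ _ MN.
  rewrite (le_lt_trans _ x1) ?ler_rat//= (le_trans (ltW x2))// ler_rat//.
(* The deficits e/2 for the interval, 3e/4 for its plateau function and e for the approximating laws
   leave the strict gaps that the two limits require. *)
have e2 : 1 - e / 2 < 1 by rewrite ltrBlDr ltrDl divr_gt0.
have [N0 hN0] := cvgn_ge_eventually (carried_exhaustion laI ex) e2.
have {hN0} hN0 := hN0 N0 (leqnn _).
pose A := ratr (a N0) : R; pose B := ratr (b N0) : R.
have cvp : \int[la]_x plateau A B n x @[n --> \oo] --> pr la `]A, B[.
  rewrite -Rintegral_indic//.
  apply: (@Rintegral_cvg_bounded _ _ _ _ _ _ 1).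
  - by move=> n; apply: continuous_measurable_fun; exact: plateau_continuous.
  - by apply: measurable_indic; exact: measurable_itv.
  - exact: plateau_cvg.
  - by move=> n x; exact: plateau_norm_le1.
have e3 : 1 - 3 / 4 * e < pr la `]A, B[ by apply: lt_le_trans hN0; lra.
have [j /(_ j (leqnn _)) hj] := cvgn_ge_eventually cvp e3.
have cfj := @plateau_continuous _ A B j.
have Cf : @Cb R R I (plateau A B j).
  exact: continuous_Cb1 cfj (plateau_norm_le1 _ _ _).
have mfj := continuous_measurable_fun cfj.
have mI := open_measurable I_open.
have := wc _ Cf; rewrite Rintegral_carried//.
under eq_fun do rewrite Rintegral_carried//.
have e4 : 1 - e < \int[la]_x plateau A B j x by apply: lt_le_trans hj; lra.
move=> /cvgn_ge_eventually/(_ e4)[N1 hN1].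
have big n : (N1 <= n)%N -> 1 - e <= pr (la_ n) `]A, B[.
  move=> /hN1 h; rewrite (le_trans h)// -Rintegral_indic//.
  apply: le_Rintegral => //.
  - exact: bounded_fun_integrable (plateau_norm_le1 _ _ _).
  - by apply: integrable_indicr; exact: measurable_itv.
  - by move=> x _; exact: plateau_le_indic.
have small n : exists M, 1 - e <= pr (la_ n) `]ratr (a M), ratr (b M)[.
  have e1 : 1 - e < 1 by lra.
  have [N hN] := cvgn_ge_eventually (carried_exhaustion (la_I n) ex) e1.
  by exists N; exact: hN.
have [M hM] := choice small.
pose N := maxn N0 (\max_(i < N1) M i).
exists (a N), (b N); split; [exact: (Iab N).1|exact: (Iab N).2|exact: ab|].
move=> n; have [nN1|N1n] := ltnP n N1.
  apply: (le_trans (hM n)); apply: le_N.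
  by rewrite (leq_trans _ (leq_maxr _ _))// (leq_bigmax (Ordinal nN1)).
by apply: (le_trans (big n N1n)); apply: le_N; exact: leq_maxl.
Qed.

End exhaustion.

Section martingale.
Context (R : realType) (I : set R).
Implicit Types (la mu : probability R R) (nu : probability (R * R)%type R).

Let mpre1 (B : set R) : measurable B -> measurable (fst @^-1` B : set (R * R)).
Proof. exact: (measurable_preimage measurable_fst). Qed.

#[local] HB.instance Definition _ :=
  @isMeasurableFun.Build _ _ (R * R)%type R fst measurable_fst.
#[local] HB.instance Definition _ :=
  @isMeasurableFun.Build _ _ (R * R)%type R snd measurable_snd.

Lemma marginal_integral nu la (X : {mfun (R * R)%type >-> R}) (f : R -> R) :
  (forall B, measurable B -> nu (X @^-1` B) = la B) ->
  measurable_fun [set: R] f -> la.-integrable [set: R] (EFin \o f) ->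
  nu.-integrable [set: R * R] (EFin \o (f \o X)) /\
  \int[nu]_z f (X z) = \int[la]_x f x.
Proof.
move=> nuX mf fi; pose D : probability R R := distribution nu X.
have DE B : measurable B -> D B = la B by move=> mB; exact: nuX.
have mEf : measurable_fun setT (EFin \o f) by exact/measurable_EFinP.
have abs_eq : (\int[D]_x `|(EFin \o f) x| = \int[la]_x `|(EFin \o f) x|)%E.
  by apply: eq_measure_integral => B mB _; exact: DE.
have fi' : nu.-integrable setT (EFin \o (f \o X)).
  apply/integrableP; split.
    by apply/measurable_EFinP; exact: measurableT_comp.
  have /integrableP[_] := fi; rewrite -abs_eq.
  by rewrite ge0_integral_pushforward//; exact: measurableT_comp.
split => //; rewrite -(Rintegral_distribution (X := X))//.
by congr fine; apply: eq_measure_integral => B mB _; exact: DE.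
Qed.

Lemma fst_integral nu la (f : R -> R) :
  (forall B, measurable B -> nu (fst @^-1` B) = la B) ->
  measurable_fun [set: R] f -> la.-integrable [set: R] (EFin \o f) ->
  nu.-integrable [set: R * R] (EFin \o (fun z => f z.1)) /\
  \int[nu]_z f z.1 = \int[la]_x f x.
Proof. by move=> h; exact: (@marginal_integral nu la fst). Qed.

Lemma snd_integral nu mu (f : R -> R) :
  (forall B, measurable B -> nu (snd @^-1` B) = mu B) ->
  measurable_fun [set: R] f -> mu.-integrable [set: R] (EFin \o f) ->
  nu.-integrable [set: R * R] (EFin \o (fun z => f z.2)) /\
  \int[nu]_z f z.2 = \int[mu]_x f x.
Proof. by move=> h; exact: (@marginal_integral nu mu snd). Qed.

Lemma integrable_increment nu la mu :
  (forall B, measurable B -> nu (fst @^-1` B) = la B) ->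
  (forall B, measurable B -> nu (snd @^-1` B) = mu B) ->
  finite_mean la -> finite_mean mu ->
  nu.-integrable [set: R * R] (EFin \o (fun z : R * R => z.2 - z.1)).
Proof.
move=> n1 n2 f1 f2; apply: integrable_subr.
  by have [] := @snd_integral nu mu id n2 (@measurable_id _ _ _) f2.
by have [] := @fst_integral nu la id n1 (@measurable_id _ _ _) f1.
Qed.

Lemma integral_fst_preimage nu (B : set R) (f : R * R -> R) : measurable B ->
  nu.-integrable [set: R * R] (EFin \o f) ->
  (\int[nu]_(z in fst @^-1` B) (f z)%:E = (\int[nu]_z (\1_B z.1 * f z))%:E)%E.
Proof.
move=> mB fi.
have -> : \int[nu]_z (\1_B z.1 * f z) = \int[nu]_(z in fst @^-1` B) f z.
  by rewrite [RHS]Rintegral_restrict; apply: eq_Rintegral => z _; congr (_ * _).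
rewrite /Rintegral fineK//; apply: integrable_fin_num; first exact: mpre1.
by apply: integrableS fi => //; exact: mpre1.
Qed.

(** Finite means supply the integrability clauses of the definition. What remains, the orthogonality
    of the increment to events of the first coordinate, is the form that passes to limits and
    images. *)
Lemma martingaleP nu la mu :
  (forall B, measurable B -> nu (fst @^-1` B) = la B) ->
  (forall B, measurable B -> nu (snd @^-1` B) = mu B) ->
  finite_mean la -> finite_mean mu ->
  is_cond_exp nu (fst : R * R -> R) snd fst <->
  forall B, measurable B -> \int[nu]_z (\1_B z.1 * (z.2 - z.1)) = 0.
Proof.
move=> n1 n2 f1 f2.
have i1 : nu.-integrable setT (EFin \o (fst : R * R -> R)).
  by have [] := @fst_integral nu la id n1 (@measurable_id _ _ _) f1.
have i2 : nu.-integrable setT (EFin \o (snd : R * R -> R)).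
  by have [] := @snd_integral nu mu id n2 (@measurable_id _ _ _) f2.
have m1 (B : set R) : measurable B ->
    measurable_fun setT (fun z : R * R => \1_B z.1 : R).
  by move=> mB; apply: measurableT_comp => //; exact: measurable_indic.
have E B f := @integral_fst_preimage nu B f.
have D B : measurable B -> \int[nu]_z (\1_B z.1 * (z.2 - z.1)) =
    \int[nu]_z (\1_B z.1 * z.2) - \int[nu]_z (\1_B z.1 * z.1).
  move=> mB; rewrite -RintegralB//.
  - by apply: eq_Rintegral => z _; rewrite mulrBr.
  - by apply: (@integrableMbounded _ _ _ _ _ _ 1) i2 => [|z];
      [exact: m1|exact: indic_norm_le1].
  - by apply: (@integrableMbounded _ _ _ _ _ _ 1) i1 => [|z];
      [exact: m1|exact: indic_norm_le1].
split.
  move=> [_ _ _ h] B mB; rewrite D//; apply/eqP; rewrite subr_eq0; apply/eqP.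
  by have := h B mB; rewrite !E// => -[->].
move=> h; split => //.
  by move=> _ B mB; exists B.
move=> B mB; rewrite !E//; congr EFin; apply/eqP; rewrite -subr_eq0.
by rewrite -oppr_eq0 opprB -D// h.
Qed.

End martingale.

Section clamp.
Variable R : realType.
Implicit Types K y : R.

Definition clamp K y := Num.max (- K) (Num.min K y).

Lemma clamp_continuous K : continuous (clamp K).
Proof.
move=> x; apply: (continuous_max (@cvg_cst _ (- K : R^o) _ (nbhs x) _)).
have cid : continuous (fun y : R => y) by move=> y; exact: cvg_id.
exact: (continuous_min (@cvg_cst _ (K : R^o) _ (nbhs x) _) (cid x)).
Qed.

Lemma clamp_norm_le K y : 0 <= K -> `|clamp K y| <= K.
Proof.
move=> K0; rewrite /clamp ler_norml le_max lexx/= ge_max ge_min lexx /=.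
by rewrite andbT (le_trans _ K0)// oppr_le0.
Qed.

Lemma clamp_id K y : `|y| <= K -> clamp K y = y.
Proof.
by rewrite ler_norml => /andP[h1 h2]; rewrite /clamp (min_idPr h2) (max_idPr h1).
Qed.

Lemma clamp_dist_le K y : 0 <= K -> `|y - clamp K y| <= `|y|.
Proof.
move=> K0; have [yK|Ky] := leP `|y| K; first by rewrite clamp_id// subrr normr0.
rewrite /clamp; have [y0|y0] := leP 0 y.
  rewrite ger0_norm// in Ky *; rewrite (min_idPl (ltW Ky)) (max_idPr _).
    by rewrite ger0_norm; lra.
  by lra.
rewrite ltr0_norm// in Ky *; rewrite (min_idPr _); last by lra.
rewrite (max_idPl _); last by lra.
by rewrite ler0_norm; lra.
Qed.

Lemma clamp_tail (P : probability R R) : finite_mean P ->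
  \int[P]_y `|y - clamp n%:R y| @[n --> \oo] --> (0 : R).
Proof.
move=> fP; rewrite -[X in _ --> X](Rintegral_cst1 P 0).
have mc K : measurable_fun setT (clamp K).
  by apply: continuous_measurable_fun; exact: clamp_continuous.
apply: (@Rintegral_cvg _ _ _ _ _ _ (fun y => `|y|)) => //.
- move=> n; apply: measurableT_comp => //.
  by apply: measurable_funB => //; exact: mc.
- move=> y; apply: cvg_near_cst; near=> n; rewrite clamp_id ?subrr ?normr0//.
  by near: n; exact: nbhs_infty_ger.
- exact: (integrable_norm fP).
- by move=> n y; rewrite normr_id clamp_dist_le.
Unshelve. all: by end_near. Qed.

End clamp.

Lemma continuous_fst_comp (R : realType) (f : R -> R) :
  continuous f -> continuous (fun z : R * R => f z.1).
Proof. by move=> cf z; apply: continuous_comp; [exact: cvg_fst|exact: cf]. Qed.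

Lemma continuous_snd_comp (R : realType) (f : R -> R) :
  continuous f -> continuous (fun z : R * R => f z.2).
Proof. by move=> cf z; apply: continuous_comp; [exact: cvg_snd|exact: cf]. Qed.

Section martingale_closed.
Context (R : realType) (I : set R).
Hypotheses (I_nonempty : I !=set0) (I_open : open I) (I_itv : is_interval I).
Implicit Types (la mu : probability R R) (nu : probability (R * R)%type R).

Let mI : measurable I. Proof. exact: open_measurable. Qed.
Let mII : measurable (I `*` I). Proof. exact: measurableX. Qed.

Lemma carried_marginals nu la mu :
  (forall B, measurable B -> nu (fst @^-1` B) = la B) ->
  (forall B, measurable B -> nu (snd @^-1` B) = mu B) ->
  carried_by la I -> carried_by mu I -> carried_by nu (I `*` I).
Proof.
move=> n1 n2 l m; rewrite /carried_by.
have mC : measurable (~` I) by exact: measurableC.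
have m1 : measurable (fst @^-1` (~` I) : set (R * R)).
  exact: (measurable_preimage measurable_fst).
have m2 : measurable (snd @^-1` (~` I) : set (R * R)).
  exact: (measurable_preimage measurable_snd).
apply/eqP; rewrite -measure_le0.
have sub : ~` (I `*` I) `<=` (fst @^-1` (~` I)) `|` (snd @^-1` (~` I)).
  move=> z h; have [z1|] := pselect (I z.1); last by left.
  by right => z2; exact: h.
apply: (@le_trans _ _ (nu ((fst @^-1` (~` I)) `|` (snd @^-1` (~` I))))).
  by apply: le_measure; rewrite ?inE//; [exact: measurableC|exact: measurableU].
apply: (@le_trans _ _ (nu (fst @^-1` (~` I)) + nu (snd @^-1` (~` I)))%E).
  exact: measureU2.
by rewrite n1// n2// [la _]l [mu _]m adde0.
Qed.

Variables (nu_ : nat -> probability (R * R)%type R)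
  (nu : probability (R * R)%type R).
Variables (la_ : nat -> probability R R) (la mu : probability R R).
Hypothesis nu1 : forall n B, measurable B -> nu_ n (fst @^-1` B) = la_ n B.
Hypothesis nu2 : forall n B, measurable B -> nu_ n (snd @^-1` B) = mu B.
Hypotheses (la_I : forall n, carried_by (la_ n) I) (laI : carried_by la I).
Hypotheses (muI : carried_by mu I) (nuI : carried_by nu (I `*` I)).
Hypotheses (la_cvg : weak_cvg1 I la_ la) (nu_cvg : weak_cvg2 I nu_ nu).

#[local] HB.instance Definition _ :=
  @isMeasurableFun.Build _ _ (R * R)%type R fst measurable_fst.
#[local] HB.instance Definition _ :=
  @isMeasurableFun.Build _ _ (R * R)%type R snd measurable_snd.

Let nu_I n : carried_by (nu_ n) (I `*` I).
Proof. exact: carried_marginals (nu1 n) (nu2 n) (la_I n) muI. Qed.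

Let nu_lim (f : R * R -> R) (M : R) : continuous f -> (forall z, `|f z| <= M) ->
  \int[nu_ n]_z f z @[n --> \oo] --> \int[nu]_z f z.
Proof.
move=> cf fM; have Cf := @continuous_Cb2 _ I _ _ cf fM.
have mf : measurable_fun setT f.
  have := @continuous_in_measurable _ setT f (@openT _) (continuous_subspaceT cf).
  by rewrite patch_setT.
have /(weak_cvg2P _ _ I_open) := nu_cvg => /(_ f Cf).
rewrite Rintegral_carried//.
by under eq_fun do rewrite Rintegral_carried//.
Qed.

Let la_lim (f : R -> R) (M : R) : continuous f -> (forall z, `|f z| <= M) ->
  \int[la_ n]_z f z @[n --> \oo] --> \int[la]_z f z.
Proof.
move=> cf fM; have Cf := @continuous_Cb1 _ I _ _ cf fM.
have mf : measurable_fun setT f by exact: continuous_measurable_fun.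
have /(weak_cvg1P _ _ I_open) := la_cvg => /(_ f Cf).
rewrite Rintegral_carried//.
by under eq_fun do rewrite Rintegral_carried//.
Qed.

Lemma fst_marginal_closed B : measurable B -> nu (fst @^-1` B) = la B.
Proof.
move=> mB; apply: (@eq_probability_Cb _ (distribution nu fst) la) => // f M cf fM.
have mf := continuous_measurable_fun cf.
rewrite Rintegral_distribution//; last first.
  by apply: bounded_fun_integrable => [|z]; [exact: measurableT_comp|exact: fM].
have cv1 := @nu_lim (fun z => f z.1) M (continuous_fst_comp cf) (fun z => fM z.1).
have cv2 := la_lim cf fM.
rewrite -(cvg_lim _ cv1)// -(cvg_lim _ cv2)//; congr (lim (_ @ \oo)).
apply/funext => n; have [|_ ->//] := @fst_integral _ (nu_ n) (la_ n) f (nu1 n) mf.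
exact: bounded_fun_integrable fM.
Qed.

Lemma snd_marginal_closed B : measurable B -> nu (snd @^-1` B) = mu B.
Proof.
move=> mB; apply: (@eq_probability_Cb _ (distribution nu snd) mu) => // f M cf fM.
have mf := continuous_measurable_fun cf.
rewrite Rintegral_distribution//; last first.
  by apply: bounded_fun_integrable => [|z]; [exact: measurableT_comp|exact: fM].
have cv1 := @nu_lim (fun z => f z.2) M (continuous_snd_comp cf) (fun z => fM z.2).
rewrite -(cvg_lim _ cv1)//.
rewrite (_ : (fun n => _) = (fun n => \int[mu]_x f x)) ?lim_cst//.
apply/funext => n; have [|_ ->//] := @snd_integral _ (nu_ n) mu f (nu2 n) mf.
exact: bounded_fun_integrable fM.
Qed.

Hypotheses (la_mean : forall n, finite_mean (la_ n)) (la_fin : finite_mean la)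
  (mu_fin : finite_mean mu).
(** An asymptotic martingale property is enough for the limit: it also covers couplings that are
    martingales only up to a vanishing error, such as those built from near-splittings. *)
Hypothesis nu_mart : forall a b m, I a -> I b ->
  \int[nu_ n]_z (plateau a b m z.1 * (z.2 - z.1)) @[n --> \oo] --> (0 : R).

(** The plateau bounds the first coordinate; the second is truncated at level [K]. The truncation
    error [tau K] depends on the second marginal [mu] only, so it is the same for every coupling and
    vanishes as [K] grows. *)
Let plateau_mart a b m : I a -> I b ->
  \int[nu]_z (plateau a b m z.1 * (z.2 - z.1)) = 0.
Proof.
move=> Ia Ib; set g := plateau a b m.
have cg : continuous g by exact: plateau_continuous.
have mg := continuous_measurable_fun cg.
have g1 x : `|g x| <= 1 by exact: plateau_norm_le1.
pose psi (K : nat) (z : R * R) := g z.1 * (clamp K%:R z.2 - z.1).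
pose C := Num.max `|a| `|b|.
have gx x : `|g x * x| <= C.
  have [ab|nab] := boolP (a < x < b); last first.
    rewrite /g plateau_eq0; last exact/negP.
    by rewrite mul0r normr0 /C le_max normr_ge0.
  rewrite normrM (le_trans (ler_wpM2r (normr_ge0 _) (g1 x)))// mul1r.
  have /andP[ax xb] := ab; rewrite /C le_max.
  have [x0|x0] := leP 0 x; apply/orP.
    by right; rewrite ger0_norm// (le_trans (ltW xb))// ler_norm.
  by left; rewrite ltr0_norm// -normrN (le_trans _ (ler_norm _))// lerN2 ltW.
have psiM K z : `|psi K z| <= K%:R + C.
  rewrite /psi mulrBr (le_trans (ler_normB _ _))// lerD//.
  by rewrite normrM (le_trans (ler_wpM2r (normr_ge0 _) (g1 _)))// mul1r clamp_norm_le.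
have cpsi K : continuous (psi K).
  move=> z; apply: cvgM; first exact: (continuous_fst_comp cg).
  apply: cvgB; last exact: cvg_fst.
  exact: (continuous_snd_comp (@clamp_continuous _ K%:R)).
have mpsi K : measurable_fun setT (psi K).
  apply: measurable_funM; first exact: measurableT_comp.
  apply: measurable_funB => //; apply: measurableT_comp => //.
  by apply: continuous_measurable_fun; exact: clamp_continuous.
pose tau (K : nat) := \int[mu]_y `|y - clamp K%:R y|.
have tail (Q : probability (R * R)%type R) (l : probability R R) K :
    (forall B, measurable B -> Q (fst @^-1` B) = l B) -> finite_mean l ->
    (forall B, measurable B -> Q (snd @^-1` B) = mu B) ->
    `|\int[Q]_z (g z.1 * (z.2 - z.1)) - \int[Q]_z psi K z| <= tau K.
  move=> Q1 lf Q2; have iX := integrable_increment Q1 Q2 lf mu_fin.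
  have igX : Q.-integrable setT (EFin \o (fun z => g z.1 * (z.2 - z.1))).
    by apply: (@integrableMbounded _ _ _ _ _ _ 1) iX => [|z]; [exact: measurableT_comp|].
  have ipsi : Q.-integrable setT (EFin \o psi K) by exact: bounded_fun_integrable (psiM K).
  apply: (le_trans (Rintegral_dist igX ipsi)).
  have mh : measurable_fun setT (fun y : R => `|y - clamp K%:R y|).
    apply: measurableT_comp => //; apply: measurable_funB => //.
    by apply: continuous_measurable_fun; exact: clamp_continuous.
  have ih : mu.-integrable setT (EFin \o (fun y : R => `|y - clamp K%:R y|)).
    apply: (@integrable_norm _ _ _ _ _ (fun y : R => y - clamp K%:R y)).
    apply: integrable_subr; first exact: mu_fin.
    apply: (@bounded_fun_integrable _ _ _ _ _ K%:R) => [|y].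
      by apply: continuous_measurable_fun; exact: clamp_continuous.
    exact: clamp_norm_le.
  rewrite /tau; have [ih' <-] := snd_integral Q2 mh ih.
  apply: le_Rintegral => //.
    by apply: integrable_norm; exact: integrable_subr.
  move=> z _; rewrite /psi -mulrBr normrM.
  rewrite (le_trans (ler_wpM2r (normr_ge0 _) (g1 _)))// mul1r.
  by rewrite (_ : _ - _ - _ = z.2 - clamp K%:R z.2)//; ring.
have n1 := fst_marginal_closed; have n2 := snd_marginal_closed.
(* One [tau K] pays for truncating under [nu], the other for undoing the truncation under
   [nu_ n]. *)
have bound K : `|\int[nu]_z (g z.1 * (z.2 - z.1))| <= tau K + tau K.
  rewrite -[X in `|X|](subrK (\int[nu]_z psi K z)) (le_trans (ler_normD _ _))//.
  rewrite lerD//; first exact: tail n1 la_fin n2.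
  have cv : `|\int[nu_ n]_z psi K z| @[n --> \oo] --> `|\int[nu]_z psi K z|.
    by apply: cvg_norm; exact: nu_lim (cpsi K) (psiM K).
  have cv2 : `|\int[nu_ n]_z (g z.1 * (z.2 - z.1))| + tau K @[n --> \oo] --> tau K.
    rewrite -[X in _ --> X]add0r; apply: cvgD; last exact: cvg_cst.
    by rewrite -(@normr0 _ R); apply: cvg_norm; exact: nu_mart.
  apply: (ler_cvg_to cv cv2); apply: nearW => n.
  have := tail (nu_ n) (la_ n) K (nu1 n) (la_mean n) (nu2 n).
  by rewrite distrC => h; rewrite -lerBlDl (le_trans (lerB_dist _ _)).
apply/eqP; rewrite -normr_le0.
have cv : tau K + tau K @[K --> \oo] --> (0 : R).
  by rewrite -[X in _ --> X](addr0 0); apply: cvgD; exact: clamp_tail.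
rewrite -(cvg_lim _ cv)//; apply: limr_ge; first by apply/cvg_ex; eexists; exact: cv.
exact: nearW.
Qed.

(** Plateaus with end points in [I] give the intervals with end points in [I]; as [nu] is carried by
    I x I, exhausting [I] gives all open intervals, which determine the identity on Borel sets. *)
Lemma martingale_transport_closed : martingale_transport I la mu nu.
Proof.
have n1 := fst_marginal_closed; have n2 := snd_marginal_closed.
split => //; apply/(martingaleP n1 n2 la_fin mu_fin).
have iX := integrable_increment n1 n2 la_fin mu_fin.
have itvI a b : I a -> I b ->
    \int[nu]_z (\1_`]a, b[%classic z.1 * (z.2 - z.1)) = 0.
  move=> Ia Ib.
  have cv : \int[nu]_z (plateau a b m z.1 * (z.2 - z.1)) @[m --> \oo] -->
      \int[nu]_z (\1_`]a, b[%classic z.1 * (z.2 - z.1)).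
    have mX : measurable_fun setT (fun z : R * R => z.2 - z.1).
      exact: measurable_funB.
    apply: (@Rintegral_cvg _ _ _ _ _ _ (fun z : R * R => `|z.2 - z.1|)).
    - move=> n; apply: measurable_funM => //; apply: measurableT_comp => //.
      by apply: continuous_measurable_fun; exact: plateau_continuous.
    - by apply: measurable_funM => //; apply: measurableT_comp.
    - by move=> z; apply: cvgMl; exact: plateau_cvg.
    - exact: integrable_norm.
    - by move=> n z; rewrite normrM ler_piMl// plateau_norm_le1.
  rewrite -(cvg_lim _ cv)//; under eq_fun do rewrite plateau_mart//.
  exact: lim_cst.
apply: Rintegral_indic_eq0_ext => // a b.
have [a_ [b_ [Iab _ _ ex]]] := interval_exhaustion I_nonempty I_open.
have mab : measurable (`]a, b[%classic : set R) by exact: measurable_itv.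
have -> : \int[nu]_z (\1_`]a, b[%classic z.1 * (z.2 - z.1)) =
    \int[nu]_z (\1_(`]a, b[ `&` I) z.1 * (z.2 - z.1)).
  apply: ae_eq_Rintegral.
  - apply: measurable_funM; last exact: measurable_funB.
    by apply: measurableT_comp => //; exact: measurable_indic.
  - apply: measurable_funM; last exact: measurable_funB.
    by apply: measurableT_comp => //; apply: measurable_indic; exact: measurableI.
  apply: filterS (carried_ae mII nuI) => z [z1 _].
  by rewrite !indicE in_setI [z.1 \in I]mem_set// andbT.
(* Intersecting with an exhausting interval brings the end points into [I], unless the intersection
   is empty. *)
pose A_ n : set R := `]a, b[ `&` `]ratr (a_ n), ratr (b_ n)[.
have cv : \int[nu]_z (\1_(A_ n) z.1 * (z.2 - z.1)) @[n --> \oo] -->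
    \int[nu]_z (\1_(`]a, b[ `&` I) z.1 * (z.2 - z.1)).
  apply: Rintegral_indic_cvg => //.
  - by move=> n; apply: measurableI => //; exact: measurable_itv.
  - exact: measurableI.
  move=> x; rewrite [\1__ x]indicE in_setI.
  have [/set_mem Ix|nIx] := boolP (x \in I).
    have [N hN] := ex x Ix; apply: cvg_near_cst; exists N => // n /= Nn.
    by rewrite indicE in_setI [x \in `]ratr _, _[%classic]mem_set//= in_itv/= hN.
  rewrite andbF; apply: cvg_near_cst; apply: nearW => n.
  rewrite indicE memNset// /A_ => -[_ /=]; rewrite in_itv/= => /andP[x1 x2].
  move/negP : nIx; apply; rewrite inE.
  by apply: (I_itv (Iab n).1 (Iab n).2); rewrite !ltW.
rewrite -(cvg_lim _ cv)//.
rewrite (_ : (fun n => _) = (fun=> 0)) ?lim_cst//; apply/funext => n.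
pose a' := Num.max a (ratr (a_ n)); pose b' := Num.min b (ratr (b_ n)).
have -> : A_ n = `]a', b'[%classic.
  apply/seteqP; split => x; rewrite /A_ /a' /b' /= !in_itv/= gt_max lt_min.
    by case=> /andP[-> ->] /andP[-> ->].
  by move=> /andP[/andP[-> ->] /andP[-> ->]].
have [a'b'|b'a'] := ltP a' b'; last first.
  rewrite -[RHS](Rintegral_cst1 nu); apply: eq_Rintegral => z _.
  by rewrite indicE memNset ?mul0r//= in_itv/= => /andP[h1 h2]; lra.
apply: itvI; apply: (I_itv (Iab n).1 (Iab n).2).
  by rewrite le_max lexx orbT/= (le_trans (ltW a'b'))// ge_min lexx orbT.
by rewrite ge_min lexx orbT andbT (le_trans _ (ltW a'b'))// le_max lexx orbT.
Qed.

End martingale_closed.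

(** * Convex functions *)

Section convex_functions.
Context (R : realType).
Implicit Types (I : set R) (g : R -> R).

Lemma convex_ineq I g (t x y : R) :
  convex_function (I : set R^o) (g : R^o -> R^o) -> I x -> I y ->
  0 <= t -> t <= 1 -> g (t * x + (1 - t) * y) <= t * g x + (1 - t) * g y.
Proof.
move=> cg Ix Iy t0 t1.
have xI : (x : R^o) \in (I : set R^o) by rewrite inE.
have yI : (y : R^o) \in (I : set R^o) by rewrite inE.
exact: (cg (Itv01 t0 t1) x y xI yI).
Qed.

Lemma convex_three_points I g (x y z : R) :
  convex_function (I : set R^o) (g : R^o -> R^o) -> I x -> I z ->
  x <= y <= z -> (z - x) * g y <= (z - y) * g x + (y - x) * g z.
Proof.
move=> cg Ix Iz /andP[xy yz]; have [xz|zx] := ltP x z; last first.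
  have -> : y = x by lra.
  have -> : z = x by lra.
  by rewrite subrr !mul0r addr0.
have zx0 : z - x != 0 by rewrite subr_eq0 gt_eqF.
pose t := (z - y) / (z - x).
have t0 : 0 <= t by rewrite divr_ge0// subr_ge0// ltW.
have t1 : t <= 1 by rewrite ler_pdivrMr ?subr_gt0// mul1r lerD2l lerN2.
have := convex_ineq cg Ix Iz t0 t1.
have -> : t * x + (1 - t) * z = y by rewrite /t; field.
have -> : (1 - t) = (y - x) / (z - x) by rewrite /t; field.
move=> h; have zx : 0 < z - x by rewrite subr_gt0.
have := ler_wpM2l (ltW zx) h; rewrite /t.
by congr (_ <= _); field.
Qed.

(** The slope is the supremum of the left difference quotients at [t], each of which is at most
    every right one; openness of [I] provides points on both sides. *)
Lemma subgradient I g (t : R) : open I ->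
  convex_function (I : set R^o) (g : R^o -> R^o) -> I t ->
  exists c : R, forall y, I y -> g t + c * (y - t) <= g y.
Proof.
move=> oI cg It.
have [u [Iu ut]] := open_rat_left oI It; have [v [Iv tv]] := open_rat_right oI It.
pose S := [set (g t - g x) / (t - x) | x in [set x | I x /\ x < t]].
have Sub z : I z -> t < z -> ubound S ((g z - g t) / (z - t)).
  move=> Iz tz _ [x [Ix xt] <-].
  have tx : 0 < t - x by rewrite subr_gt0.
  have zt : 0 < z - t by rewrite subr_gt0.
  rewrite ler_pdivrMr// mulrAC ler_pdivlMr//.
  have xtz : x <= t <= z by rewrite !ltW.
  by have := convex_three_points cg Ix Iz xtz; lra.
have hS : has_sup S.
  split; first by exists ((g t - g (ratr u)) / (t - ratr u)); exists (ratr u).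
  by exists ((g (ratr v) - g t) / (ratr v - t)); exact: Sub.
exists (sup S) => y Iy; have [ty|yt|<-] := ltgtP t y.
- have : sup S <= (g y - g t) / (y - t) by apply: ge_sup; [exact: hS.1|exact: Sub].
  by rewrite ler_pdivlMr ?subr_gt0//; lra.
- have : (g t - g y) / (t - y) <= sup S by apply: ub_le_sup; [exact: hS.2|exists y].
  by rewrite ler_pdivrMr ?subr_gt0//; lra.
- by rewrite subrr mulr0 addr0.
Qed.

(** A support line bounds the function from below, and the chords to two rational points [U < t < V]
    bound it from above, so it is Lipschitz at [t]. *)
Lemma convex_within_continuous I g : open I ->
  convex_function (I : set R^o) (g : R^o -> R^o) -> {within I, continuous g}.
Proof.
move=> oI cg; rewrite continuous_open_subspace// => t /set_mem It.
have [c hc] := subgradient oI cg It.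
have [u [Iu ut]] := open_rat_left oI It; have [v [Iv tv]] := open_rat_right oI It.
pose U : R := ratr u; pose V : R := ratr v.
pose A := (g V - g t) / (V - t); pose B := (g U - g t) / (t - U).
pose L := `|c| + `|A| + `|B| + 1.
have L0 : 0 < L by rewrite /L ltr_wpDl// !addr_ge0.
have lip y : U <= y <= V -> I y -> `|g t - g y| <= L * `|t - y|.
  move=> /andP[Uy yV] Iy; have h1 := hc y Iy.
  have h2 : g y - g t <= (`|A| + `|B|) * `|t - y|.
    have [ty|yt] := leP t y.
      have tyV : t <= y <= V by rewrite ty.
      have h := convex_three_points cg It Iv tyV.
      have Vt : 0 < V - t by rewrite subr_gt0.
      have gV : g V = g t + A * (V - t) by rewrite /A divfK ?gt_eqF//; ring.
      have h5 : g y - g t <= A * (y - t).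
        by rewrite -(ler_pM2l Vt); rewrite -/V gV in h; lra.
      have -> : `|t - y| = y - t by rewrite distrC ger0_norm// subr_ge0.
      apply: (le_trans h5); apply: ler_wpM2r; first by rewrite subr_ge0.
      by rewrite (le_trans (ler_norm A))// lerDl.
    have Uyt : U <= y <= t by rewrite Uy ltW.
    have h := convex_three_points cg Iu It Uyt.
    have tU : 0 < t - U by rewrite subr_gt0.
    have gU : g U = g t + B * (t - U) by rewrite /B divfK ?gt_eqF//; ring.
    have h5 : g y - g t <= B * (t - y).
      by rewrite -(ler_pM2l tU); rewrite -/U gU in h; lra.
    have -> : `|t - y| = t - y by rewrite gtr0_norm// subr_gt0.
    apply: (le_trans h5); apply: ler_wpM2r; first by rewrite subr_ge0 ltW.
    by rewrite (le_trans (ler_norm B))// lerDr.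
  have h3 : - (c * (y - t)) <= `|c| * `|t - y|.
    by rewrite distrC -normrM -normrN ler_norm.
  have h4 : 0 <= `|t - y| by [].
  have : 0 <= `|c| * `|t - y| by rewrite mulr_ge0.
  have : 0 <= (`|A| + `|B|) * `|t - y| by rewrite mulr_ge0// addr_ge0.
  by rewrite ler_norml /L; nra.
apply/cvgrPdist_lt => e e0.
have /nbhs_ballP[r /= r0 rI] := open_nbhs_nbhs (conj oI It).
apply/nbhs_ballP.
exists (Num.min (Num.min r (e / L)) (Num.min (t - U) (V - t))).
  by rewrite /= !lt_min r0 divr_gt0//= !subr_gt0 ut.
move=> y; rewrite /ball /= !lt_min => /andP[/andP[yr ye] /andP[yU yV]].
have Iy : I y by exact: rI.
have UyV : U <= y <= V.
  by move: yU yV; rewrite !ltr_norml => /andP[_ ?] /andP[? _]; apply/andP; split; lra.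
by apply: (le_lt_trans (lip y UyV Iy)); rewrite mulrC -ltr_pdivlMr.
Qed.

(* Countably many support lines suffice, so that a conditional Jensen inequality
   can be proved line by line, almost surely. *)
Lemma rational_support_lines I g (C : R) (c : rat -> R) (x s : R) : open I ->
  convex_function (I : set R^o) (g : R^o -> R^o) ->
  (forall y, I y -> `|g y| <= C) ->
  (forall q, I (ratr q) -> forall y, I y ->
    g (ratr q) + c q * (y - ratr q) <= g y) ->
  I x -> (forall q, I (ratr q) -> g (ratr q) + c q * (x - ratr q) <= s) ->
  g x <= s.
Proof.
move=> oI cg gC hc Ix hs.
have [cx hcx] := subgradient oI cg Ix.
have [v [Iv xv]] := open_rat_right oI Ix; pose V : R := ratr v.
have C0 : 0 <= C by apply: le_trans (gC x Ix).
(* [L] bounds the slope [c q] at rationals just above [x], increased by the size of the slope at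
   [x]; passing from [x] to [q] then costs at most [L] times the distance. *)
pose L := 4 * C / (V - x) + `|cx| + 1.
have Vx : 0 < V - x by rewrite subr_gt0.
have L0 : 0 < L by rewrite /L ltr_wpDl// addr_ge0// divr_ge0// ?mulr_ge0// ltW.
have /nbhs_ballP[r /= r0 rI] := open_nbhs_nbhs (conj oI Ix).
apply/ler_addgt0Pr => e e0.
pose d := Num.min (Num.min r (e / L)) ((V - x) / 2).
have d0 : 0 < d by rewrite !lt_min r0 !divr_gt0.
have xd : x < x + d by rewrite ltrDl.
have [q /[!in_itv]/= /andP[xq qd]] := rat_in_itvoo xd.
move: qd; rewrite -ltrBlDl !lt_min => /andP[/andP[qr qe] qV].
have Iq : I (ratr q).
  by apply: rI; rewrite /ball /= distrC ger0_norm// subr_ge0 ltW.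
have h1 := hs q Iq; have h2 := hcx _ Iq; have h3 := hc q Iq V Iv.
have h4 := gC _ Iv; have h5 := gC _ Iq.
pose w := ratr q - x; have w0 : 0 < w by rewrite /w subr_gt0.
have h6 : L * w < e by rewrite mulrC -ltr_pdivlMr.
(* The line at [q] stays below [g V], so its rise from [q] to [V] is at most [2 * C]; as [q] lies in
   the first half of the way from [x] to [V], the slope is at most [4 * C / (V - x)]. *)
have cq : c q <= 4 * C / (V - x).
  rewrite ler_pdivlMr//.
  have : g V - g (ratr q) <= 2 * C.
    by move: h4 h5; rewrite !ler_norml; lra.
  have [c0|c0] := leP (c q) 0; first by nra.
  by move: qV; rewrite ltr_pdivlMr//; nra.
have : - cx <= `|cx| by rewrite -normrN ler_norm.
rewrite /L in h6; rewrite (_ : ratr q = x + w) in h1 h2 *; last by rewrite /w; ring.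
move: h1 h2 h6; rewrite /w; nra.
Qed.

End convex_functions.

(** * Density of continuous functions in L1 *)

Section L1_density.
Context (R : realType) (la : probability R R).

Let approximable (f : R -> R) := [/\ measurable_fun [set: R] f,
  exists M : R, forall x, `|f x| <= M &
  forall e : R, 0 < e -> exists p : R -> R, [/\ continuous p,
    exists M : R, forall x, `|p x| <= M & \int[la]_x `|f x - p x| <= e]].

Let bd_int (f : R -> R) : measurable_fun [set: R] f ->
  (exists M : R, forall x, `|f x| <= M) -> la.-integrable setT (EFin \o f).
Proof. by move=> mf [M fM]; exact: bounded_fun_integrable fM. Qed.

Let bd_dist (f g : R -> R) : measurable_fun [set: R] f ->
  measurable_fun [set: R] g ->
  (exists M : R, forall x, `|f x| <= M) -> (exists M : R, forall x, `|g x| <= M) ->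
  la.-integrable setT (EFin \o (fun x => `|f x - g x|)).
Proof.
move=> mf mg bf bg; apply: (@integrable_norm _ _ _ _ _ (fun x => f x - g x)).
by apply: integrable_subr; exact: bd_int.
Qed.

Let approximable_lin (k : R) f g : approximable f -> approximable g ->
  approximable (fun x => k * f x + g x).
Proof.
move=> [mf [M fM] hf] [mg [N gN] hg]; split.
- by apply: measurable_funD => //; exact: measurable_funM.
- exists (`|k| * M + N) => x; rewrite (le_trans (ler_normD _ _))// lerD//.
  by rewrite normrM ler_wpM2l.
move=> e e0; pose e1 := e / (`|k| + 1).
have k1 : 0 < `|k| + 1 by rewrite ltr_wpDl.
have e10 : 0 < e1 by rewrite divr_gt0.
have [p [cp [Mp pM] hp]] := hf e1 e10; have [q [cq [Mq qM] hq]] := hg e1 e10.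
have mp := continuous_measurable_fun cp; have mq := continuous_measurable_fun cq.
exists (fun x => k * p x + q x); split.
- by move=> x; apply: cvgD; [apply: cvgMr; exact: cp|exact: cq].
- exists (`|k| * Mp + Mq) => x; rewrite (le_trans (ler_normD _ _))// lerD//.
  by rewrite normrM ler_wpM2l.
have i1 : la.-integrable setT (EFin \o (fun x => `|f x - p x|)).
  by apply: bd_dist => //; [exists M|exists Mp].
have i2 : la.-integrable setT (EFin \o (fun x => `|g x - q x|)).
  by apply: bd_dist => //; [exists N|exists Mq].
apply: (@le_trans _ _ (\int[la]_x (`|k| * `|f x - p x| + `|g x - q x|))).
  apply: le_Rintegral => //; last first.
  - move=> x _; rewrite -normrM -[leRHS]/(_ + _).
    rewrite (_ : _ - _ = k * (f x - p x) + (g x - q x)); last by ring.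
    exact: ler_normD.
  - by apply: integrable_addr => //; exact: integrable_mulr.
  apply: bd_dist.
  - by apply: measurable_funD => //; exact: measurable_funM.
  - by apply: measurable_funD => //; exact: measurable_funM.
  - exists (`|k| * M + N) => x; rewrite (le_trans (ler_normD _ _))// lerD//.
    by rewrite normrM ler_wpM2l.
  - exists (`|k| * Mp + Mq) => x; rewrite (le_trans (ler_normD _ _))// lerD//.
    by rewrite normrM ler_wpM2l.
rewrite RintegralD//; last exact: integrable_mulr.
rewrite RintegralZl//.
have : `|k| * (\int[la]_x `|f x - p x|) <= `|k| * e1 by rewrite ler_wpM2l.
have -> : e = `|k| * e1 + e1 by rewrite /e1; field; lra.
by lra.
Qed.

Let approximable_lim (f_ : nat -> R -> R) (f : R -> R) (M : R) :
  (forall n, measurable_fun [set: R] (f_ n)) -> measurable_fun [set: R] f ->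
  (forall n x, `|f_ n x| <= M) -> (forall x, f_ ^~ x @ \oo --> f x) ->
  (forall n, approximable (f_ n)) -> approximable f.
Proof.
move=> mf_ mf fM ff af.
have fM' x : `|f x| <= M.
  have c : `|f_ n x| @[n --> \oo] --> `|f x| by exact: cvg_norm (ff x).
  rewrite -(cvg_lim _ c)//; apply: limr_le; first by apply/cvg_ex; eexists; exact: c.
  exact: nearW.
split => //; first by exists M.
move=> e e0; have e2 : 0 < e / 2 by rewrite divr_gt0.
have cv : \int[la]_x `|f x - f_ n x| @[n --> \oo] --> \int[la]_x (0 : R).
  apply: (@Rintegral_cvg_bounded _ _ _ _ _ _ (M + M)) => //.
  - by move=> n; apply: measurableT_comp => //; exact: measurable_funB.
  - move=> x; rewrite -(@normr0 _ R) -(subrr (f x)); apply: cvg_norm.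
    by apply: cvgB; [exact: cvg_cst|exact: ff].
  - by move=> n x; rewrite normr_id (le_trans (ler_normB _ _))// lerD.
rewrite Rintegral_cst1 in cv.
have /cvgrPdist_le/(_ _ e2)[N _ /(_ N (leqnn N))] := cv.
rewrite sub0r normrN /= => hN.
have [_ _ /(_ _ e2)[p [cp [Mp pM] hp]]] := af N.
have mp := continuous_measurable_fun cp.
exists p; split => //; first by exists Mp.
have i1 : la.-integrable setT (EFin \o (fun x => `|f x - f_ N x|)).
  by apply: bd_dist => //; exists M.
have i2 : la.-integrable setT (EFin \o (fun x => `|f_ N x - p x|)).
  by apply: bd_dist => //; [exists M|exists Mp].
apply: (@le_trans _ _ (\int[la]_x (`|f x - f_ N x| + `|f_ N x - p x|))).
  apply: le_Rintegral => //.
  - by apply: bd_dist => //; [exists M|exists Mp].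
  - exact: integrable_addr.
  - by move=> x _; exact: ler_distD.
rewrite RintegralD// [leRHS]splitr lerD//.
by rewrite (le_trans (ler_norm _)).
Qed.

Let approximable_indic A : measurable A -> approximable \1_A.
Proof.
move=> mA.
have a1 : approximable (fun=> 1).
  split => //; first by exists 1 => x; rewrite normr1.
  move=> e e0; exists (fun=> 1); split; first by move=> x; exact: cvg_cst.
    by exists 1 => x; rewrite normr1.
  by under eq_Rintegral do rewrite subrr normr0; rewrite Rintegral_cst1 ltW.
have aC B : approximable \1_B -> approximable \1_(~` B).
  move=> aB; have := approximable_lin (-1) aB a1; congr approximable.
  by apply/funext => x; rewrite !indicE in_setC; case: (x \in B) => /=; ring.
have a0 : approximable (fun=> 0).
  have := approximable_lin (-1) a1 a1; congr approximable.
  by apply/funext => x; ring.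
pose C B := approximable \1_B.
suff : C A by [].
apply: (@dynkin_induction _ R (@RGenOpens.G R) C) => //.
- exact: RGenOpens.measurableE.
- exact: open_interval_setI.
- by rewrite /C indicT.
- move=> _ [a [b ->]]; apply: (@approximable_lim (plateau a b) _ 1).
  + by move=> n; apply: continuous_measurable_fun; exact: plateau_continuous.
  + by apply: measurable_indic; exact: measurable_itv.
  + by move=> n x; exact: plateau_norm_le1.
  + by move=> x; exact: plateau_cvg.
  move=> n; split.
  + by apply: continuous_measurable_fun; exact: plateau_continuous.
  + by exists 1 => x; exact: plateau_norm_le1.
  move=> e e0; exists (plateau a b n); split; first exact: plateau_continuous.
    by exists 1 => x; exact: plateau_norm_le1.
  by under eq_Rintegral do rewrite subrr normr0; rewrite Rintegral_cst1 ltW.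
- by move=> S _; exact: aC.
- move=> F mF tF CF; pose S_ n := \big[setU/set0]_(i < n) F i.
  have mS n : measurable (S_ n) by exact: bigsetU_measurable.
  apply: (@approximable_lim (fun n => \1_(S_ n)) _ 1).
  + by move=> n; exact: measurable_indic.
  + by apply: measurable_indic; exact: bigcupT_measurable.
  + by move=> n x; exact: indic_norm_le1.
  + move=> x; have [[k _ Fkx]|nF] := pselect ((\bigcup_k F k) x).
      apply: cvg_near_cst; near=> n; rewrite !indicE mem_set; last first.
        by rewrite /S_ -bigcup_mkord; exists k => //=; near: n; exact: nbhs_infty_gt.
      by rewrite mem_set//; exists k.
    rewrite indicE memNset//; apply: cvg_near_cst; apply: nearW => n.
    rewrite indicE memNset// /S_ -bigcup_mkord => -[k _ Fkx].
    by apply: nF; exists k.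
  elim=> [|n ih]; first by rewrite /S_ big_ord0 indic0.
  have := approximable_lin 1 ih (CF n); congr approximable; apply/funext => x.
  rewrite /S_ big_ord_recr/= -/(S_ n) !indicE in_setU mul1r.
  case: (boolP (x \in F n)) => [/set_mem Fnx|_]; last by rewrite orbF addr0.
  rewrite orbT memNset ?add0r//.
  rewrite /S_ -bigcup_mkord => -[k /= kn Fkx].
  have kn' : k = n by apply: tF => //; exists x.
  by rewrite kn' ltnn in kn.
- have e : @measurable _ R = <<s @RGenOpens.G R >> := RGenOpens.measurableE R.
  by rewrite -e.
Unshelve. all: by end_near. Qed.

(** Induction on bounded measurable functions gives a continuous approximation; clamping it to
    [0, K], where [a] takes its values, only brings it nearer to [a]. *)
Lemma continuous_L1_dense (a : R -> R) (K e : R) : measurable_fun [set: R] a ->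
  (forall x, 0 <= a x <= K) -> 0 < e ->
  exists p : R -> R, [/\ continuous p, forall x, 0 <= p x <= K &
    \int[la]_x `|a x - p x| <= e].
Proof.
move=> ma aK e0.
have aK' x : `|a x| <= K by have /andP[h1 h2] := aK x; rewrite ger0_norm.
have [|||_ _ /(_ e e0)[p [cp [M pM] hp]]] :=
  @bounded_measurable_ind _ R R approximable _ _ _ a K ma aK'.
- exact: approximable_indic.
- by move=> k f g; exact: approximable_lin.
- by move=> f_ f N; exact: approximable_lim.
have K0 : 0 <= K by have /andP[h1 h2] := aK 0; exact: le_trans h1 h2.
pose q x := Num.max 0 (Num.min K (p x)).
have cq : continuous q.
  move=> x; apply: (continuous_max (@cvg_cst _ (0 : R^o) _ (nbhs x) _)).
  exact: (continuous_min (@cvg_cst _ (K : R^o) _ (nbhs x) _) (cp x)).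
have qK x : 0 <= q x <= K.
  by rewrite /q le_max lexx/= ge_max K0/= ge_min lexx.
exists q; split => //; apply: le_trans hp; apply: le_Rintegral => //.
- apply: bd_dist => //; first exact: continuous_measurable_fun.
    by exists K.
  by exists K => x; have /andP[h1 h2] := qK x; rewrite ger0_norm.
- apply: bd_dist => //; first exact: continuous_measurable_fun.
    by exists K.
  by exists M.
move=> x _; have /andP[a0 a1] := aK x; rewrite /q.
have [pK|Kp] := leP K (p x).
  rewrite (max_idPr _)//; have : a x - p x <= a x - K by lra.
  by move=> h; rewrite !ler0_norm; lra.
have [p0|p0] := leP 0 (p x); first by [].
by rewrite !ger0_norm; lra.
Qed.

End L1_density.

(** * Duality for the functional *)

Section concave_dual.
Context (R : realType) (phi : R -> R) (D : R).
Hypothesis D0 : 0 <= D.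
Hypothesis phi_concave : concave_function `[0, +oo[%classic phi.
Hypothesis phi_nd : {in `[0, D] &, {homo phi : x y / x <= y}}.
Hypothesis phi_cont : {within `[0, D], continuous phi}.

Let phi_three (x y z : R) : 0 <= x -> x <= y <= z ->
  (z - y) * phi x + (y - x) * phi z <= (z - x) * phi y.
Proof.
move=> x0 xyz; have /andP[xy yz] := xyz.
have Ix : `[0, +oo[%classic x by rewrite /= in_itv/= x0.
have Iz : `[0, +oo[%classic z.
  by rewrite /= in_itv/= andbT (le_trans x0)// (le_trans xy).
by have := convex_three_points phi_concave Ix Iz xyz; lra.
Qed.

Let phi_le (s t : R) : 0 <= s -> s <= t -> t <= D -> phi s <= phi t.
Proof.
move=> s0 st tD; apply: phi_nd => //; rewrite in_itv/=.
  by rewrite s0 (le_trans st).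
by rewrite (le_trans s0 st).
Qed.

(** A concave function on [0, +oo[ is continuous in the interior but may jump at 0, hence the case
    distinction. *)
Lemma measurable_phi_max : measurable_fun [set: R] (fun t => phi (Num.max 0 t)).
Proof.
have -> : (fun t => phi (Num.max 0 t)) = (fun t => if t <= 0 then phi 0 else phi t).
  by apply/funext => t; case: (leP t 0) => // t0; rewrite max_l.
apply: measurable_fun_if => //; first exact: measurable_fun_ler.
have -> : [set: R] `&` (fun x : R => x <= 0) @^-1` [set false] = `]0, +oo[%classic.
  apply/seteqP; split => x /=; rewrite in_itv/= andbT ltNge; first by case=> _ ->.
  by move/negbTE => ->.
have cm : convex_function (`]0, +oo[%classic : set R^o) (fun x : R^o => - phi x : R^o).
  move=> t x y xI yI; apply: phi_concave.
    by move: xI; rewrite !inE /= !in_itv/= !andbT; exact: ltW.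
  by move: yI; rewrite !inE /= !in_itv/= !andbT; exact: ltW.
have oI : open (`]0, +oo[%classic : set R) by exact: interval_open.
have cphi := convex_within_continuous oI cm.
apply: open_continuous_measurable_fun => //.
rewrite continuous_open_subspace// in cphi.
move=> x xI; rewrite (_ : phi = (fun y => - - phi y)); last first.
  by apply/funext => y; rewrite opprK.
by apply: cvgN; exact: cphi.
Qed.

Definition concave_conj (p : R) : R :=
  sup [set phi s - p * s | s in `[0, D]%classic].

Lemma concave_conj_ge p s : 0 <= s <= D -> phi s <= p * s + concave_conj p.
Proof.
move=> sD; rewrite -lerBlDl; apply: ub_le_sup; last by exists s.
exists (phi D + `|p| * D) => _ [t + <-]; rewrite /= in_itv/= => /andP[t0 tD].
rewrite lerD//; first exact: phi_le.
by rewrite (le_trans (ler_norm _))// normrN normrM ler_pM// ger0_norm.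
Qed.

Lemma concave_conj_le p M : (forall s, 0 <= s <= D -> phi s - p * s <= M) ->
  concave_conj p <= M.
Proof.
move=> h; apply: ge_sup; first by exists (phi 0 - p * 0), 0 => //=; rewrite in_itv/= lexx.
by move=> _ [t + <-]; rewrite /= in_itv/= => tD; exact: h.
Qed.

(** A supremum of affine functions of [p] whose slopes lie in [-D, 0]. *)
Lemma concave_conj_lip p p' :
  `|concave_conj p - concave_conj p'| <= D * `|p - p'|.
Proof.
suff h q q' : concave_conj q - concave_conj q' <= D * `|q - q'|.
  by rewrite ler_norml; have := h p p'; have := h p' p; rewrite [`|p' - p|]distrC; lra.
rewrite lerBlDl; apply: concave_conj_le => s sD.
have := concave_conj_ge q' sD.
have : (q' - q) * s <= D * `|q - q'|.
  have /andP[s0 s1] := sD.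
  rewrite (le_trans (ler_norm _))// normrM mulrC distrC ler_wpM2r//.
  by rewrite ger0_norm.
by lra.
Qed.

Lemma concave_conj_continuous : continuous concave_conj.
Proof.
move=> x; apply/cvgrPdist_lt => e e0.
apply/nbhs_ballP; exists (e / (D + 1)) => /=; first by rewrite divr_gt0// ltr_wpDl.
move=> y; rewrite /ball /= => xy; apply: (le_lt_trans (concave_conj_lip _ _)).
have D1 : 0 < D + 1 by rewrite ltr_wpDl.
move: xy; rewrite ltr_pdivlMr// => xy; apply: le_lt_trans xy.
by rewrite mulrC ler_wpM2l// lerDl.
Qed.

Lemma concave_conj_attained e : 0 < e -> exists P : R -> R, exists K : R,
  [/\ measurable_fun [set: R] P, forall t, 0 <= P t <= K &
    forall t, 0 <= t <= D -> P t * t + concave_conj (P t) <= phi t + e].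
Proof.
move=> e0.
have [h h0 hphi] : exists2 h : R, 0 < h & forall u, 0 <= u <= D -> u < h ->
    phi u - phi 0 <= e.
  move/subspace_continuousP : phi_cont => /(_ 0).
  rewrite /= in_itv/= lexx D0 => /(_ isT)/cvgrPdist_le/(_ e e0).
  move=> /nbhs_ballP[h /= h0 hh]; exists h => // u uD uh.
  have := hh u; rewrite /ball /= sub0r normrN ger0_norm; last by case/andP: uD.
  move=> /(_ uh); rewrite in_itv/= => /(_ uD).
  by rewrite distrC => h1; exact: le_trans (ler_norm _) h1.
(* Clamping extends [phi] from [0, D] to a monotone function on the line, so that [P] is a
   difference of monotone functions and the chord may overshoot [D]. *)
pose cl (t : R) := Num.min D (Num.max 0 t).
have cl_in (t : R) : 0 <= cl t <= D by rewrite /cl le_min D0 le_max lexx/= ge_min lexx.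
have cl_nd (s t : R) : s <= t -> cl s <= cl t.
  move=> st; rewrite /cl le_min ge_min lexx/= ge_min; apply/orP; right.
  by rewrite ge_max le_max lexx/= le_max st orbT.
have cl_id (t : R) : 0 <= t <= D -> cl t = t.
  by case/andP=> t0 tD; rewrite /cl (max_idPr t0) (min_idPr tD).
pose ph (t : R) := phi (cl t).
have ph_nd (s t : R) : s <= t -> ph s <= ph t.
  move=> st; have /andP[s0 sD] := cl_in s; have /andP[t0 tD] := cl_in t.
  by apply: phi_le => //; exact: cl_nd.
pose P (t : R) := (ph (t + h) - ph t) / h.
pose K := (phi D - phi 0) / h.
have P_ge0 (t : R) : 0 <= P t.
  apply: divr_ge0; last exact: ltW.
  by rewrite subr_ge0; apply: ph_nd; rewrite lerDl ltW.
exists P, K; split.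
- apply: measurable_funM => //; apply: measurable_funB.
    by apply: nondecreasing_measurable => // s t st; apply: ph_nd; rewrite lerD2r.
  by apply: nondecreasing_measurable => // s t st; exact: ph_nd.
- move=> t; rewrite P_ge0 /P ler_pM2r ?invr_gt0//; apply: lerB.
    by have /andP[? ?] := cl_in (t + h); exact: phi_le.
  by have /andP[? ?] := cl_in t; exact: phi_le.
move=> t tD; have /andP[t0 tD1] := tD.
have PE : h * P t = ph (t + h) - ph t by rewrite /P mulrC divfK// gt_eqF.
have P0 := P_ge0 t.
suff H (s : R) : 0 <= s <= D -> phi s <= phi t + P t * (s - t) + e.
  rewrite -lerBrDl; apply: concave_conj_le => s sD; have := H s sD; lra.
move=> sD; have /andP[s0 sD1] := sD.
have phtE : ph t = phi t by rewrite /ph cl_id.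
rewrite phtE in PE.
(* To the left of [t] the chord slopes of a concave function are larger, so the line is above [phi]
   without error. *)
have [st|ts] := leP s t.
  have ge_e : phi s <= phi t + P t * (s - t) -> phi s <= phi t + P t * (s - t) + e.
    by move=> H; rewrite (le_trans H)// lerDl ltW.
  apply: ge_e.
  pose t' := cl (t + h).
  have tt' : t <= t' by rewrite -[leLHS](cl_id t tD); apply: cl_nd; rewrite lerDl ltW.
  have t'h : t' - t <= h.
    rewrite lerBlDl /t' /cl ge_min; apply/orP; right.
    by rewrite ge_max lexx andbT addr_ge0// ltW.
  have h3 : (t' - t) * phi s + (t - s) * phi t' <= (t' - s) * phi t.
    by apply: phi_three => //; rewrite st.
  have mono : phi s <= phi t by exact: phi_le.
  have h4 : h * P t * (t - s) <= h * (phi t - phi s).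
    rewrite PE -/t' -[ph (t + h)]/(phi t').
    apply: (@le_trans _ _ ((t' - t) * (phi t - phi s))); first by lra.
    by rewrite ler_wpM2r ?subr_ge0.
  by move: h4; rewrite -mulrA ler_pM2l//; lra.
(* Below the chord the error appears: by concavity the increment of [phi] from [t] to [s] is at most
   its increment from 0 to [s - t]. *)
have [sth|ths] := ltP s (t + h).
  have h1 : phi (s - t) - phi 0 <= e.
    apply: hphi; last by rewrite ltrBlDl.
    by rewrite subr_ge0 ltW//=; lra.
  have a1 : (s - t) * phi 0 + (t - 0) * phi s <= (s - 0) * phi t.
    by apply: phi_three => //; rewrite t0 ltW.
  have a2 : (s - (s - t)) * phi 0 + ((s - t) - 0) * phi s <= (s - 0) * phi (s - t).
    by apply: phi_three => //; rewrite subr_ge0 ltW//=; lra.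
  have s1 : 0 < s by rewrite (le_lt_trans t0).
  have h2 : phi s - phi t <= phi (s - t) - phi 0.
    by rewrite -(ler_pM2l s1); lra.
  have : 0 <= P t * (s - t) by rewrite mulr_ge0// subr_ge0 ltW.
  by lra.
(* Beyond [t + h] the extended chord is above [phi], again without error. *)
have thD : 0 <= t + h <= D by apply/andP; split; lra.
have h3 : (s - (t + h)) * phi t + ((t + h) - t) * phi s <= (s - t) * phi (t + h).
  by apply: phi_three => //; rewrite lerDl ths ltW.
have PE' : h * P t = phi (t + h) - phi t by rewrite PE /ph cl_id.
have h5 : phi (t + h) = phi t + h * P t by lra.
have h4 : phi s <= phi t + P t * (s - t).
  by rewrite -(ler_pM2l h0); rewrite h5 in h3; lra.
by rewrite (le_trans h4)// lerDl ltW.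
Qed.

End concave_dual.

Section functional.
Context (R : realType) (I : set R) (gamma phi : R -> R).
Hypotheses (I_nonempty : I !=set0) (I_open : open I).
Hypothesis gamma_convex : convex_function (I : set R^o) (gamma : R^o -> R^o).
Hypothesis gamma_bounded : [bounded (gamma x : R^o) | x in I].

Let C : R := supnorm I gamma.
Let D : R := 2 * C.
Let gI : R -> R := gamma \_ I.

Lemma supnorm_ge x : I x -> `|gamma x| <= supnorm I gamma.
Proof.
move=> Ix; apply: ub_le_sup; last by exists x.
have [M [Mr hM]] := gamma_bounded.
by exists (M + 1) => _ [y Iy <-]; apply: hM => //; rewrite ltrDl.
Qed.

Let C0 : 0 <= C.
Proof. by have [x Ix] := I_nonempty; exact: le_trans (supnorm_ge Ix). Qed.

Let D0 : 0 <= D.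
Proof. by rewrite mulr_ge0. Qed.

Hypothesis phi_concave : concave_function `[0, +oo[%classic phi.
Hypothesis phi_nd : {in `[0, 2 * supnorm I gamma] &, {homo phi : x y / x <= y}}.
Hypothesis phi_cont : {within `[0, 2 * supnorm I gamma], continuous phi}.

Lemma restrict_gamma_norm x : `|(gamma \_ I) x| <= supnorm I gamma.
Proof.
rewrite patchE; case: ifPn => [/set_mem/supnorm_ge//|_].
by rewrite normr0; exact: C0.
Qed.

Lemma measurable_restrict_gamma : measurable_fun [set: R] (gamma \_ I).
Proof.
have Cg : @Cb R R I gamma by split => //; exact: convex_within_continuous.
by have [] := Cb1_restrict I_open Cg.
Qed.

Let mg := measurable_restrict_gamma.
Let mI := open_measurable I_open.

Section fixed_transport.
Variables (la mu : probability R R) (nu : probability (R * R)%type R).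
Hypotheses (laI : carried_by la I) (muI : carried_by mu I).
Hypotheses (la_fin : finite_mean la) (mu_fin : finite_mean mu).
Hypothesis nuM : martingale_transport I la mu nu.

Let nuI : carried_by nu (I `*` I). Proof. by case: nuM. Qed.
Let n1 : forall B, measurable B -> nu (fst @^-1` B) = la B.
Proof. by case: nuM. Qed.
Let n2 : forall B, measurable B -> nu (snd @^-1` B) = mu B.
Proof. by case: nuM. Qed.
Let nu_mart : forall B, measurable B -> \int[nu]_z (\1_B z.1 * (z.2 - z.1)) = 0.
Proof. by apply/(martingaleP n1 n2 la_fin mu_fin); case: nuM. Qed.

Let m1 (B : set R) : measurable B ->
  measurable_fun setT (fun z : R * R => \1_B z.1 : R).
Proof. by move=> mB; apply: measurableT_comp => //; exact: measurable_indic. Qed.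

Let i1 (B : set R) (f : R * R -> R) : measurable B ->
  nu.-integrable setT (EFin \o f) ->
  nu.-integrable setT (EFin \o (fun z => \1_B z.1 * f z)).
Proof.
move=> mB fi; apply: (@integrableMbounded _ _ _ _ _ _ 1) => //; first exact: m1.
by move=> z; exact: indic_norm_le1.
Qed.

Let mg2 : measurable_fun setT (fun z : R * R => gI z.2).
Proof. exact: measurableT_comp. Qed.

Let mg1 : measurable_fun setT (fun z : R * R => gI z.1).
Proof. exact: measurableT_comp. Qed.

Let ig2 : nu.-integrable setT (EFin \o (fun z : R * R => gI z.2)).
Proof. by apply: bounded_fun_integrable mg2 _ => z; exact: restrict_gamma_norm. Qed.

Let ig1 : nu.-integrable setT (EFin \o (fun z : R * R => gI z.1)).
Proof. by apply: bounded_fun_integrable mg1 _ => z; exact: restrict_gamma_norm. Qed.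

Let indic_fst (B : set R) : measurable B -> \int[nu]_z \1_B z.1 = pr la B.
Proof.
move=> mB; have iB := integrable_indicr la mB.
have [_ e] := fst_integral n1 (measurable_indic mB) iB.
by rewrite e; exact: Rintegral_indic.
Qed.

(** [zeta] represents the conditional mean of [gI] at the second coordinate as a function of the
    first. An affine change of scale brings the variable into [0, 1], where the density lemma
    applies. *)
Let regression : exists zeta : R -> R, [/\ measurable_fun [set: R] zeta,
  exists M : R, forall x, `|zeta x| <= M &
  forall B, measurable B ->
    \int[nu]_z (\1_B z.1 * gI z.2) = \int[la]_x (\1_B x * zeta x)].
Proof.
(* Adding 1 keeps the scale positive when the supremum norm is 0. *)
pose c := C + 1; have c0 : 0 < c by rewrite /c ltr_wpDl.
pose Y (z : R * R) := (gI z.2 + c) / (2 * c).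
have Y01 z : 0 <= Y z <= 1.
  have := restrict_gamma_norm z.2; rewrite -/gI -/C ler_norml => /andP[h1 h2].
  by rewrite divr_ge0 ?ler_pdivrMr ?mul1r ?mulr_ge0 ?mulr_gt0//= /c; lra.
have mY : measurable_fun setT Y by apply: measurable_funM => //; exact: measurable_funD.
have iY : nu.-integrable setT (EFin \o Y).
  apply: (@bounded_fun_integrable _ _ _ _ _ 1) => // z.
  by have /andP[h1 h2] := Y01 z; rewrite ger0_norm.
pose L B := \int[nu]_z (\1_B z.1 * Y z).
have [F [mF F01 LF]] : exists F : R -> R, [/\ measurable_fun [set: R] F,
    forall x, 0 <= F x <= 1 &
    forall B, measurable B -> L B = \int[la]_x (\1_B x * F x)].
  apply: dominated_density.
  - move=> A mA; apply: Rintegral_ge0 => z _.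
    by have /andP[h _] := Y01 z; rewrite mulr_ge0.
  - move=> A mA; rewrite -indic_fst//; apply: le_Rintegral => //.
    + exact: i1.
    + have := i1 mA (integrable_cstr nu 1); congr (_.-integrable _ _).
      by apply/funext => z /=; rewrite mulr1.
    + move=> z _; have /andP[h1 h2] := Y01 z.
      by rewrite ler_piMr// indicE.
  - move=> A B mA mB /disj_setPS AB; rewrite /L -RintegralD//; [|exact: i1..].
    apply: eq_Rintegral => z _; rewrite -mulrDl; congr (_ * _).
    rewrite !indicE in_setU.
    case: (boolP (z.1 \in A)) => [/set_mem zA|_]; last by rewrite add0r.
    by rewrite memNset ?addr0// => zB; apply: (AB z.1).
have F_bd x : `|F x| <= 1 by have /andP[h1 h2] := F01 x; rewrite ger0_norm.
have iF B : measurable B -> la.-integrable setT (EFin \o (fun x => \1_B x * F x)).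
  move=> mB; apply: (@bounded_fun_integrable _ _ _ _ _ 1) => [|x].
    by apply: measurable_funM => //; exact: measurable_indic.
  by rewrite normrM mulr_ile1// indic_norm_le1.
exists (fun x => 2 * c * F x - c); split.
- by apply: measurable_funB => //; exact: measurable_funM.
- exists (2 * c + c) => x; rewrite (le_trans (ler_normB _ _))// lerD//; last first.
    by rewrite gtr0_norm.
  by rewrite normrM gtr0_norm ?mulr_gt0// ler_piMr// ?mulr_ge0// ltW.
move=> B mB.
have -> : \int[nu]_z (\1_B z.1 * gI z.2) = 2 * c * L B - c * pr la B.
  rewrite -indic_fst// /L -RintegralZl//; last exact: i1.
  have iB : nu.-integrable setT (EFin \o (fun z : R * R => \1_B z.1 : R)).
    have := i1 mB (integrable_cstr nu 1); congr (_.-integrable _ _).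
    by apply/funext => z /=; rewrite mulr1.
  rewrite -RintegralZl// -RintegralB//.
  - apply: eq_Rintegral => z _; rewrite /Y; field; lra.
  - by apply: integrable_mulr; exact: i1.
  - exact: integrable_mulr.
rewrite LF// -Rintegral_indic// -RintegralZl//; last exact: iF.
rewrite -RintegralZl//; last exact: integrable_indicr.
rewrite -RintegralB//; last 2 first.
- by apply: integrable_mulr; exact: iF.
- by apply: integrable_mulr; exact: integrable_indicr.
by apply: eq_Rintegral => x _; ring.
Qed.

Let la_of (f : R -> R) (B : set R) : measurable_fun [set: R] f ->
  la.-integrable setT (EFin \o f) -> measurable B ->
  \int[nu]_z (\1_B z.1 * f z.1) = \int[la]_x (\1_B x * f x).
Proof.
move=> mf fi mB.
have mBf : measurable_fun setT (fun x => \1_B x * f x).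
  by apply: measurable_funM => //; exact: measurable_indic.
have iBf : la.-integrable setT (EFin \o (fun x => \1_B x * f x)).
  apply: (@integrableMbounded _ _ _ _ _ _ 1) => //.
  by move=> x; exact: indic_norm_le1.
by have [_ ->] := fst_integral n1 mBf iBf.
Qed.

(** The lower bound is a conditional Jensen inequality: each support line at a rational point gives
    an almost sure inequality, and countably many of them determine [gamma] on [I]. *)
Let regression_bounds (zeta : R -> R) : measurable_fun [set: R] zeta ->
  (exists M : R, forall x, `|zeta x| <= M) ->
  (forall B, measurable B ->
    \int[nu]_z (\1_B z.1 * gI z.2) = \int[la]_x (\1_B x * zeta x)) ->
  {ae la, forall x, gI x <= zeta x <= C}.
Proof.
move=> mz [M zM] hz.
have iz : la.-integrable setT (EFin \o zeta) by exact: bounded_fun_integrable zM.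
have up : {ae la, forall x, zeta x <= C}.
  apply: (ae_le_of_indic iz (integrable_cstr la C)) => B mB.
  rewrite -hz// -(@la_of (fun=> C)) ?integrable_cstr//.
  apply: le_Rintegral => //; [exact: i1|exact/i1/integrable_cstr|].
  move=> z _; rewrite ler_wpM2l ?indicE//.
  exact: le_trans (ler_norm _) (restrict_gamma_norm _).
have [c hc] : exists c : rat -> R, forall q, I (ratr q) -> forall y, I y ->
    gamma (ratr q) + c q * (y - ratr q) <= gamma y.
  have /choice[c hc] : forall q : rat, exists c : R, I (ratr q) -> forall y, I y ->
      gamma (ratr q) + c * (y - ratr q) <= gamma y.
    move=> q; have [Iq|nIq] := pselect (I (ratr q)); last by exists 0.
    by have [c hc] := subgradient I_open gamma_convex Iq; exists c.
  by exists c.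
pose en n : rat := odflt 0 (unpickle n).
have low : {ae la, forall x, forall n, I (ratr (en n)) ->
    gamma (ratr (en n)) + c (en n) * (x - ratr (en n)) <= zeta x}.
  apply/ae_foralln => n; set q := en n.
  have [Iq|nIq] := pselect (I (ratr q)); last by apply: aeW.
  have : {ae la, forall x, gamma (ratr q) + c q * (x - ratr q) <= zeta x}.
    pose l (x : R) := gamma (ratr q) + c q * (x - ratr q).
    have ml : measurable_fun setT l.
      by apply: measurable_funD => //; apply: measurable_funM => //; exact: measurable_funB.
    have il (P : probability R R) : finite_mean P -> P.-integrable setT (EFin \o l).
      move=> Pf; apply: integrable_addr; first exact: integrable_cstr.
      apply: integrable_mulr; apply: (@integrable_subr _ _ _ _ (fun x : R => x)) => //.
      exact: integrable_cstr.
    apply: (ae_le_of_indic (il la la_fin) iz) => B mB.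
    rewrite -hz// -la_of//; last exact: il.
    have [il2 _] := snd_integral n2 ml (il mu mu_fin).
    have [il1 _] := fst_integral n1 ml (il la la_fin).
    (* By the martingale property, an affine function has the same integrals at both coordinates
       over events of the first. *)
    have -> : \int[nu]_z (\1_B z.1 * l z.1) = \int[nu]_z (\1_B z.1 * l z.2).
      apply/eqP; rewrite eq_sym -subr_eq0 -RintegralB//; [|exact: i1..].
      rewrite (_ : (fun z : R * R => _) =
        (fun z : R * R => c q * (\1_B z.1 * (z.2 - z.1)))); last first.
        by apply/funext => z; rewrite /l; ring.
      rewrite RintegralZl ?nu_mart ?mulr0//.
      by apply: i1 => //; exact: (integrable_increment n1 n2).
    apply: ae_le_Rintegral; [exact: i1|exact: i1|].
    apply: filterS (carried_ae (measurableX mI mI) nuI) => z [_ Iz2].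
    rewrite ler_wpM2l ?indicE// /gI patchE mem_set//; exact: hc.
  by apply: filterS => x h _.
apply: filterS2 (filterI up low) (carried_ae mI laI) => x [h1 h2] Ix.
rewrite h1 andbT /gI patchE mem_set//.
apply: (rational_support_lines I_open gamma_convex supnorm_ge hc Ix) => q Iq.
by have := h2 (pickle q); rewrite /en pickleK; exact.
Qed.

Let phi_int (w : R -> R) : measurable_fun [set: R] w ->
  (forall x, 0 <= w x <= D) ->
  measurable_fun setT (fun z : R * R => phi (w z.1)) /\
  nu.-integrable setT (EFin \o (fun z : R * R => phi (w z.1))).
Proof.
move=> mw w_in.
have phiw : measurable_fun setT (fun z : R * R => phi (w z.1)).
  rewrite (_ : (fun z => _) = (fun t => phi (Num.max 0 t)) \o (fun z : R * R => w z.1)).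
    apply: measurableT_comp; first exact: measurable_phi_max phi_concave.
    exact: measurableT_comp.
  by apply/funext => z /=; rewrite (max_idPr _)//; have /andP[] := w_in z.1.
split=> //.
apply: (@bounded_fun_integrable _ _ _ _ _ (`|phi 0| + `|phi D|)) => // z.
have /andP[h1 h2] := w_in z.1.
have a1 : phi 0 <= phi (w z.1) by apply: phi_nd; rewrite ?in_itv/= ?lexx ?D0 ?h1.
have a2 : phi (w z.1) <= phi D by apply: phi_nd; rewrite ?in_itv/= ?lexx ?D0 ?h1.
have := ler_norm (phi D); have := ler_norm (- phi 0); rewrite normrN => b1 b2.
have b3 : 0 <= `|phi 0| by []. have b4 : 0 <= `|phi D| by [].
by rewrite ler_norml; apply/andP; split; lra.
Qed.

(* [w X_1] is a version of the argument of phi in J. *)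
Lemma J_representation : exists w : R -> R, [/\ measurable_fun [set: R] w,
  forall x, 0 <= w x <= 2 * supnorm I gamma,
  forall B, measurable B -> \int[nu]_z (\1_B z.1 * (gI z.2 - gI z.1)) =
    \int[nu]_z (\1_B z.1 * w z.1) &
  J I gamma phi nu = (\int[nu]_z phi (w z.1))%:E].
Proof.
have [zeta [mz [M zM] hz]] := regression.
have bounds := regression_bounds mz (ex_intro _ M zM) hz.
have iz : la.-integrable setT (EFin \o zeta) by exact: bounded_fun_integrable zM.
have mz1 : measurable_fun setT (fun z : R * R => zeta z.1) by exact: measurableT_comp.
have iz1 : nu.-integrable setT (EFin \o (fun z : R * R => zeta z.1)).
  by apply: bounded_fun_integrable mz1 _ => z; exact: zM.
(* The bounds on [zeta - gI] hold almost surely; clamping makes them hold at every point. *)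
pose w x := Num.max 0 (Num.min D (zeta x - gI x)).
have mw : measurable_fun setT w.
  apply: measurable_maxr => //; apply: measurable_minr => //.
  exact: measurable_funB.
have w_in x : 0 <= w x <= D.
  by rewrite /w le_max lexx/= ge_max D0/= ge_min lexx.
have ae_nu (Q : R -> Prop) : {ae la, forall x, Q x} -> {ae nu, forall z, Q z.1}.
  move=> [N [mN N0 NQ]]; exists (fst @^-1` N); split.
  - exact: (measurable_preimage measurable_fst).
  - by rewrite n1.
  - by move=> z h; exact: NQ.
have w_ae : {ae nu, forall z, w z.1 = zeta z.1 - gI z.1}.
  apply: (@ae_nu (fun x => w x = zeta x - gI x)); apply: filterS bounds => x /andP[h1 h2].
  have := restrict_gamma_norm x; rewrite -/gI -/C ler_norml => /andP[h3 h4].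
  by rewrite /w (min_idPr _) ?(max_idPr _) ?subr_ge0// /D; lra.
have mw1 : measurable_fun setT (fun z : R * R => w z.1) by exact: measurableT_comp.
exists w; split => //.
- move=> B mB.
  have -> : \int[nu]_z (\1_B z.1 * w z.1) =
      \int[nu]_z (\1_B z.1 * (zeta z.1 - gI z.1)).
    apply: ae_eq_Rintegral.
    + by apply: measurable_funM => //; exact: m1.
    + by apply: measurable_funM; [exact: m1|exact: measurable_funB].
    + by apply: filterS w_ae => z ->.
  have E (f g : R * R -> R) : nu.-integrable setT (EFin \o f) ->
      nu.-integrable setT (EFin \o g) -> \int[nu]_z (\1_B z.1 * (f z - g z)) =
      \int[nu]_z (\1_B z.1 * f z) - \int[nu]_z (\1_B z.1 * g z).
    move=> fi gi; rewrite -RintegralB//; [|exact: i1..].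
    by apply: eq_Rintegral => z _; rewrite mulrBr.
  by rewrite (E (fun z => gI z.2) (fun z => gI z.1))//
    (E (fun z => zeta z.1) (fun z => gI z.1))// hz// (la_of mz iz).
pose Y : R * R -> R := gI \o snd.
(* A version exists, so [cond_exp] is a genuine conditional expectation and not its default value
   0. *)
have ex : is_cond_exp nu (fst : R * R -> R) Y (fun z => zeta z.1).
  split => //.
    move=> _ B mB; exists (zeta @^-1` B); last by rewrite setTI.
    exact: (measurable_preimage mz).
  move=> B mB; rewrite !integral_fst_preimage//; congr EFin.
  by rewrite la_of// -hz.
have [iY iZ mZ hZ] := xgetPex (cst 0) (ex_intro _ _ ex).
rewrite -/(cond_exp nu (fst : R * R -> R) Y) in iZ mZ hZ.
set Z := cond_exp _ _ _ in iZ mZ hZ.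
have mZ' := integrable_measurable iZ.
have hZz B : measurable B -> \int[nu]_z (\1_B z.1 * Z z) =
    \int[nu]_z (\1_B z.1 * zeta z.1).
  move=> mB; have := hZ B mB; rewrite !integral_fst_preimage// => -[->].
  by rewrite la_of// -hz.
have mz1' : measurable_fun [set: g_sigma_algebra_preimageType (fst : R * R -> R)]
    (fun z : R * R => zeta z.1).
  by case: ex.
(* Integrals of the chosen version are known only over events of the first coordinate. Both
   functions are measurable for that sigma-field, so their level sets are such events. *)
have Z_ae : {ae nu, forall z, Z z = zeta z.1}.
  have le1 : {ae nu, forall z, Z z <= zeta z.1}.
    apply: (ae_le_of_level_set iZ iz1).
    have := measurable_fun_ltr mz1' mZ measurableT (Y := [set true]) Logic.I.
    move=> [B mB]; rewrite !setTI => BE.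
    rewrite (_ : [set y | zeta y.1 < Z y] = fst @^-1` B); last first.
      by rewrite BE.
    by rewrite le_eqVlt hZz ?eqxx.
  have le2 : {ae nu, forall z, zeta z.1 <= Z z}.
    apply: (ae_le_of_level_set iz1 iZ).
    have := measurable_fun_ltr mZ mz1' measurableT (Y := [set true]) Logic.I.
    move=> [B mB]; rewrite !setTI => BE.
    rewrite (_ : [set y | Z y < zeta y.1] = fst @^-1` B); last first.
      by rewrite BE.
    by rewrite le_eqVlt hZz ?eqxx.
  by apply: filterS2 le1 le2 => z h1 h2; apply/eqP; rewrite eq_le h1.
have mphi := measurable_phi_max phi_concave.
have [phiw iphi] := phi_int mw w_in.
rewrite /J unlock -EFin_Rintegral//.
apply: ae_eq_integral => //.
- apply/measurable_EFinP.
  apply: (measurableT_comp mphi); apply: measurable_funB => //.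
- exact/measurable_EFinP.
apply: filterS2 Z_ae w_ae => z zZ zw _; congr EFin.
rewrite -/Y -/Z zZ -/gI -zw (max_idPr _)//.
by have /andP[] := w_in z.1.
Qed.

Let conj := concave_conj phi D.

Lemma J_fin_num : J I gamma phi nu \is a fin_num.
Proof. by have [w [_ _ _ ->]] := J_representation. Qed.

Let p_int (p : R -> R) (K : R) : measurable_fun [set: R] p ->
  (forall x, 0 <= p x <= K) ->
  [/\ measurable_fun [set: R * R] (fun z => p z.1 * (gI z.2 - gI z.1)),
      nu.-integrable setT (EFin \o (fun z => p z.1 * (gI z.2 - gI z.1))) &
      nu.-integrable setT (EFin \o (fun z => conj (p z.1)))].
Proof.
move=> mp pK.
have pK' x : `|p x| <= K by have /andP[h1 h2] := pK x; rewrite ger0_norm.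
have mp1 : measurable_fun setT (fun z : R * R => p z.1) by exact: measurableT_comp.
split.
- by apply: measurable_funM => //; exact: measurable_funB.
- apply: (@integrableMbounded _ _ _ _ (fun z : R * R => p z.1) _ K) => //.
  exact: integrable_subr.
apply: (@bounded_fun_integrable _ _ _ _ _ (`|conj 0| + D * K)).
  apply: measurableT_comp => //; apply: continuous_measurable_fun.
  exact: concave_conj_continuous D0 phi_nd.
move=> z; rewrite -[X in `|X|](subrK (conj 0)) addrC (le_trans (ler_normD _ _))//.
rewrite lerD// (le_trans (concave_conj_lip D0 phi_nd _ _))// subr0.
by rewrite ler_wpM2l.
Qed.

(** A factor depending on the first coordinate only can be pulled out, which replaces the increment
    of [gI] by its conditional mean [w]. *)
Let p_rewrite (w : R -> R) (p : R -> R) (K : R) : measurable_fun [set: R] w ->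
  (forall x, 0 <= w x <= D) ->
  (forall B, measurable B -> \int[nu]_z (\1_B z.1 * (gI z.2 - gI z.1)) =
    \int[nu]_z (\1_B z.1 * w z.1)) ->
  measurable_fun [set: R] p -> (forall x, 0 <= p x <= K) ->
  nu.-integrable setT (EFin \o (fun z => p z.1 * w z.1)) /\
  \int[nu]_z (p z.1 * (gI z.2 - gI z.1) + conj (p z.1)) =
  \int[nu]_z (p z.1 * w z.1 + conj (p z.1)).
Proof.
move=> mw w_in hw mp pK.
have pK' x : `|p x| <= K by have /andP[h1 h2] := pK x; rewrite ger0_norm.
have mp1 : measurable_fun setT (fun z : R * R => p z.1) by exact: measurableT_comp.
have mw1 : measurable_fun setT (fun z : R * R => w z.1) by exact: measurableT_comp.
have iw : nu.-integrable setT (EFin \o (fun z : R * R => w z.1)).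
  apply: (@bounded_fun_integrable _ _ _ _ _ D) => // z.
  by have /andP[h1 h2] := w_in z.1; rewrite ger0_norm.
have ipw : nu.-integrable setT (EFin \o (fun z => p z.1 * w z.1)).
  exact: (@integrableMbounded _ _ _ _ (fun z : R * R => p z.1) _ K).
split => //; have [_ ip ic] := p_int mp pK.
rewrite !RintegralD//; congr (_ + _).
have ig : nu.-integrable setT (EFin \o (fun z : R * R => gI z.2 - gI z.1)).
  exact: integrable_subr.
pose h (z : R * R) := (gI z.2 - gI z.1) - w z.1.
have ih : nu.-integrable setT (EFin \o h) by exact: integrable_subr.
have h0 B : measurable B -> \int[nu]_z (\1_B z.1 * h z) = 0.
  move=> mB; rewrite (_ : (fun z => _) = (fun z : R * R =>
      \1_B z.1 * (gI z.2 - gI z.1) - \1_B z.1 * w z.1)); last first.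
    by apply/funext => z; rewrite mulrBr.
  by rewrite RintegralB ?hw ?subrr//; exact: i1.
have := @Rintegral_pull_out _ _ _ _ _ nu (fst : R * R -> R) h measurable_fst ih h0 p K mp pK'.
rewrite (_ : (fun z => _) = (fun z : R * R =>
    p z.1 * (gI z.2 - gI z.1) - p z.1 * w z.1)); last first.
  by apply/funext => z; rewrite mulrBr.
by rewrite RintegralB// => /eqP; rewrite subr_eq0 => /eqP.
Qed.

(** Young's inequality for [phi] and its conjugate at each point. The function [p] is merely
    measurable because coarsening composes a continuous function with a step map. *)
Lemma J_dual_le (p : R -> R) (K : R) : measurable_fun [set: R] p ->
  (forall x, 0 <= p x <= K) ->
  (J I gamma phi nu <= (\int[nu]_z (p z.1 * (gI z.2 - gI z.1) +
    concave_conj phi (2 * supnorm I gamma) (p z.1)))%:E)%E.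
Proof.
move=> mp pK; have [w [mw w_in hw ->]] := J_representation.
have [ipw ->] := p_rewrite mw w_in hw mp pK; have [_ _ ic] := p_int mp pK.
have [phiw iphi] := phi_int mw w_in.
rewrite lee_fin; apply: le_Rintegral => //; first exact: integrable_addr.
move=> z _; exact: (concave_conj_ge phi_nd (p z.1) (w_in z.1)).
Qed.

(** The composition of near-optimal slopes with [w] is only measurable; as the integrand is
    Lipschitz in [p], an L1 approximation replaces it by a continuous function. *)
Lemma J_dual_attained (e : R) : 0 < e -> exists p : R -> R, exists K : R,
  [/\ continuous p, forall x, 0 <= p x <= K &
  ((\int[nu]_z (p z.1 * (gI z.2 - gI z.1) +
    concave_conj phi (2 * supnorm I gamma) (p z.1)))%:E <=
    J I gamma phi nu + e%:E)%E].
Proof.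
move=> e0; have e2 : 0 < e / 2 by rewrite divr_gt0.
have [w [mw w_in hw ->]] := J_representation.
have [P [K [mP PK hP]]] := concave_conj_attained D0 phi_concave phi_nd phi_cont e2.
pose a x := P (w x).
have ma : measurable_fun setT a by exact: measurableT_comp.
have aK x : 0 <= a x <= K by exact: PK.
(* Exchanging [a] for [p] changes the integrand by at most [2 * D] times their distance: [D] from
   the bound on [w] and [D] from the Lipschitz constant of the conjugate. The 1 covers [D = 0]; the
   other e/2 is spent on the slopes. *)
pose e3 := e / 2 / (2 * D + 1).
have D1 : 0 < 2 * D + 1 by have := D0; lra.
have e30 : 0 < e3 by rewrite divr_gt0.
have [p [cp pK hp]] := continuous_L1_dense la ma aK e30.
have mp := continuous_measurable_fun cp.
exists p, K; split => //.
have [ipw ->] := p_rewrite mw w_in hw mp pK; have [_ _ ic] := p_int mp pK.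
have [iaw _] := p_rewrite mw w_in hw ma aK; have [_ _ iac] := p_int ma aK.
rewrite -EFinD lee_fin.
have [phiw iphi] := phi_int mw w_in.
have md : measurable_fun setT (fun x : R => `|a x - p x|).
  by apply: measurableT_comp => //; exact: measurable_funB.
have id_ : la.-integrable setT (EFin \o (fun x : R => `|a x - p x|)).
  apply: (@bounded_fun_integrable _ _ _ _ _ (K + K)) => // x.
  have /andP[h1 h2] := aK x; have /andP[h3 h4] := pK x.
  by rewrite normr_id ler_norml; lra.
have [id1 idE] := fst_integral n1 md id_.
apply: (@le_trans _ _ (\int[nu]_z (phi (w z.1) + (e / 2 + 2 * D * `|a z.1 - p z.1|)))).
  apply: le_Rintegral => //.
  - exact: integrable_addr.
  - apply: integrable_addr => //; apply: integrable_addr; first exact: integrable_cstr.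
    exact: integrable_mulr.
  move=> z _; set x := z.1; have h1 := hP _ (w_in x); rewrite -/(a x) in h1.
  have h2 := concave_conj_lip D0 phi_nd (p x) (a x).
  have h3 : p x * w x <= a x * w x + D * `|a x - p x|.
    have /andP[w0 wD] := w_in x.
    have : `|a x - p x| * w x <= `|a x - p x| * D by rewrite ler_wpM2l.
    have : (p x - a x) * w x <= `|a x - p x| * w x.
      by rewrite ler_wpM2r// distrC ler_norm.
    by lra.
  have h4 := le_trans (ler_norm _) h2; rewrite distrC in h4.
  by rewrite /conj; lra.
rewrite RintegralD//; last first.
  by apply: integrable_addr; [exact: integrable_cstr|exact: integrable_mulr].
rewrite lerD2l RintegralD//; [|exact: integrable_cstr|exact: integrable_mulr].
rewrite Rintegral_cst1 RintegralZl// idE.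
have : 2 * D * (\int[la]_x `|a x - p x|) <= 2 * D * e3.
  by rewrite ler_wpM2l// mulr_ge0.
have : 2 * D * e3 <= e / 2.
  rewrite /e3 mulrA ler_pdivrMr// mulrC ler_wpM2l// ?lerDl//.
  exact: ltW.
by lra.
Qed.

End fixed_transport.

End functional.

Lemma finite_set_norm_bound (R : realType) (F : set R) (f : R -> R) :
  finite_set F -> exists M : R, forall x, F x -> `|f x| <= M.
Proof.
move=> /finite_seqP[s ->]; exists (\sum_(y <- s) `|f y|) => x /= xs.
rewrite (big_rem x xs)/= lerDl; exact: sumr_ge0.
Qed.

Lemma measurable_finite_support (R : realType) (F : set R) (f : R -> R) :
  finite_set F -> (forall x, ~ F x -> f x = 0) -> measurable_fun [set: R] f.
Proof.
move=> fF f0 _ Y mY; rewrite setTI.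
have mfin (A : set R) : A `<=` F -> measurable A.
  move=> AF; apply: countable_measurable; last first.
    by apply: finite_set_countable; exact: sub_finite_set fF.
  by move=> x; exact: measurable_set1.
have -> : f @^-1` Y = (F `&` f @^-1` Y) `|` (~` F `&` [set x | Y 0]).
  apply/seteqP; split => x /=.
    move=> Yx; have [Fx|nFx] := pselect (F x); first by left.
    by right; split => //; rewrite -(f0 _ nFx).
  by move=> [[]//|[nFx Y0]]; rewrite f0.
apply: measurableU; first by apply: mfin; exact: subIsetl.
apply: measurableI; first by apply: measurableC; exact: mfin.
have [Y0|nY0] := pselect (Y 0).
  by rewrite (_ : [set _ | _] = setT)//; apply/seteqP; split.
by rewrite (_ : [set _ | _] = set0)//; apply/seteqP; split.
Qed.

(** The integral of [g] may be +oo, as for convex functions testing the convex order; hence the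
    separate comparison of positive and negative parts. *)
Lemma integral_ge_integrable d (T : measurableType d) (R : realType)
    (P : probability T R) (f g : T -> R) :
  P.-integrable [set: T] (EFin \o f) -> measurable_fun [set: T] g ->
  {ae P, forall x, f x <= g x} ->
  ((\int[P]_x f x)%:E <= \int[P]_x (g x)%:E)%E.
Proof.
move=> fi mg fg; rewrite -EFin_Rintegral//.
have mf : measurable_fun setT (EFin \o f) by case/integrableP : fi.
have mg' : measurable_fun setT (EFin \o g) by exact/measurable_EFinP.
rewrite [leLHS]integralE [leRHS]integralE; apply: leeB.
  apply: ae_ge0_le_integral => //; try exact: measurable_funepos.
  by apply: filterS fg => x fgx _; rewrite !funeposE -!EFin_max lee_fin ge_max !le_max fgx lexx orbT.
apply: ae_ge0_le_integral => //; try exact: measurable_funeneg.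
by apply: filterS fg => x fgx _; rewrite !funenegE -!EFinN -!EFin_max lee_fin ge_max !le_max lerN2 fgx lexx orbT.
Qed.

(** * Upper semicontinuity of the functional *)

Section functional_limits.
Context (R : realType) (I : set R) (gamma phi : R -> R).
Hypotheses (I_nonempty : I !=set0) (I_open : open I).
Hypothesis gamma_convex : convex_function (I : set R^o) (gamma : R^o -> R^o).
Hypothesis gamma_bounded : [bounded (gamma x : R^o) | x in I].
Hypothesis phi_concave : concave_function `[0, +oo[%classic phi.
Hypothesis phi_nd : {in `[0, 2 * supnorm I gamma] &, {homo phi : x y / x <= y}}.
Hypothesis phi_cont : {within `[0, 2 * supnorm I gamma], continuous phi}.

Let gI : R -> R := gamma \_ I.
Let D : R := 2 * supnorm I gamma.
Let mg := measurable_restrict_gamma I_open gamma_convex gamma_bounded.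
Let mI := open_measurable I_open.
Let mII : measurable (I `*` I). Proof. exact: measurableX. Qed.

Let D0 : 0 <= D.
Proof.
rewrite mulr_ge0//; have [x Ix] := I_nonempty.
exact: le_trans (supnorm_ge gamma_bounded Ix).
Qed.

Let conj := concave_conj phi D.

Let dual (p : R -> R) (z : R * R) : R := p z.1 * (gI z.2 - gI z.1) + conj (p z.1).

(** Continuity is claimed on I x I only: [gI] may jump at the end points of [I]. *)
Let dual_Cb (p : R -> R) (K : R) : continuous p -> (forall x, 0 <= p x <= K) ->
  Cb (I `*` I) (dual p).
Proof.
move=> cp pK; have cconj := concave_conj_continuous D0 phi_nd.
have cg x : I x -> {for x, continuous gI}.
  move=> Ix; have := convex_within_continuous I_open gamma_convex.
  rewrite continuous_open_subspace// => /(_ x (mem_set Ix)) cx.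
  change (gI y @[y --> x] --> gI x).
  have -> : gI x = gamma x by rewrite /gI patchE mem_set.
  apply: cvg_trans cx; apply: near_eq_cvg.
  have := open_nbhs_nbhs (Logic.conj I_open Ix).
  by apply: filterS => y Iy; rewrite /gI patchE mem_set.
have cp1 := continuous_fst_comp cp.
split.
  rewrite continuous_open_subspace; last exact: open_setX.
  move=> z /set_mem[/= Iz1 Iz2].
  have c1 : gI y.1 @[y --> z] --> gI z.1.
    by apply: (@continuous_comp _ _ _ fst gI z); [exact: cvg_fst|exact: cg].
  have c2 : gI y.2 @[y --> z] --> gI z.2.
    by apply: (@continuous_comp _ _ _ snd gI z); [exact: cvg_snd|exact: cg].
  have c3 : conj (p y.1) @[y --> z] --> conj (p z.1).
    by apply: (@continuous_comp _ _ _ (fun z => p z.1) conj z); [exact: cp1|exact: cconj].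
  apply: (@cvgD _ R^o _ _ _ (fun y => p y.1 * (gI y.2 - gI y.1)) (fun y => conj (p y.1))) => //.
  apply: (@cvgM _ _ _ _ (fun y => p y.1) (fun y => gI y.2 - gI y.1)); first exact: cp1.
  exact: (@cvgB _ R^o _ _ _ (fun y => gI y.2) (fun y => gI y.1)).
exists (K * D + (`|conj 0| + D * K)); split; first exact: num_real.
move=> r Mr z _ /=; apply: le_trans (ltW Mr).
have /andP[p0 pz] := pK z.1.
rewrite (le_trans (ler_normD _ _))// lerD//.
  rewrite normrM ler_pM//; first by rewrite ger0_norm.
  rewrite (le_trans (ler_normB _ _))// /D mulr_natl mulr2n.
  by rewrite lerD// restrict_gamma_norm.
rewrite -[X in `|X|](subrK (conj 0)) addrC (le_trans (ler_normD _ _))//.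
rewrite lerD// (le_trans (concave_conj_lip D0 phi_nd _ _))// subr0.
by rewrite ler_wpM2l// ger0_norm.
Qed.

(** A function [p] that is nearly optimal for the limit also bounds [J] along the sequence, and the
    integrals of its bounded continuous dual integrand converge. *)
Lemma J_upper_semicontinuous (la_ : nat -> probability R R)
    (la mu : probability R R) (nu_ : nat -> probability (R * R)%type R)
    (nu : probability (R * R)%type R) (e : R) :
  (forall n, carried_by (la_ n) I) -> carried_by la I ->
  (forall n, finite_mean (la_ n)) -> finite_mean la -> finite_mean mu ->
  (forall n, martingale_transport I (la_ n) mu (nu_ n)) ->
  martingale_transport I la mu nu -> weak_cvg2 I nu_ nu -> 0 < e ->
  exists N, forall n, (N <= n)%N ->
    (J I gamma phi (nu_ n) <= J I gamma phi nu + e%:E)%E.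
Proof.
move=> la_I laI la_f laf muf nu_M nuM /(weak_cvg2P _ _ I_open) cv e0.
have e2 : 0 < e / 2 by rewrite divr_gt0.
have [p [K [cp pK hp]]] := J_dual_attained I_nonempty I_open gamma_convex
  gamma_bounded phi_concave phi_nd phi_cont laI laf muf nuM e2.
have mp := continuous_measurable_fun cp.
have mdual : measurable_fun setT (dual p).
  have mp1 : measurable_fun setT (fun z : R * R => p z.1) by exact: measurableT_comp.
  apply: measurable_funD.
    apply: measurable_funM => //; apply: measurable_funB => //.
      exact: (measurableT_comp mg measurable_snd).
    exact: (measurableT_comp mg measurable_fst).
  apply: measurableT_comp => //; apply: continuous_measurable_fun.
  exact: concave_conj_continuous D0 phi_nd.
have := cv _ (dual_Cb cp pK).
rewrite (Rintegral_carried mII _ mdual); last by case: nuM.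
rewrite (_ : (fun n => _) = (fun n => \int[nu_ n]_z dual p z)); last first.
  by apply/funext => n; rewrite (Rintegral_carried mII)//; case: (nu_M n).
move=> /cvgrPdist_le/(_ _ e2)[N _ hN]; exists N => n Nn.
have le1 := J_dual_le I_nonempty I_open gamma_convex gamma_bounded phi_concave
  phi_nd (la_I n) (la_f n) muf (nu_M n) mp pK.
apply: (le_trans le1).
have h : \int[nu_ n]_z dual p z <= \int[nu]_z dual p z + e / 2.
  have := hN n Nn; rewrite /= ler_norml => /andP[h1 _].
  by rewrite -lerBlDl -lerN2 opprB.
apply: (@le_trans _ _ ((\int[nu]_z dual p z + e / 2)%:E)); first by rewrite lee_fin.
rewrite (_ : e%:E = ((e / 2)%:E + (e / 2)%:E)%E); last by rewrite -EFinD -splitr.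
by rewrite EFinD addeA leeD2r.
Qed.

End functional_limits.

(** * Coarsening the first marginal *)

Section coarsening.
Context (R : realType) (I : set R).
Hypotheses (I_nonempty : I !=set0) (I_open : open I).
Variables (la la' : probability R R) (T : R -> R).
Hypotheses (laI : carried_by la I) (la_fin : finite_mean la).
Hypotheses (mT : measurable_fun [set: R] T) (TI : forall x, I (T x)).
Hypothesis T_finite : finite_set (range T).
Hypothesis la'E : forall B, measurable B -> la' B = la (T @^-1` B).
Hypothesis T_mean : forall B, measurable B ->
  \int[la]_x (\1_B (T x) * (x - T x)) = 0.

Let mI := open_measurable I_open.

Let T_bound : exists M : R, forall x, `|T x| <= M.
Proof.
have [M hM] := finite_set_norm_bound id T_finite.
by exists M => x; apply: hM; exists x.
Qed.

Let iT : la.-integrable setT (EFin \o T).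
Proof. by have [M hM] := T_bound; exact: bounded_fun_integrable hM. Qed.

Let iXT : la.-integrable setT (EFin \o (fun x => x - T x)).
Proof. exact: integrable_subr. Qed.

Let mTpre (B : set R) : measurable B -> measurable (T @^-1` B).
Proof. exact: (measurable_preimage mT). Qed.

#[local] HB.instance Definition _ := @isMeasurableFun.Build _ _ R R T mT.

Lemma coarse_carried : carried_by la' I.
Proof.
rewrite /carried_by la'E; last exact: measurableC.
by rewrite (_ : T @^-1` _ = set0)//; apply/seteqP; split => // x; apply.
Qed.

Let law_integral (f : R -> R) : measurable_fun [set: R] f ->
  la.-integrable setT (EFin \o (f \o T)) ->
  la'.-integrable setT (EFin \o f) /\ \int[la']_y f y = \int[la]_x f (T x).
Proof.
move=> mf fi; have e (g : R -> \bar R) :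
    (\int[la']_x g x = \int[distribution la T]_x g x)%E.
  by apply: eq_measure_integral => B mB _; exact: la'E.
split; last by rewrite -Rintegral_distribution// /Rintegral e.
have /integrableP[m1 m2] := integrable_distribution mf fi.
by apply/integrableP; split => //; rewrite e.
Qed.

Lemma coarse_mean : finite_mean la'.
Proof. by have [|] := @law_integral id (@measurable_id _ _ _). Qed.

(** The function [c] is arbitrary, since it will be a choice of subgradients of unknown
    measurability; on the finite range of [T] it agrees with a bounded measurable function. *)
Let T_pull (c : R -> R) : \int[la]_x (c (T x) * (x - T x)) = 0 /\
  la.-integrable setT (EFin \o (fun x => c (T x) * (x - T x))).
Proof.
pose a := c \_ (range T).
have ma : measurable_fun setT a.
  apply: (measurable_finite_support T_finite) => x nx.
  by rewrite /a patchE memNset.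
have aT x : a (T x) = c (T x) by rewrite /a patchE mem_set//; exists x.
have [M hM] := finite_set_norm_bound c T_finite.
have aM x : `|a x| <= `|M|.
  rewrite /a patchE; case: ifPn => [/set_mem/hM h|_]; last by rewrite normr0.
  exact: le_trans h (ler_norm _).
have := Rintegral_pull_out mT iXT T_mean ma aM.
rewrite (_ : (fun x => _) = (fun x => c (T x) * (x - T x))) => [->|]; last first.
  by apply/funext => x; rewrite aT.
split => //; have := @integrableMbounded _ _ _ la (a \o T) _ `|M|
  (measurableT_comp ma mT) (fun x => aM (T x)) iXT.
congr (_.-integrable _ _); apply/funext => x /=; by rewrite aT.
Qed.

Let support_line (psi : R -> R) :
  convex_function (I : set R^o) (psi : R^o -> R^o) ->
  exists c : R -> R, forall x y, I y -> psi (T x) + c (T x) * (y - T x) <= psi y.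
Proof.
move=> cpsi; have /choice[c hc] : forall t, exists c : R, I t -> forall y, I y ->
    psi t + c * (y - t) <= psi y.
  move=> t; have [It|nIt] := pselect (I t); last by exists 0.
  by have [c hc] := subgradient I_open cpsi It; exists c.
by exists c => x y Iy; exact: hc.
Qed.

Let comp_T (psi : R -> R) : measurable_fun [set: R] psi ->
  la.-integrable setT (EFin \o (psi \o T)).
Proof.
move=> mpsi; have [M hM] := finite_set_norm_bound psi T_finite.
apply: (@bounded_fun_integrable _ _ _ _ _ M); first exact: measurableT_comp.
by move=> x; apply: hM; exists x.
Qed.

(** Jensen by support lines at [T x]: the linear term integrates to 0 because [T x] is the
    conditional mean. *)
Lemma coarse_convex_order : convex_order I la' la.
Proof.
move=> psi cpsi; have [c hc] := support_line cpsi.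
have mpsi : measurable_fun setT (psi \_ I).
  apply/(measurable_restrictT _ mI); apply: open_continuous_measurable_fun => //.
  rewrite -continuous_open_subspace//; exact: convex_within_continuous.
have E (P : probability R R) : (\int[P]_(x in I) (psi x)%:E =
    \int[P]_x ((psi \_ I) x)%:E)%E.
  rewrite integral_mkcond; apply: eq_integral => x _.
  by rewrite !patchE; case: ifP.
rewrite !E; have [i1 e1] := law_integral mpsi (comp_T mpsi).
rewrite EFin_Rintegral// e1.
have [p0 pi] := T_pull c; have iq := comp_T mpsi.
rewrite -[X in X%:E]addr0 -p0 -RintegralD//.
apply: integral_ge_integrable => //; first exact: integrable_addr.
apply: filterS (carried_ae mI laI) => x Ix.
by rewrite !patchE !mem_set//; exact: hc.
Qed.

Section transport.
Variables (gamma phi : R -> R).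
Hypothesis gamma_convex : convex_function (I : set R^o) (gamma : R^o -> R^o).
Hypothesis gamma_bounded : [bounded (gamma x : R^o) | x in I].
Hypothesis phi_concave : concave_function `[0, +oo[%classic phi.
Hypothesis phi_nd : {in `[0, 2 * supnorm I gamma] &, {homo phi : x y / x <= y}}.
Hypothesis phi_cont : {within `[0, 2 * supnorm I gamma], continuous phi}.
Variables (mu : probability R R) (nu : probability (R * R)%type R).
Hypotheses (muI : carried_by mu I) (mu_fin : finite_mean mu).
Hypothesis nuM : martingale_transport I la mu nu.

Let X (z : R * R) : R * R := (T z.1, z.2).

Let mX : measurable_fun setT X.
Proof.
apply: measurable_fun_pair => //; exact: (measurableT_comp mT measurable_fst).
Qed.

#[local] HB.instance Definition _ :=
  @isMeasurableFun.Build _ _ (R * R)%type (R * R)%type X mX.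

Let nu' : probability (R * R)%type R := distribution nu X.

Let gI : R -> R := gamma \_ I.
Let mg := measurable_restrict_gamma I_open gamma_convex gamma_bounded.

Let n1 : forall B, measurable B -> nu (fst @^-1` B) = la B.
Proof. by case: nuM. Qed.
Let n2 : forall B, measurable B -> nu (snd @^-1` B) = mu B.
Proof. by case: nuM. Qed.
Let nu_mart : forall B, measurable B -> \int[nu]_z (\1_B z.1 * (z.2 - z.1)) = 0.
Proof. by apply/(martingaleP n1 n2 la_fin mu_fin); case: nuM. Qed.

Let n1' : forall B, measurable B -> nu' (fst @^-1` B) = la' B.
Proof. by move=> B mB; rewrite la'E// -n1//; exact: mTpre. Qed.

Let n2' : forall B, measurable B -> nu' (snd @^-1` B) = mu B.
Proof. by move=> B mB; rewrite -n2. Qed.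

Let iX1 := integrable_increment n1 n2 la_fin mu_fin.
Let iX2 := integrable_increment n1' n2' coarse_mean mu_fin.

(** The new increment is the sum of the old one, orthogonal to functions of the first coordinate,
    and of the displacement from a point to its image under [T], orthogonal to functions of that
    image. *)
Let nu'M : martingale_transport I la' mu nu'.
Proof.
split => //; first exact: (carried_marginals I_open n1' n2' coarse_carried muI).
apply/(martingaleP n1' n2' coarse_mean mu_fin) => B mB.
have mB1 : measurable_fun setT (\1_B : R -> R) by exact: measurable_indic.
have ix : la.-integrable setT (EFin \o (fun x => \1_B (T x) * (x - T x))).
  by have [_] := T_pull \1_B.
have mx : measurable_fun setT (fun x => \1_B (T x) * (x - T x)).
  exact: integrable_measurable ix.
have [j1 j2] := fst_integral n1 mx ix.
have j3 : nu.-integrable setT (EFin \o (fun z : R * R => \1_B (T z.1) * (z.2 - z.1))).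
  apply: (@integrableMbounded _ _ _ _ (fun z : R * R => \1_B (T z.1)) _ 1) => //.
  - apply: (measurableT_comp mB1); exact: (measurableT_comp mT measurable_fst).
  - by move=> z; exact: indic_norm_le1.
have sp : (fun z : R * R => \1_B (T z.1) * (z.2 - T z.1)) = (fun z : R * R =>
    \1_B (T z.1) * (z.2 - z.1) + \1_B (T z.1) * (z.1 - T z.1)).
  by apply/funext => z; ring.
rewrite Rintegral_distribution; first last.
- rewrite [X in _.-integrable _ X](_ : _ = EFin \o
    (fun z : R * R => \1_B (T z.1) * (z.2 - T z.1)))//.
  by rewrite sp; exact: integrable_addr.
- apply: measurable_funM; first exact: (measurableT_comp mB1 measurable_fst).
  exact: measurable_funB.
rewrite [LHS](_ : _ = \int[nu]_z (\1_B (T z.1) * (z.2 - T z.1)))//.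
rewrite sp RintegralD// j2 T_mean// addr0 -[RHS](nu_mart (mTpre mB)).
by apply: eq_Rintegral => z _.
Qed.

(** The test function [p] is chosen nearly optimal for the coarse coupling and then used, composed
    with [T], as a competitor for the original one. *)
Lemma coarse_transport : exists nu' : probability (R * R)%type R,
  martingale_transport I la' mu nu' /\
  (J I gamma phi nu <= J I gamma phi nu')%E.
Proof.
exists nu'; split; first exact: nu'M.
apply/lee_addgt0Pr => e e0.
have [p [K [cp pK hp]]] := J_dual_attained I_nonempty I_open gamma_convex
  gamma_bounded phi_concave phi_nd phi_cont coarse_carried coarse_mean mu_fin nu'M e0.
have mp := continuous_measurable_fun cp.
apply: le_trans hp.
have mpT : measurable_fun setT (p \o T) by exact: measurableT_comp.
apply: (le_trans (J_dual_le I_nonempty I_open gamma_convex gamma_bounded phi_concave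
  phi_nd laI la_fin mu_fin nuM mpT (fun x => pK (T x)))).
rewrite lee_fin.
pose C := supnorm I gamma; pose D := 2 * C.
have C0 : 0 <= C.
  by have [x Ix] := I_nonempty; exact: le_trans (supnorm_ge gamma_bounded Ix).
have D0 : 0 <= D by rewrite mulr_ge0.
have mconj : measurable_fun setT (concave_conj phi D).
  by apply: continuous_measurable_fun; exact: concave_conj_continuous D0 phi_nd.
have gn x : `|gI x| <= C by exact: restrict_gamma_norm.
have iq : la.-integrable setT (EFin \o (fun x => p (T x) * (gI (T x) - gI x))).
  apply: (@integrableMbounded _ _ _ _ (p \o T) _ K) => //.
    by move=> x; have /andP[h1 h2] := pK (T x); rewrite ger0_norm.
  apply: integrable_subr; first exact: comp_T.
  exact: bounded_fun_integrable gn.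
have mq : measurable_fun setT (fun x => p (T x) * (gI (T x) - gI x)).
  exact: integrable_measurable iq.
have [q1 q2] := fst_integral n1 mq iq.
(* The difference of the two dual integrals; it is at most 0 because [p] is nonnegative and the
   support line of [gamma] at [T x] has mean 0. *)
have q_le0 : \int[la]_x (p (T x) * (gI (T x) - gI x)) <= 0.
  have [c hc] := support_line gamma_convex.
  have [<- ir] := T_pull (fun t => - (p t * c t)).
  apply: ae_le_Rintegral => //.
  apply: filterS (carried_ae mI laI) => x Ix.
  have /andP[p0 _] := pK (T x).
  have := hc x x Ix; rewrite /gI !patchE !mem_set// => h.
  rewrite mulNr -mulrA -mulrN ler_wpM2l//; lra.
pose F (z : R * R) := p z.1 * (gI z.2 - gI z.1) + concave_conj phi D (p z.1).
have mgI1 : measurable_fun setT (fun z : R * R => gI z.1).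
  exact: (measurableT_comp mg measurable_fst).
have mgI2 : measurable_fun setT (fun z : R * R => gI z.2).
  exact: (measurableT_comp mg measurable_snd).
have mF : measurable_fun setT F.
  apply: measurable_funD.
    apply: measurable_funM; first exact: (measurableT_comp mp measurable_fst).
    exact: measurable_funB.
  apply: (measurableT_comp mconj); exact: (measurableT_comp mp measurable_fst).
have mpT1 : measurable_fun setT (fun z : R * R => p (T z.1)).
  exact: (measurableT_comp mpT measurable_fst).
have iG1 : nu.-integrable setT (EFin \o (fun z : R * R =>
    p (T z.1) * (gI z.2 - gI z.1) + concave_conj phi D (p (T z.1)))).
  apply: integrable_addr.
    apply: (@integrableMbounded _ _ _ _ (fun z : R * R => p (T z.1)) _ K) => //.
      by move=> z; have /andP[h1 h2] := pK (T z.1); rewrite ger0_norm.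
    by apply: integrable_subr; apply: (@bounded_fun_integrable _ _ _ _ _ C).
  have [M hM] := finite_set_norm_bound (concave_conj phi D \o p) T_finite.
  apply: (@bounded_fun_integrable _ _ _ _ _ M); first exact: measurableT_comp.
  by move=> z; apply: hM; exists z.1.
have sp : (fun z : R * R => F (X z)) = (fun z : R * R =>
    (p (T z.1) * (gI z.2 - gI z.1) + concave_conj phi D (p (T z.1))) -
    p (T z.1) * (gI (T z.1) - gI z.1)).
  by apply/funext => z; rewrite /F /X/=; ring.
rewrite -/gI -/C -/D -[leRHS]/(\int[nu']_z F z) Rintegral_distribution//; last first.
  rewrite [X in _.-integrable _ X](_ : _ = EFin \o (fun z => F (X z)))//.
  by rewrite sp; exact: integrable_subr.
by rewrite sp RintegralB// q2 lerBrDl addrC -lerBrDl subrr.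
Qed.

End transport.

End coarsening.

(** * Martingale transports of finitely supported measures *)

Lemma Rintegral_sum d (T : measurableType d) (R : realType)
    (P : probability T R) (J : Type) (s : seq J) (f : J -> T -> R) :
  (forall i, P.-integrable [set: T] (EFin \o f i)) ->
  P.-integrable [set: T] (EFin \o (fun x => \sum_(i <- s) f i x)) /\
  \int[P]_x (\sum_(i <- s) f i x) = \sum_(i <- s) \int[P]_x f i x.
Proof.
move=> fi; elim: s => [|i s [IH1 IH2]].
  rewrite big_nil (_ : (fun x => _) = cst 0).
    by split; [exact: integrable_cstr|rewrite Rintegral_cst1].
  by apply/funext => x; rewrite big_nil.
rewrite big_cons (_ : (fun x => _) = (fun x => f i x + \sum_(j <- s) f j x)).
  by split; [exact: integrable_addr|rewrite RintegralD// IH2].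
by apply/funext => x; rewrite big_cons.
Qed.

Lemma Rintegral_clamp_cvg d (T : measurableType d) (R : realType)
    (P : probability T R) (f h : T -> R) :
  measurable_fun [set: T] f -> measurable_fun [set: T] h ->
  P.-integrable [set: T] (EFin \o (fun x => f x * h x)) ->
  \int[P]_x (clamp n%:R (f x) * h x) @[n --> \oo] --> \int[P]_x (f x * h x).
Proof.
move=> mf mh ifh; apply: (@Rintegral_cvg _ _ _ _ _ _ (fun x => `|f x * h x|)).
- move=> n; apply: measurable_funM => //; apply: (measurableT_comp _ mf).
  by apply: continuous_measurable_fun; exact: clamp_continuous.
- exact: measurable_funM.
- move=> x; apply: cvgMl; apply: cvg_near_cst; near=> n; rewrite clamp_id//.
  by near: n; exact: nbhs_infty_ger.
- exact: integrable_norm.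
- move=> n x; rewrite !normrM ler_wpM2r//.
  have [fn|nf] := leP `|f x| n%:R; first by rewrite clamp_id.
  exact: le_trans (clamp_norm_le _ (ler0n _ _)) (ltW nf).
Unshelve. all: by end_near. Qed.

(** [psi] is the maximum of the functions and [g] the indicators of a measurable choice of the
    maximizing index, so that [g] is a splitting that turns [psi] into a sum. *)
Lemma max_selection (R : realType) (n : nat) (l : nat -> R -> R) :
  (forall i, measurable_fun [set: R] (l i)) ->
  exists (psi : R -> R) (g : nat -> R -> R),
  [/\ forall i, measurable_fun [set: R] (g i), forall i y, 0 <= g i y,
      forall y, \sum_(i < n.+1) g i y = 1,
      forall i y, (i <= n)%N -> l i y <= psi y &
      forall y, \sum_(i < n.+1) g i y * l i y = psi y].
Proof.
move=> ml; elim: n => [|n [psi [g [mg g0 g1 gl gE]]]].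
  exists (l 0), (fun=> cst 1); split => //.
  - by move=> y; rewrite big_ord1.
  - by move=> i y; rewrite leqn0 => /eqP ->.
  - by move=> y; rewrite big_ord1 mul1r.
have mpsi : measurable_fun setT psi.
  rewrite (_ : psi = (fun y => \sum_(i < n.+1) g i y * l i y)); last first.
    by apply/funext => y; rewrite gE.
  by apply: measurable_sum => i; exact: measurable_funM.
exists (fun y => Num.max (psi y) (l n.+1 y)).
exists (fun i y => if l n.+1 y <= psi y then (if (i <= n)%N then g i y else 0)
  else (i == n.+1)%:R).
split.
- move=> i; apply: measurable_fun_ifT => //; first exact: measurable_fun_ler.
  by case: leqP.
- by move=> i y; case: ifP => // _; case: ifP.
- move=> y; rewrite big_ord_recr/=; case: ifP => _.
    rewrite ltnn addr0 -[RHS](g1 y); apply: eq_bigr => i _.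
    by rewrite -ltnS ltn_ord.
  rewrite eqxx big1 ?add0r// => i _; by rewrite ltn_eqF.
- move=> i y; rewrite leq_eqVlt => /predU1P[->|]; first by rewrite le_max lexx orbT.
  by rewrite ltnS => /gl h; rewrite le_max h.
- move=> y; rewrite big_ord_recr/=; case: ifPn => [h|].
    rewrite ltnn mul0r addr0 (max_idPl h) -[RHS]gE; apply: eq_bigr => i _.
    by rewrite -ltnS ltn_ord.
  rewrite -ltNge => /ltW h; rewrite eqxx mul1r (max_idPr h).
  by rewrite big1 ?add0r// => i _; rewrite ltn_eqF ?mul0r.
Qed.

Lemma convex_order_Rintegral (R : realType) (I : set R)
    (la mu : probability R R) (psi : R -> R) : open I ->
  carried_by la I -> carried_by mu I -> convex_order I la mu ->
  convex_function (I : set R^o) (psi : R^o -> R^o) ->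
  la.-integrable [set: R] (EFin \o psi) -> mu.-integrable [set: R] (EFin \o psi) ->
  \int[la]_x psi x <= \int[mu]_x psi x.
Proof.
move=> oI laI muI co cpsi i1 i2; have mI := open_measurable oI.
have mpsi := integrable_measurable i1.
have E (P : probability R R) : carried_by P I -> P.-integrable setT (EFin \o psi) ->
    (\int[P]_(x in I) (psi x)%:E = (\int[P]_x psi x)%:E)%E.
  move=> PI ip; rewrite -(Rintegral_carried mI PI mpsi) -EFin_Rintegral.
    rewrite integral_mkcond; apply: eq_integral => x _.
    by rewrite !patchE; case: ifP.
  rewrite (_ : psi \_ I = (fun x => \1_I x * psi x)).
    apply: (@integrableMbounded _ _ _ _ _ _ 1) => //.
    by move=> x; exact: indic_norm_le1.
  by apply/funext => x; rewrite patchE indicE; case: ifP; rewrite ?mul1r ?mul0r.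
by have := co psi cpsi; rewrite !E// lee_fin.
Qed.

Section splitting.
Context (R : realType) (mu : probability R R) (mu_fin : finite_mean mu).
Variables (n : nat) (x : nat -> R) (p : nat -> R).

(* A splitting of mu into n+1 parts, given by their densities. *)
Definition splitting (f : nat -> R -> R) := [/\ forall i, measurable_fun [set: R] (f i),
  forall i y, 0 <= f i y & forall y, \sum_(i < n.+1) f i y = 1].

Definition mass_error (f : nat -> R -> R) i := \int[mu]_y f i y - p i.
Definition drift (f : nat -> R -> R) i := \int[mu]_y (f i y * (y - x i)).

Let Q (f : nat -> R -> R) :=
  \sum_(i < n.+1) (mass_error f i ^+ 2 + drift f i ^+ 2).

Lemma splitting_le1 f i y : splitting f -> (i <= n)%N -> 0 <= f i y <= 1.
Proof.
move=> [mf f0 f1] ni; rewrite f0/= -(f1 y).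
have ni' : (i < n.+1)%N by [].
by rewrite (bigD1 (Ordinal ni'))//= lerDl; exact: sumr_ge0.
Qed.

Lemma splitting_integrable f i : splitting f -> (i <= n)%N ->
  mu.-integrable setT (EFin \o f i).
Proof.
move=> sf ni; have [mf _ _] := sf.
apply: (@bounded_fun_integrable _ _ _ _ _ 1) => // y.
by have /andP[h1 h2] := splitting_le1 y sf ni; rewrite ger0_norm.
Qed.

Lemma splitting_integrableM f i (a : R -> R) : splitting f -> (i <= n)%N ->
  mu.-integrable setT (EFin \o a) ->
  mu.-integrable setT (EFin \o (fun y => f i y * a y)).
Proof.
move=> sf ni ia; have [mf _ _] := sf.
apply: (@integrableMbounded _ _ _ _ _ _ 1) => // y.
by have /andP[h1 h2] := splitting_le1 y sf ni; rewrite ger0_norm.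
Qed.

Let iY (c : R) : mu.-integrable setT (EFin \o (fun y : R => y - c)).
Proof.
by apply: (@integrable_subr _ _ _ _ (fun y : R => y)) => //; exact: integrable_cstr.
Qed.

Let mix (t : R) (f g : nat -> R -> R) i y := (1 - t) * f i y + t * g i y.

Let mix_splitting t f g : 0 <= t <= 1 -> splitting f -> splitting g ->
  splitting (mix t f g).
Proof.
move=> /andP[t0 t1] [mf f0 f1] [mg g0 g1]; split.
- by move=> i; apply: measurable_funD; exact: measurable_funM.
- by move=> i y; rewrite addr_ge0// mulr_ge0// subr_ge0.
- by move=> y; rewrite big_split/= -!mulr_sumr f1 g1; ring.
Qed.

Let mass_mix t f g i : splitting f -> splitting g -> (i <= n)%N ->
  mass_error (mix t f g) i = mass_error f i + t * (mass_error g i - mass_error f i).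
Proof.
move=> sf sg ni; have i1 := splitting_integrable sf ni.
have i2 := splitting_integrable sg ni.
rewrite /mass_error /mix RintegralD//; [|exact: integrable_mulr..].
by rewrite !RintegralZl//; ring.
Qed.

Let drift_mix t f g i : splitting f -> splitting g -> (i <= n)%N ->
  drift (mix t f g) i = drift f i + t * (drift g i - drift f i).
Proof.
move=> sf sg ni; have i1 := splitting_integrableM sf ni (iY (x i)).
have i2 := splitting_integrableM sg ni (iY (x i)).
rewrite /drift /mix.
rewrite (_ : (fun y => _) = (fun y => (1 - t) * (f i y * (y - x i)) +
    t * (g i y * (y - x i)))); last by apply/funext => y; ring.
rewrite RintegralD//; [|exact: integrable_mulr..].
by rewrite !RintegralZl//; ring.
Qed.

Let B := \sum_(i < n.+1) (1 + (\int[mu]_y `|y - x i|) ^+ 2).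

(** The bound is the same for all splittings, since their densities lie in [0, 1]; the step length
    can thus be fixed before the near-minimizer. *)
Let diff_bound f g : splitting f -> splitting g ->
  \sum_(i < n.+1) ((mass_error g i - mass_error f i) ^+ 2 +
    (drift g i - drift f i) ^+ 2) <= B.
Proof.
move=> sf sg; apply: ler_sum => i _; have ni : (i <= n)%N by rewrite -ltnS.
have i1 := splitting_integrable sf ni; have i2 := splitting_integrable sg ni.
have j1 := splitting_integrableM sf ni (iY (x i)).
have j2 := splitting_integrableM sg ni (iY (x i)).
have sq (a b : R) : `|a| <= b -> a ^+ 2 <= b ^+ 2.
  move=> ab; rewrite -(real_normK (num_real a)) ler_sqr// nnegrE//.
  exact: le_trans ab.
have fg y : `|g i y - f i y| <= 1.
  have /andP[h1 h2] := splitting_le1 y sf ni.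
  have /andP[h3 h4] := splitting_le1 y sg ni.
  by rewrite ler_norml; apply/andP; split; lra.
apply: lerD; first rewrite -[leRHS](expr1n _ 2).
  apply: sq; rewrite /mass_error opprB addrA subrK -RintegralB//.
  apply: le_trans (le_normr_Rintegral _ _) _ => //; first exact: integrable_subr.
  rewrite -[leRHS](Rintegral_cst1 mu 1); apply: le_Rintegral => //.
  - by apply: integrable_norm; exact: integrable_subr.
  - exact: integrable_cstr.
apply: sq; rewrite /drift -RintegralB//.
apply: le_trans (le_normr_Rintegral _ _) _ => //; first exact: integrable_subr.
apply: le_Rintegral => //.
- by apply: integrable_norm; exact: integrable_subr.
- exact: integrable_norm.
- by move=> y _; rewrite -mulrBl normrM ler_piMl.
Qed.

Hypothesis balanced : forall psi : R -> R,
  convex_function ([set: R] : set R^o) (psi : R^o -> R^o) ->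
  mu.-integrable setT (EFin \o psi) ->
  \sum_(i < n.+1) p i * psi (x i) <= \int[mu]_y psi y.
Hypothesis p0 : forall i, 0 <= p i.

(* Where the squared error is nearly minimal, the error vector separates the
   errors of all the splittings from 0, and the maximum of the affine functions
   with the coefficients of this vector violates the convex order. *)
Lemma near_martingale_splitting (e : R) : 0 < e -> exists f, splitting f /\
  \sum_(i < n.+1) (mass_error f i ^+ 2 + drift f i ^+ 2) <= e.
Proof.
move=> e0; apply: contrapT => no.
have Qe f : splitting f -> e <= Q f.
  by move=> sf; rewrite leNgt; apply/negP => h; apply: no; exists f; split => //; exact: ltW.
pose A := [set Q f | f in splitting].
have s0 : splitting (fun i => cst (i == 0)%:R).
  split => // y; rewrite big_ord_recl/= big1 ?addr0// => i _.
have A0 : A !=set0 by exists (Q (fun i => cst (i == 0)%:R)); exists (fun i => cst (i == 0)%:R).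
have lA : has_lbound A by exists e => _ [f sf <-]; exact: Qe.
pose q := inf A.
have q0 : 0 < q.
  by apply: lt_le_trans e0 _; apply: lb_le_inf => // _ [f sf <-]; exact: Qe.
have B0 : 0 <= B by apply: sumr_ge0 => i _; rewrite addr_ge0// sqr_ge0.
(* The step length from the near-minimizer towards another splitting. With [t * (1 + B) <= q], the
   quadratic term and the slack [t ^+ 2] of the near-minimum together cost at most q/2 in the
   first-order term. *)
pose t := Num.min 1 (q / (1 + B)).
have t0 : 0 < t by rewrite lt_min ltr01 divr_gt0// ltr_wpDr.
have t1 : t <= 1 by rewrite ge_min lexx.
have tB : t * (1 + B) <= q.
  by rewrite -ler_pdivlMr ?ltr_wpDr// ge_min lexx orbT.
have t2 : 0 < t ^+ 2 by rewrite exprn_gt0.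
have [_ [f sf <-] Qf] := inf_adherent t2 (Logic.conj A0 lA).
rewrite -/q in Qf.
pose u := mass_error f; pose v := drift f.
(* Moving from [f] towards [g] cannot bring the squared error below [q]; the first-order term of
   this inequality is the separation. *)
have sep g : splitting g ->
    q / 2 <= \sum_(i < n.+1) (u i * mass_error g i + v i * drift g i).
  move=> sg; have qm : q <= Q (mix t f g).
    apply: ge_inf => //; exists (mix t f g) => //; apply: mix_splitting => //.
    by rewrite (ltW t0).
  pose L := \sum_(i < n.+1) (u i * (mass_error g i - u i) + v i * (drift g i - v i)).
  pose S := \sum_(i < n.+1) ((mass_error g i - u i) ^+ 2 + (drift g i - v i) ^+ 2).
  have QE : Q (mix t f g) = Q f + 2 * t * L + t ^+ 2 * S.
    rewrite /Q /L /S !mulr_sumr -!big_split/=; apply: eq_bigr => i _.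
    have ni : (i <= n)%N by rewrite -ltnS.
    by rewrite mass_mix// drift_mix// -/(u i) -/(v i); ring.
  have SB : S <= B by exact: diff_bound.
  have LE : L = \sum_(i < n.+1) (u i * mass_error g i + v i * drift g i) - Q f.
    rewrite /L /Q -sumrB; apply: eq_bigr => i _.
    by rewrite -/(u i) -/(v i); ring.
  have qf : q <= Q f by apply: ge_inf => //; exists f.
  have h1 : 0 < t * (t + 2 * L + t * S) by lra.
  rewrite pmulr_rgt0// in h1.
  have h2 : t * S <= t * B by rewrite ler_wpM2l// ltW.
  lra.
(* The affine function with value [- u i] at the atom [x i] and slope [- v i]; the maximum of these
   will contradict the convex order. *)
pose l i y := - u i - v i * (y - x i).
have ml i : measurable_fun setT (l i).
  by apply: measurable_funB => //; apply: measurable_funM => //; exact: measurable_funB.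
have il i : mu.-integrable setT (EFin \o l i).
  by apply: integrable_subr; [exact: integrable_cstr|exact: integrable_mulr].
have [psi [g [mg g0 g1 gl gE]]] := max_selection n ml.
have sg : splitting g by [].
have psiE : psi = (fun y => \sum_(i < n.+1) g i y * l i y).
  by apply/funext => y; rewrite gE.
have [ipsi psi_sum] := @Rintegral_sum _ _ _ mu _ (index_enum 'I_n.+1)
  (fun i y => g i y * l i y) (fun i => splitting_integrableM sg (leq_ord i) (il i)).
rewrite -psiE in ipsi psi_sum.
have cpsi : convex_function ([set: R] : set R^o) (psi : R^o -> R^o).
  move=> s a b _ _; rewrite [leLHS](_ : _ = psi (s%:num * a + (1 - s%:num) * b))//.
  rewrite [leRHS](_ : _ = s%:num * psi a + (1 - s%:num) * psi b)//.
  set c := _ + _ * b.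
  have -> : psi c = \sum_(i < n.+1) g i c * (s%:num * l i a + (1 - s%:num) * l i b).
    by rewrite -gE; apply: eq_bigr => i _; rewrite /l /c; ring.
  have -> : s%:num * psi a + (1 - s%:num) * psi b =
      \sum_(i < n.+1) g i c * (s%:num * psi a + (1 - s%:num) * psi b).
    by rewrite -mulr_suml g1 mul1r.
  apply: ler_sum => i _.
  have ni : (i <= n)%N by rewrite -ltnS.
  rewrite ler_wpM2l// lerD// ler_wpM2l// ?gl//.
have := balanced cpsi ipsi; apply/negP; rewrite -ltNge.
(* The integral of [psi] is the middle sum minus the separated quantity of the splitting [g], hence
   smaller by at least q/2; the sum over the atoms is at least the middle sum, since [psi] dominates
   each [l i] at [x i]. *)
apply: (@lt_le_trans _ _ (\sum_(i < n.+1) - (p i * u i))); last first.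
  apply: ler_sum => i _; have ni : (i <= n)%N by rewrite -ltnS.
  by rewrite -mulrN ler_wpM2l// (le_trans _ (gl i _ ni))// /l subrr mulr0 subr0.
have := sep g sg; suff -> : \int[mu]_y psi y =
    \sum_(i < n.+1) - (p i * u i) -
    \sum_(i < n.+1) (u i * mass_error g i + v i * drift g i) by lra.
rewrite psi_sum -sumrB; apply: eq_bigr => i _.
have ni : (i <= n)%N by rewrite -ltnS.
have j1 := splitting_integrable sg ni.
have j2 := splitting_integrableM sg ni (iY (x i)).
rewrite (_ : (fun y => _) = (fun y => - u i * g i y + - v i * (g i y * (y - x i)))).
  rewrite RintegralD//; [|exact: integrable_mulr..].
  by rewrite !RintegralZl// /mass_error /drift; ring.
by apply/funext => y; rewrite /l; ring.
Qed.

End splitting.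

Section atoms.
Context (R : realType) (n : nat) (x : nat -> R).

(** The value is [x i] on [A i] and [x 0] off these disjoint sets. In this form every function of
    the chosen atom is a linear combination of indicators. *)
Let pick_atom (A : 'I_n.+1 -> set (R * R)) (w : R * R) : R :=
  x 0%N + \sum_(i < n.+1) (x i - x 0%N) * \1_(A i) w.

Let pick_in (A : 'I_n.+1 -> set (R * R)) w (g : R -> R) :
  (forall i j, A i w -> A j w -> i = j) ->
  (exists i : 'I_n.+1, pick_atom A w = x i) /\
  g (pick_atom A w) = g (x 0%N) + \sum_(i < n.+1) (g (x i) - g (x 0%N)) * \1_(A i) w.
Proof.
move=> tA; have [[i Ai]|nA] := pselect (exists i, A i w); last first.
  have e (h : 'I_n.+1 -> R) : \sum_(i < n.+1) h i * \1_(A i) w = 0.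
    apply: big1 => i _; rewrite indicE memNset ?mulr0// => Ai.
    by apply: nA; exists i.
  by rewrite /pick_atom !e !addr0; split => //; exists ord0.
have e (h : 'I_n.+1 -> R) : \sum_(j < n.+1) h j * \1_(A j) w = h i.
  rewrite (bigD1 i)//= indicE mem_set// mulr1 big1 ?addr0// => j ji.
  rewrite indicE memNset ?mulr0// => Aj.
  by move: ji; rewrite (tA _ _ Aj Ai) eqxx.
rewrite /pick_atom (e (fun j : 'I_n.+1 => x j - x 0%N)).
rewrite (e (fun j : 'I_n.+1 => g (x j) - g (x 0%N))).
have s (a b : R) : a + (b - a) = b by rewrite addrC subrK.
by rewrite !s; split => //; exists i.
Qed.

Variables (mu : probability R R) (f : nat -> R -> R).
Hypothesis sf : splitting n f.

(** Given [y], an index is drawn with the weights [f i y] by the quantile construction, and the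
    index selects the atom. Drawing indices rather than points allows the [x i] to be unsorted or
    repeated. *)
Lemma splitting_coupling : exists nu : probability (R * R)%type R,
  [/\ forall B, measurable B -> nu (snd @^-1` B) = mu B,
      nu (~` [set z | exists i : 'I_n.+1, z.1 = x i]) = 0%E &
      forall (g a : R -> R), measurable_fun [set: R] g ->
        measurable_fun [set: R] a -> mu.-integrable [set: R] (EFin \o a) ->
        nu.-integrable [set: R * R] (EFin \o (fun z => g z.1 * a z.2)) /\
        \int[nu]_z (g z.1 * a z.2) =
        \sum_(i < n.+1) g (x i) * \int[mu]_y (f i y * a y)].
Proof.
have [mf f0 f1] := sf.
pose F (q : rat) y := \sum_(j < n.+1 | j%:R <= q) f j y.
have mF q : measurable_fun setT (F q).
  rewrite (_ : F q = (fun y => \sum_(j < n.+1) (if j%:R <= q then f j y else 0))).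
    by apply: measurable_sum => i; set b := (_ <= q); case: b.
  by apply/funext => y; rewrite /F big_mkcond.
have F01 q y : 0 <= F q y <= 1.
  rewrite sumr_ge0//= -(f1 y) [leRHS](bigID (fun j : 'I_n.+1 => j%:R <= q))/=.
  by rewrite lerDl; exact: sumr_ge0.
have F_nd q q' y : q <= q' -> F q y <= F q' y.
  move=> qq; rewrite /F [leRHS](bigID (fun j : 'I_n.+1 => j%:R <= q))/=.
  rewrite [X in _ <= X + _](_ : _ = \sum_(j < n.+1 | j%:R <= q) f j y).
    by rewrite lerDl; exact: sumr_ge0.
  by apply: eq_bigl => j; apply: andb_idl => h; exact: le_trans h qq.
have [Om [h [S [_ mS _ tS [Om1 OmS]]]]] := quantile_coupling mu mF F01 F_nd.
(* The event that the index is [i]: between [i - 1] and [i] the distribution function grows exactly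
   by [f i]. *)
pose A (i : 'I_n.+1) := S (i%:R - 1) i%:R.
have mA i : measurable (A i) by exact: mS.
have tA w i j : A i w -> A j w -> i = j.
  have lt (i' j' : 'I_n.+1) : (i' < j')%N -> A i' w -> ~ A j' w.
    move=> ij; apply: tS; by rewrite lerBrDr natr1 ler_nat.
  by move=> Ai Aj; case: (ltngtP i j) => [/lt/(_ Ai)//|/lt/(_ Aj)//|/val_inj].
have OmA i B : measurable B ->
    pr Om (A i `&` fst @^-1` B) = \int[mu]_y (\1_B y * f i y).
  move=> mB; have i1 : i%:R - 1 <= i%:R :> rat by rewrite gerBl.
  have iF q : mu.-integrable setT (EFin \o (fun y => \1_B y * F q y)).
    apply: (@integrableMbounded _ _ _ _ _ _ 1) => //.
      by move=> y; exact: indic_norm_le1.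
    apply: (@bounded_fun_integrable _ _ _ _ _ 1) => // y.
    by have /andP[a1 a2] := F01 q y; rewrite ger0_norm.
  rewrite OmS// -RintegralB//; apply: eq_Rintegral => y _.
  rewrite -mulrBr; congr (_ * _); rewrite /F (bigD1 i)//=.
  rewrite (_ : \sum_(j < n.+1 | _) f j y = \sum_(j < n.+1 | j%:R <= i%:R - 1 :> rat) f j y).
    by rewrite addrK.
  apply: eq_bigl => j; rewrite lerBrDr natr1 !ler_nat ltn_neqAle andbC.
  by congr (_ && _).
have int_fst (a : R -> R) : measurable_fun setT a -> mu.-integrable setT (EFin \o a) ->
    Om.-integrable setT (EFin \o (fun w => a w.1)) /\
    \int[Om]_w a w.1 = \int[mu]_y a y.
  move=> ma ia; apply: fst_integral => // B mB.
  have m1 : measurable (fst @^-1` B : set (R * R)).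
    exact: (measurable_preimage measurable_fst).
  have := Om1 B mB; rewrite /pr => e.
  have f1' : Om (fst @^-1` B) \is a fin_num by exact: fin_num_measure.
  have f2' : mu B \is a fin_num by exact: fin_num_measure.
  by rewrite -(fineK f1') -(fineK f2') e.
have m1A i : measurable_fun setT (\1_(A i) : R * R -> R) by exact: measurable_indic.
have iA i (b : R * R -> R) : Om.-integrable setT (EFin \o b) ->
    Om.-integrable setT (EFin \o (fun w => \1_(A i) w * b w)).
  move=> ib; apply: (@integrableMbounded _ _ _ _ _ _ 1) => // w.
  exact: indic_norm_le1.
have i1 i : Om.-integrable setT (EFin \o (\1_(A i) : R * R -> R)).
  exact: integrable_indicr.
have ni (i : 'I_n.+1) : (i <= n)%N by rewrite -ltnS.
have int_A i (a : R -> R) : measurable_fun setT a -> mu.-integrable setT (EFin \o a) ->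
    \int[Om]_w (\1_(A i) w * a w.1) = \int[mu]_y (f i y * a y).
  move=> ma ia.
  have if_ := splitting_integrable mu sf (ni i).
  have [ifo ifoE] := int_fst _ (mf i) if_.
  (* [f i] is the conditional probability of [A i], so [k] is orthogonal to bounded functions of the
     first coordinate; the integrable factor [a] is reached through its truncations. *)
  pose k (w : R * R) := \1_(A i) w - f i w.1.
  have ik : Om.-integrable setT (EFin \o k) by exact: integrable_subr.
  have mk : measurable_fun setT k.
    exact: integrable_measurable ik.
  have k0 B : measurable B -> \int[Om]_w (\1_B w.1 * k w) = 0.
    move=> mB; have iBf : mu.-integrable setT (EFin \o (fun y => \1_B y * f i y)).
      apply: (@integrableMbounded _ _ _ _ _ _ 1) => // y; exact: indic_norm_le1.
    have mBf : measurable_fun setT (fun y => \1_B y * f i y).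
      exact: integrable_measurable iBf.
    have [j1 j2] := int_fst _ mBf iBf.
    have m1B : measurable (fst @^-1` B : set (R * R)).
      exact: (measurable_preimage measurable_fst).
    have mAB : measurable (A i `&` fst @^-1` B) by exact: measurableI.
    rewrite (_ : (fun w => _) = (fun w : R * R =>
        \1_(A i `&` fst @^-1` B) w - \1_B w.1 * f i w.1)).
      rewrite RintegralB//; last exact: integrable_indicr.
      by rewrite Rintegral_indic// OmA// j2 subrr.
    apply/funext => w; rewrite /k mulrBr; congr (_ - _).
    by rewrite indicI mulrC.
  have iak : Om.-integrable setT (EFin \o (fun w => k w * a w.1)).
    have [ia1 _] := int_fst _ ma ia.
    apply: (@integrableMbounded _ _ _ _ _ _ 1) => // w.
    have /andP[h1 h2] := splitting_le1 w.1 sf (ni i).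
    by rewrite /k indicE; case: (_ \in _); rewrite ler_norml /=; apply/andP; split; lra.
  have ka0 : \int[Om]_w (a w.1 * k w) = 0.
    have ma1 : measurable_fun setT (fun w : R * R => a w.1).
      exact: (measurableT_comp ma measurable_fst).
    have iak' : Om.-integrable setT (EFin \o (fun w => a w.1 * k w)).
      by move: iak; congr (_.-integrable _ _); apply/funext => w /=; rewrite mulrC.
    have cv := Rintegral_clamp_cvg ma1 mk iak'.
    rewrite -(cvg_lim _ cv)// (_ : (fun m => _) = cst 0) ?lim_cst//.
    apply/funext => m; have mc : measurable_fun setT (clamp (m%:R : R)).
      by apply: continuous_measurable_fun; exact: clamp_continuous.
    apply: (Rintegral_pull_out measurable_fst ik k0 (measurableT_comp mc ma)).
    by move=> y; exact: clamp_norm_le.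
  have ifa := splitting_integrableM sf (ni i) ia.
  have mfa : measurable_fun setT (fun y => f i y * a y) by exact: measurable_funM.
  have [j3 j4] := int_fst _ mfa ifa; have [ia1 _] := int_fst _ ma ia.
  rewrite -j4; apply/eqP; rewrite -subr_eq0 -RintegralB//; last exact: iA.
  apply/eqP; rewrite -[RHS]ka0; apply: eq_Rintegral => w _.
  by rewrite /k; ring.
pose X := pick_atom A.
have mX : measurable_fun setT X.
  by apply: measurable_funD => //; apply: measurable_sum => i; exact: measurable_funM.
pose W (w : R * R) := (X w, w.1).
have mW : measurable_fun setT W by exact: measurable_fun_pair.
pose Wm : {mfun (R * R)%type >-> (R * R)%type} :=
  HB.pack W (@isMeasurableFun.Build _ _ _ _ W mW).
exists (distribution Om Wm : probability (R * R)%type R); split.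
- move=> B mB; have := Om1 B mB; rewrite /pr => e.
  have m1B : measurable (fst @^-1` B : set (R * R)).
    exact: (measurable_preimage measurable_fst).
  have f1' : Om (fst @^-1` B) \is a fin_num by exact: fin_num_measure.
  have f2' : mu B \is a fin_num by exact: fin_num_measure.
  by rewrite -(fineK f2') -e fineK.
- have e : W @^-1` (~` [set z | exists i : 'I_n.+1, z.1 = x i]) = set0.
    apply/seteqP; split => // w /=; apply.
    by have [] := pick_in id (tA w).
  transitivity (Om (W @^-1` (~` [set z | exists i : 'I_n.+1, z.1 = x i]))) => //.
  by rewrite e measure0.
move=> g a mg ma ia; have [ia1 iaE] := int_fst _ ma ia.
pose G (w : R * R) := g (x 0%N) * a w.1 +
  \sum_(i < n.+1) (g (x i) - g (x 0%N)) * (\1_(A i) w * a w.1).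
have GE w : g (X w) * a w.1 = G w.
  have [_ ->] := pick_in g (tA w); rewrite mulrDl mulr_suml; congr (_ + _).
  by apply: eq_bigr => i _; rewrite mulrA.
have iGi (i : 'I_n.+1) : Om.-integrable setT
    (EFin \o (fun w => (g (x i) - g (x 0%N)) * (\1_(A i) w * a w.1))).
  by apply: integrable_mulr; exact: iA.
have [s1 s2] := @Rintegral_sum _ _ _ Om _ (index_enum 'I_n.+1)
  (fun (i : 'I_n.+1) w => (g (x i) - g (x 0%N)) * (\1_(A i) w * a w.1)) iGi.
have iG0 : Om.-integrable setT (EFin \o (fun w => g (x 0%N) * a w.1)).
  exact: integrable_mulr.
have iW : Om.-integrable setT (EFin \o ((fun z => g z.1 * a z.2) \o Wm)).
  rewrite [X in _.-integrable _ X](_ : _ = EFin \o G); first exact: integrable_addr.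
  by apply/funext => w /=; rewrite GE.
have mga : measurable_fun setT (fun z : R * R => g z.1 * a z.2).
  by apply: measurable_funM; [exact: (measurableT_comp mg measurable_fst)|
    exact: (measurableT_comp ma measurable_snd)].
split; first exact: integrable_distribution.
rewrite Rintegral_distribution//.
rewrite [LHS](_ : _ = \int[Om]_w G w); last first.
  by apply: eq_Rintegral => w _; rewrite -GE.
rewrite RintegralD// s2 RintegralZl// iaE.
have -> : \int[mu]_y a y = \sum_(i < n.+1) \int[mu]_y (f i y * a y).
  have [_ <-] := @Rintegral_sum _ _ _ mu _ (index_enum 'I_n.+1)
    (fun i y => f i y * a y) (fun i => splitting_integrableM sf (ni i) ia).
  by apply: eq_Rintegral => y _; rewrite -mulr_suml f1 mul1r.
rewrite mulr_sumr -big_split/=; apply: eq_bigr => i _.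
rewrite RintegralZl//; last exact: iA.
by rewrite int_A//; ring.
Qed.

End atoms.

Lemma cvg_subsequence (T : topologicalType) (u : nat -> T) (l : T) (k : nat -> nat) :
  (forall n, (k n < k n.+1)%N) -> u n @[n --> \oo] --> l ->
  (u \o k) n @[n --> \oo] --> l.
Proof.
move=> kS; apply: cvg_comp => A [N _ NA]; exists N => // n /= Nn; apply: NA => /=.
have kn m : (m <= k m)%N by elim: m => // m IH; exact: leq_ltn_trans (kS m).
exact: leq_trans (kn n).
Qed.

Lemma cvg_sum_ord (R : realType) (n : nat) (u : 'I_n -> nat -> R) (l : 'I_n -> R) :
  (forall i, u i k @[k --> \oo] --> l i) ->
  \sum_(i < n) u i k @[k --> \oo] --> \sum_(i < n) l i.
Proof.
elim: n u l => [|n IH] u l ul.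
  by rewrite big_ord0; under eq_fun do rewrite big_ord0; exact: cvg_cst.
rewrite big_ord_recr/=; under eq_fun do rewrite big_ord_recr/=.
by apply: cvgD; [exact: IH|exact: ul].
Qed.

Lemma sqr_le_harmonic_cvg0 (R : realType) (u : nat -> R) :
  (forall k, u k ^+ 2 <= k.+1%:R^-1) -> u k @[k --> \oo] --> (0 : R).
Proof.
move=> hu; apply/cvgrPdist_lt => e e0; near=> k.
rewrite sub0r normrN -(@ltr_sqr _ `|u k|)// ?nnegrE ?ltW// real_normK ?num_real//.
apply: le_lt_trans (hu k) _; near: k.
exact: (near_infty_natSinv_lt (PosNum (exprn_gt0 2 e0))).
Unshelve. all: by end_near. Qed.

Lemma finitely_supported_atoms (R : realType) (I : set R) (la : probability R R) :
  measurable I -> carried_by la I -> finitely_supported la ->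
  exists (n : nat) (x p : nat -> R),
  [/\ forall i, I (x i), forall i, 0 <= p i &
      forall f, measurable_fun [set: R] f ->
        la.-integrable [set: R] (EFin \o f) /\
        \int[la]_y f y = \sum_(i < n.+1) p i * f (x i)].
Proof.
move=> mI laI [F fF laF].
have fFI : finite_set (F `&` I) by apply: sub_finite_set fF; exact: subIsetl.
have mfin (A : set R) : finite_set A -> measurable A.
  move=> fA; apply: countable_measurable; last exact: finite_set_countable.
  by move=> x; exact: measurable_set1.
have aeFI : {ae la, forall x, (F `&` I) x}.
  by apply: filterS2 (carried_ae (mfin _ fF) laF) (carried_ae mI laI) => x.
have [s0 sE0] := (finite_seqP _).1 fFI.
pose s := undup s0.
have sE x : (F `&` I) x <-> x \in s by rewrite sE0 mem_undup.
(* The total mass is 1, so there is an atom [d]. It is the default for indices past the end of the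
   list, which keeps every [x i] in [I]. *)
have [d ds] : exists d, d \in s.
  apply: contrapT => nd.
  have : {ae la, forall x : R, 1 <= (0 : R)}.
    by apply: filterS aeFI => x /sE xs; exfalso; apply: nd; exists x.
  move=> /(ae_le_Rintegral (integrable_cstr la 1) (integrable_cstr la 0)).
  by rewrite !Rintegral_cst1 ler10.
pose x i := nth d s i.
have xs i : x i \in s.
  by have [h|h] := ltnP i (size s); [exact: mem_nth|rewrite /x nth_default].
have sz : (size s).-1.+1 = size s by rewrite prednK//; case: (s) ds.
exists (size s).-1, x, (fun i => pr la [set x i]); split.
- by move=> i; have /sE[] := xs i.
- by move=> i; rewrite fine_ge0.
move=> f mf; pose C (i : 'I_(size s).-1.+1) := [set x i].
have mC i : measurable (C i) by exact: measurable_set1.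
have [j1 j2] := Rintegral_sum_indic la (fun i : 'I_(size s).-1.+1 => f (x i)) mC.
pose g (z : R) := \sum_(j < (size s).-1.+1) f (x j) * \1_(C j) z.
rewrite -/g in j1.
have mg := integrable_measurable j1.
have fg : {ae la, forall z, f z = g z}.
  apply: filterS aeFI => z /sE zs.
  have iz : (index z s < (size s).-1.+1)%N by rewrite sz index_mem.
  rewrite /g (bigD1 (Ordinal iz))//= indicE /C mem_set/=; last by rewrite /x nth_index.
  rewrite mulr1 /x nth_index// big1 ?addr0// => j ji.
  rewrite indicE memNset ?mulr0// => zj; case/eqP: ji.
  by apply/val_inj; rewrite /= zj index_uniq ?undup_uniq// -[X in (_ < X)%N]sz.
split.
  apply: ae_eq_integrable j1 => //; first exact: filterS fg.
rewrite (ae_eq_Rintegral mf mg fg) j2; apply: eq_bigr => i _; exact: mulrC.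
Qed.

(** Splittings with squared error at most 1/(k+1) give couplings with the exact second marginal,
    nearly the right first marginal and nearly the martingale property; a weak limit point has all
    three exactly. *)
Lemma finitely_supported_strassen (R : realType) (I : set R)
    (la mu : probability R R) : I !=set0 -> open I -> is_interval I ->
  carried_by la I -> carried_by mu I -> finite_mean mu ->
  finitely_supported la -> convex_order I la mu ->
  exists nu, martingale_transport I la mu nu.
Proof.
move=> I0 oI Iitv laI muI muf las co; have mI := open_measurable oI.
have [n [x [p [xI p0 laE]]]] := finitely_supported_atoms mI laI las.
have bal (psi : R -> R) : convex_function ([set: R] : set R^o) (psi : R^o -> R^o) ->
    mu.-integrable setT (EFin \o psi) ->
    \sum_(i < n.+1) p i * psi (x i) <= \int[mu]_y psi y.
  move=> cpsi ipsi.
  have mpsi := integrable_measurable ipsi.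
  have [ilpsi <-] := laE _ mpsi.
  apply: (convex_order_Rintegral oI laI muI co) => //.
  by move=> t a b _ _; apply: cpsi; rewrite inE.
have e_gt0 k : 0 < (k.+1%:R^-1 : R) by rewrite invr_gt0.
have /choice[f hf] := fun k => near_martingale_splitting muf bal p0 (e_gt0 k).
have /choice[nu_ hnu] := fun k => splitting_coupling x mu (hf k).1.
have snd_nu k B : measurable B -> nu_ k (snd @^-1` B) = mu B.
  by have [h _ _] := hnu k; exact: h.
pose fstm : {mfun (R * R)%type >-> R} :=
  HB.pack (fst : R * R -> R) (@isMeasurableFun.Build _ _ (R * R)%type R fst measurable_fst).
pose la_ k : probability R R := distribution (nu_ k) fstm.
have fst_nu k B : measurable B -> nu_ k (fst @^-1` B) = la_ k B by [].
have la_ext k (A : set R) : measurable A -> (forall i, A (x i)) -> carried_by (la_ k) A.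
  move=> mA Ax; have [_ h _] := hnu k; rewrite /carried_by -fst_nu; last exact: measurableC.
  apply: (subset_measure0 _ _ _ h).
  - by apply: (measurable_preimage measurable_fst); exact: measurableC.
  - have -> : [set z : R * R | exists i : 'I_n.+1, z.1 = x i] =
        fst @^-1` [set x i | i in [set: 'I_n.+1]].
      by apply/seteqP; split => [z [i zi]|z [i _ zi]]; exists i.
    apply: measurableC; apply: (measurable_preimage measurable_fst).
    apply: countable_measurable; first by move=> ?; exact: measurable_set1.
    by apply: finite_set_countable; apply: finite_image; exact: finite_finset.
  - by move=> z /= nA [i zi]; apply: nA; rewrite zi.
have la_I k : carried_by (la_ k) I by exact: la_ext.
have la_int k (g : R -> R) : measurable_fun setT g ->
    (la_ k).-integrable setT (EFin \o g) /\ \int[la_ k]_y g y =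
    \sum_(i < n.+1) g (x i) * (mass_error mu p (f k) i + p i).
  move=> mg; have [_ _ h] := hnu k.
  have [h1 h2] := h g (cst 1) mg (measurable_cst _) (integrable_cstr _ _).
  have e : (fun z : R * R => g z.1 * cst 1 z.2) = g \o fstm.
    by apply/funext => z /=; rewrite mulr1.
  rewrite e in h1 h2; split; first exact: integrable_distribution.
  rewrite Rintegral_distribution//; apply: (etrans h2); apply: eq_bigr => i _.
  congr (_ * _); rewrite /mass_error subrK.
  by apply: eq_Rintegral => y _; rewrite mulr1.
have err_le k i : (i <= n)%N -> mass_error mu p (f k) i ^+ 2 <= k.+1%:R^-1 /\
    drift mu x (f k) i ^+ 2 <= k.+1%:R^-1.
  move=> ni; have [_] := hf k; have ni' : (i < n.+1)%N by [].
  rewrite (bigD1 (Ordinal ni'))//=; set S := \sum_(j < _ | _) _ => hS.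
  have S0 : 0 <= S by apply: sumr_ge0 => j _; rewrite addr_ge0// sqr_ge0.
  have h1 := sqr_ge0 (mass_error mu p (f k) i).
  have h2 := sqr_ge0 (drift mu x (f k) i).
  split; apply: (le_trans _ hS); first by rewrite -addrA lerDl addr_ge0.
  by rewrite addrAC lerDr addr_ge0.
have mass_to (i : 'I_n.+1) : mass_error mu p (f k) i @[k --> \oo] --> (0 : R).
  by apply: sqr_le_harmonic_cvg0 => k; have [] := err_le k i (leq_ord i).
have drift_to (i : 'I_n.+1) : drift mu x (f k) i @[k --> \oo] --> (0 : R).
  by apply: sqr_le_harmonic_cvg0 => k; have [] := err_le k i (leq_ord i).
have la_f k : finite_mean (la_ k).
  by have [] := la_int k id (@measurable_id _ _ _).
have laf : finite_mean la by have [] := laE id (@measurable_id _ _ _).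
have la_cvg : weak_cvg1 I la_ la.
  apply/(weak_cvg1P _ _ oI) => g Cg; have [mg _] := Cb1_restrict oI Cg.
  have [_ ->] := laE _ mg.
  under eq_fun do rewrite (la_int _ _ mg).2.
  apply: cvg_sum_ord => i; rewrite mulrC; apply: cvgMr.
  by rewrite -[X in _ --> X]add0r; apply: cvgD; [exact: mass_to|exact: cvg_cst].
have tight1 e : 0 < e -> exists a b : rat, [/\ I (ratr a), I (ratr b), a < b &
    forall k, 1 - e <= pr (nu_ k) (fst @^-1` `]ratr a, ratr b])].
  by move=> e0; exact: (weak_cvg1_tight I0 oI la_I laI la_cvg e0).
have [k [nu [kS nuI nu_cvg]]] :=
  coupling_weak_compact oI Iitv snd_nu tight1 (carried_tight1 I0 oI muI).
exists nu; apply: (martingale_transport_closed I0 oI Iitv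
  (fun j => fst_nu (k j)) (fun j => snd_nu (k j)) (fun j => la_I (k j)) laI muI nuI
  _ nu_cvg (fun j => la_f (k j)) laf muf).
  by move=> g /la_cvg; exact: cvg_subsequence.
move=> a b m Ia Ib; pose g := plateau a b m : R -> R.
have mg : measurable_fun setT g.
  by apply: continuous_measurable_fun; exact: plateau_continuous.
(* Against a function of the atom, the martingale defect of the coupling is a combination of the
   drifts, which tend to 0. *)
have gE j : \int[nu_ j]_z (g z.1 * (z.2 - z.1)) =
    \sum_(i < n.+1) g (x i) * drift mu x (f j) i.
  have [_ _ h] := hnu j.
  have [h1 h2] := h g id mg (@measurable_id _ _ _) muf.
  have [h3 h4] := h (fun y => g y * y) (cst 1)
    (measurable_funM mg (@measurable_id _ _ _)) (measurable_cst _) (integrable_cstr _ _).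
  rewrite (_ : (fun z => _) = (fun z : R * R => g z.1 * z.2 - g z.1 * z.1 * 1)); last first.
    by apply/funext => z; ring.
  rewrite RintegralB// h2 h4 -sumrB; apply: eq_bigr => i _.
  have i1 := splitting_integrable mu (hf j).1 (leq_ord i).
  have i2 := splitting_integrableM (hf j).1 (leq_ord i) muf.
  rewrite /drift (_ : (fun y => f j i y * (y - x i)) =
      (fun y => f j i y * y - x i * f j i y)); last by apply/funext => y; ring.
  rewrite RintegralB//; last exact: integrable_mulr.
  rewrite RintegralZl// (_ : (fun y => f j i y * cst 1 y) = f j i); first by ring.
  by apply/funext => y /=; rewrite mulr1.
apply: (@cvg_subsequence _ (fun j => \int[nu_ j]_z (g z.1 * (z.2 - z.1)))) => //.
have z0 : \sum_(i < n.+1) g (x i) * 0 = 0 by rewrite big1// => i _; rewrite mulr0.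
have cv : \sum_(i < n.+1) g (x i) * drift mu x (f j) i @[j --> \oo] -->
    \sum_(i < n.+1) g (x i) * 0.
  apply: (@cvg_sum_ord _ _ (fun i j => g (x i) * drift mu x (f j) i)) => i.
  by apply: cvgMr; exact: drift_to.
by rewrite z0 in cv; under eq_fun do rewrite gE.
Qed.

(** * Barycentric approximation *)

(** If [t] were outside the interval, then [y - t] would have a constant strict sign on [A], so a
    vanishing integral would make [A] null. *)
Lemma interval_mean (R : realType) (P : probability R R) (A : set R) (t : R) :
  is_interval A -> measurable A -> 0 < pr P A ->
  P.-integrable [set: R] (EFin \o (fun y : R => y)) ->
  \int[P]_y (\1_A y * (y - t)) = 0 -> A t.
Proof.
move=> iA mA PA iid t0; apply: contrapT => nAt.
have iy : P.-integrable setT (EFin \o (fun y : R => \1_A y * (y - t))).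
  apply: (@integrableMbounded _ _ _ _ _ _ 1) => //.
    by move=> y; exact: indic_norm_le1.
  apply: (@integrable_subr _ _ _ _ (fun y : R => y)) => //; exact: integrable_cstr.
have null (c : R) : (forall y, A y -> 0 < c * (y - t)) -> False.
  move=> pos; pose f y := c * (\1_A y * (y - t)).
  have fi : P.-integrable setT (EFin \o f) by exact: integrable_mulr.
  have f0 y : 0 <= f y.
    rewrite /f mulrCA indicE; have [/set_mem Ay|_] := boolP (y \in A).
      by rewrite mul1r ltW// pos.
    by rewrite mul0r.
  have ae0 : {ae P, forall y, f y <= 0}.
    apply: (ae_le_of_indic fi (integrable_cstr P 0)) => B mB.
    rewrite [leRHS](_ : _ = 0); last first.
      rewrite -[RHS](Rintegral_cst1 P 0); apply: eq_Rintegral => y _; exact: mulr0.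
    have <- : \int[P]_y f y = 0 by rewrite RintegralZl// t0 mulr0.
    apply: le_Rintegral => //.
      apply: (@integrableMbounded _ _ _ _ _ _ 1) => //.
      by move=> y; exact: indic_norm_le1.
    move=> y _; rewrite indicE; case: (_ \in _); by rewrite ?mul1r ?mul0r.
  have aeA : {ae P, forall y, \1_A y <= (0 : R)}.
    apply: filterS ae0 => y; rewrite /f indicE.
    have [/set_mem Ay|_] := boolP (y \in A); last by [].
    by rewrite mul1r leNgt pos.
  have := ae_le_Rintegral (integrable_indicr P mA) (integrable_cstr P 0) aeA.
  by rewrite Rintegral_indic// Rintegral_cst1 leNgt PA.
have [lo|] := pselect (exists2 y, A y & y < t).
  have [y Ay yt] := lo; apply: (null (-1)) => z Az.
  rewrite mulN1r oppr_gt0 subr_lt0 ltNge; apply/negP => tz.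
  by apply: nAt; apply: (iA y z) => //; rewrite (ltW yt).
move=> nlo; apply: (null 1) => z Az; rewrite mul1r subr_gt0 lt_neqAle.
apply/andP; split; first by apply/eqP => tz; apply: nAt; rewrite tz.
by rewrite leNgt; apply/negP => zt; apply: nlo; exists z.
Qed.

Section barycentres.
Context (R : realType) (I : set R).
Hypotheses (I_nonempty : I !=set0) (I_open : open I) (I_itv : is_interval I).
Variable mu : probability R R.
Hypotheses (muI : carried_by mu I) (mu_fin : finite_mean mu).

Let mI := open_measurable I_open.

Let en (n : nat) : rat := odflt 0 (unpickle n).

(** A cell is encoded by its pattern of comparisons with the first [n] rationals: there are finitely
    many patterns, their cells are intervals, and refinement is the lengthening of a pattern. *)
Let bits n (y : R) : {ffun 'I_n -> bool} := [ffun i : 'I_n => y < ratr (en i)].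

Let cell n (b : {ffun 'I_n -> bool}) : set R := [set y | bits n y = b].

Let mcell n b : measurable (cell (n := n) b).
Proof.
have -> : cell b = \bigcap_(k in [set: nat])
    [set y | forall h : (k < n)%N, (y < ratr (en k)) = b (Ordinal h)].
  apply/seteqP; split => [y <- k _ h|y hy]; first by rewrite ffunE.
  by apply/ffunP => -[k h]; rewrite ffunE (hy k Logic.I h).
apply: bigcapT_measurable => k; have [h|h] := pselect (k < n)%N; last first.
  rewrite (_ : [set y | _] = setT)//; by apply/seteqP; split => // y _ h'; case: h.
have m1 : measurable [set y : R | y < ratr (en k)].
  rewrite (_ : [set y | _] = `]-oo, ratr (en k)[%classic); first exact: measurable_itv.
  by apply/seteqP; split => y /=; rewrite in_itv.
case e : (b (Ordinal h)).
  rewrite (_ : [set y | _] = [set y : R | y < ratr (en k)])//.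
  apply/seteqP; split => y /=; first by move=> /(_ h); rewrite e.
  by move=> yk h'; rewrite (bool_irrelevance h' h) e.
rewrite (_ : [set y | _] = ~` [set y : R | y < ratr (en k)]); first exact: measurableC.
apply/seteqP; split => y /=; first by move=> /(_ h); rewrite e => ->.
by move=> yk h'; rewrite (bool_irrelevance h' h) e; apply/negP.
Qed.

Let cell_itv n b : is_interval (cell (n := n) b).
Proof.
move=> x z xb zb y /andP[xy yz]; apply/ffunP => i; rewrite ffunE.
have : bits n x i = b i by rewrite (xb : bits n x = b).
have : bits n z i = b i by rewrite (zb : bits n z = b).
rewrite !ffunE.
case: (b i) => [zq _|_ /negbT].
  by rewrite (le_lt_trans yz zq).
by rewrite -!leNgt => qx; apply/negbTE; rewrite -leNgt (le_trans qx).
Qed.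

Let mass n b := pr mu (cell (n := n) b).
Let x0 : R := projT1 (cid I_nonempty).
(** Null cells, where the quotient is meaningless, get a fixed point of [I], so that the barycentre
    map takes all its values in [I]. *)
Let bary n b : R := if mass (n := n) b == 0 then x0
  else (\int[mu]_y (\1_(cell b) y * y)) / mass b.
Let T n (x : R) : R := bary (bits n x).

Let cell_sum n (h : {ffun 'I_n -> bool} -> R) x :
  h (bits n x) = \sum_b h b * \1_(cell b) x.
Proof.
rewrite (bigD1 (bits n x))//= indicE mem_set// mulr1 big1 ?addr0// => b bx.
by rewrite indicE memNset ?mulr0// => xb; rewrite -xb eqxx in bx.
Qed.

Let mcellfun n (h : {ffun 'I_n -> bool} -> R) :
  measurable_fun [set: R] (fun x => h (bits n x)).
Proof.
rewrite (_ : (fun x => _) = (fun x => \sum_b h b * \1_(cell b) x)); last first.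
  by apply/funext => x; exact: cell_sum.
by apply: measurable_sum => b; exact: measurable_funM.
Qed.

Let mT n : measurable_fun [set: R] (T n).
Proof. exact: mcellfun. Qed.

Let T_finite n : finite_set (range (T n)).
Proof.
apply: (@sub_finite_set _ _ [set bary b | b in [set: {ffun 'I_n -> bool}]]).
  by move=> _ [x _ <-]; exists (bits n x).
by apply: finite_image; exact: finite_finset.
Qed.

Let i_cell n b : mu.-integrable [set: R] (EFin \o (fun y => \1_(cell (n := n) b) y * y)).
Proof.
apply: (@integrableMbounded _ _ _ _ _ (fun y : R => y) 1) => //.
by move=> y; exact: indic_norm_le1.
Qed.

Let cell_mean n b : \int[mu]_y (\1_(cell (n := n) b) y * (y - bary b)) = 0.
Proof.
have i1 := integrable_indicr mu (mcell b).
have -> : (fun y => \1_(cell b) y * (y - bary b)) =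
    (fun y => \1_(cell b) y * y - bary b * \1_(cell b) y).
  by apply/funext => y; ring.
have i2 := i_cell b; have i3 := integrable_mulr (bary b) i1.
rewrite RintegralB//.
rewrite RintegralZl// Rintegral_indic//.
rewrite -/(mass b) /bary; have [m0|m0] := eqVneq (mass b) 0; last first.
  by rewrite divfK// subrr.
rewrite m0 mulr0 subr0; have cell0 : {ae mu, forall y, ~ cell b y}.
  exists (cell b); split; [exact: mcell| |by move=> y /= /contrapT].
  have fm : mu (cell b) \is a fin_num by apply: fin_num_measure; exact: mcell.
  by rewrite -(fineK fm) -/(pr mu _) -/(mass b) m0.
rewrite -[RHS](Rintegral_cst1 mu 0); apply: ae_eq_Rintegral => //.
  by apply: measurable_funM => //; apply: measurable_indic; exact: mcell.
by apply: filterS cell0 => y ny; rewrite indicE memNset ?mul0r.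
Qed.

(** The trace of a cell on [I] is an interval of the same mass and mean, so its mean lies in it. *)
Let bary_in n b : 0 < mass (n := n) b -> (cell b `&` I) (bary b).
Proof.
move=> m0; apply: (@interval_mean _ mu) => //.
- move=> x z [xc xI] [zc zI] y yxz; split; first exact: (cell_itv xc zc).
  exact: (I_itv xI zI).
- by apply: measurableI => //; exact: mcell.
- rewrite -(Rintegral_indic mu); last by apply: measurableI => //; exact: mcell.
  suff -> : \int[mu]_y \1_(cell b `&` I) y = mass b by [].
  rewrite /mass -Rintegral_indic; last exact: mcell.
  apply: ae_eq_Rintegral.
  + by apply: measurable_indic; apply: measurableI => //; exact: mcell.
  + by apply: measurable_indic; exact: mcell.
  + apply: filterS (carried_ae mI muI) => y Iy.
    by rewrite !indicE in_setI (mem_set Iy) andbT.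
- rewrite -[RHS](cell_mean b); apply: ae_eq_Rintegral.
  + apply: measurable_funM; last exact: measurable_funB.
    by apply: measurable_indic; apply: measurableI => //; exact: mcell.
  + apply: measurable_funM; last exact: measurable_funB.
    by apply: measurable_indic; exact: mcell.
  + apply: filterS (carried_ae mI muI) => y Iy.
    by congr (_ * _); rewrite !indicE in_setI (mem_set Iy) andbT.
Qed.

Let T_I n x : I (T n x).
Proof.
rewrite /T; have [m0|m0] := eqVneq (mass (bits n x)) 0.
  by rewrite /bary m0 eqxx /x0; case: cid.
have [] // := @bary_in n (bits n x).
by rewrite lt_neqAle eq_sym m0 fine_ge0.
Qed.

Let T_mean n B : measurable B -> \int[mu]_x (\1_B (T n x) * (x - T n x)) = 0.
Proof.
move=> mB; have -> : (fun x => \1_B (T n x) * (x - T n x)) =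
    (fun x => \sum_b \1_B (bary b) * (\1_(cell (n := n) b) x * (x - bary b))).
  apply/funext => x.
  rewrite (bigD1 (bits n x))//= big1 ?addr0; last first.
    move=> b bx; rewrite indicE mulrC [\1_(cell b) x]indicE memNset ?mul0r// => xb.
    by rewrite -xb eqxx in bx.
  by rewrite [\1_(cell _) x]indicE mem_set// mul1r.
have ib b : mu.-integrable setT (EFin \o (fun x => \1_(cell (n := n) b) x * (x - bary b))).
  apply: (@integrableMbounded _ _ _ _ _ (fun y : R => y - bary b) 1) => //.
  - by move=> y; exact: indic_norm_le1.
  - apply: (@integrable_subr _ _ _ _ (fun y : R => y)) => //; exact: integrable_cstr.
have [_ ->] := @Rintegral_sum _ _ _ mu _ (index_enum {ffun 'I_n -> bool})
  (fun b x => \1_B (bary b) * (\1_(cell b) x * (x - bary b)))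
  (fun b => integrable_mulr _ (ib b)).
by apply: big1 => b _; rewrite RintegralZl// cell_mean mulr0.
Qed.

Let ae_mass : {ae mu, forall x, forall n, 0 < mass (bits n x)}.
Proof.
apply/ae_foralln => n.
have h b : {ae mu, forall x, bits n x = b -> 0 < mass b}.
  have [m0|m0] := eqVneq (mass b) 0; last first.
    by apply: aeW => x _; rewrite lt_neqAle eq_sym m0 fine_ge0.
  exists (cell b); split; [exact: mcell| |].
    have fm : mu (cell b) \is a fin_num by apply: fin_num_measure; exact: mcell.
    by rewrite -(fineK fm) -/(pr mu _) -/(mass b) m0.
  by move=> x /= /not_implyP[].
have h' : {ae mu, forall x, forall b, bits n x = b -> 0 < mass b}.
  exact: filter_forall.
by apply: filterS h' => x hx; exact: hx.
Qed.

Let T_cell n x : 0 < mass (bits n x) -> bits n (T n x) = bits n x.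
Proof. by move=> /bary_in[]. Qed.

(** The finer barycentre stays in the finer cell of [x], hence has the same first [n] comparisons as
    [x]. Null cells are the reason for the positivity condition. *)
Let T_comp n x : 0 < mass (bits n.+1 x) -> T n (T n.+1 x) = T n x.
Proof.
move=> /T_cell e; rewrite {1}/T; congr bary; apply/ffunP => i; rewrite !ffunE.
have : bits n.+1 (T n.+1 x) (widen_ord (leqnSn n) i) =
  bits n.+1 x (widen_ord (leqnSn n) i) by rewrite e.
by rewrite !ffunE.
Qed.

(** Once a rational has been enumerated, [T n x] and [x] lie on the same side of it; two rationals
    close to [x] on either side suffice. *)
Let T_cvg x : (forall n, 0 < mass (bits n x)) -> T n x @[n --> \oo] --> x.
Proof.
move=> mx; have side (q : rat) n : (pickle q < n)%N -> (T n x < ratr q) = (x < ratr q).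
  move=> qn; have : bits n (T n x) (Ordinal qn) = bits n x (Ordinal qn) by rewrite T_cell.
  by rewrite !ffunE /= /en pickleK.
apply/cvgrPdist_lt => e e0.
have xe1 : x - e < x by rewrite ltrBlDr ltrDl.
have xe2 : x < x + e by rewrite ltrDl.
have [p /[!in_itv]/= /andP[p1 p2]] := rat_in_itvoo xe1.
have [q /[!in_itv]/= /andP[q1 q2]] := rat_in_itvoo xe2.
exists (maxn (pickle p) (pickle q)).+1 => // n /=; rewrite gtn_max => /andP[pn qn].
have := side p n pn; have := side q n qn; rewrite q1 => Tq.
rewrite (ltNge x) (ltW p2)/= => /negbT; rewrite -leNgt => pT.
by rewrite distrC ltr_norml; apply/andP; split; lra.
Qed.

Let TF n : {mfun R >-> R} := HB.pack (T n) (@isMeasurableFun.Build _ _ R R (T n) (mT n)).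
Let la_ n : probability R R := distribution mu (TF n).

Let law_integral n (f : R -> R) : measurable_fun [set: R] f ->
  \int[la_ n]_y f y = \int[mu]_x f (T n x).
Proof.
move=> mf; rewrite Rintegral_distribution//.
have [M hM] := finite_set_norm_bound f (T_finite n).
apply: (@bounded_fun_integrable _ _ _ _ _ M); first exact: measurableT_comp.
by move=> x; apply: hM; exists x.
Qed.

Let la_cvg : weak_cvg1 I la_ mu.
Proof.
apply/(weak_cvg1P _ _ I_open) => f Cf.
have [mf [M M0 fM]] := Cb1_restrict I_open Cf.
under eq_fun do rewrite law_integral//.
have [N [mN N0 NG]] := filterI ae_mass (carried_ae mI muI).
have good x : ~ N x -> (forall n, 0 < mass (bits n x)) /\ I x.
  by move=> nN; apply: contrapT => h; apply: nN; apply: NG.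
have aeN : {ae mu, forall x, ~ N x} by exists N; split => // x /= /contrapT.
have eN g : measurable_fun [set: R] g -> \int[mu]_x g x = \int[mu]_x (\1_(~` N) x * g x).
  move=> mg; apply: ae_eq_Rintegral => //.
    by apply: measurable_funM => //; apply: measurable_indic; exact: measurableC.
  by apply: filterS aeN => x nN; rewrite indicE mem_set// mul1r.
have mfT n : measurable_fun setT (fun x => (f \_ I) (T n x)) by exact: measurableT_comp.
have m1N : measurable_fun setT (\1_(~` N) : R -> R).
  by apply: measurable_indic; exact: measurableC.
rewrite eN// (_ : (fun n => _) =
  (fun n => \int[mu]_x (\1_(~` N) x * (f \_ I) (T n x)))); last first.
  by apply/funext => n; rewrite eN.
apply: (@Rintegral_cvg_bounded _ _ _ _ _ _ M) => [n||x|n x].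
- exact: measurable_funM.
- exact: measurable_funM.
- have [nN|NNx] := pselect ((~` N) x); last first.
    rewrite (_ : (fun n => _) = (fun=> \1_(~` N) x * (f \_ I) x)); first exact: cvg_cst.
    by apply/funext => n; rewrite indicE memNset// !mul0r.
  have [gx Ix] := good _ nN; apply: cvgMr.
  rewrite patchE mem_set// (_ : (fun n => _) = (fun n => f (T n x))); last first.
    by apply/funext => n; rewrite patchE mem_set.
  have [cf _] := Cf; move: cf; rewrite continuous_open_subspace// => /(_ x (mem_set Ix)) cx.
  have Tx := T_cvg gx; exact: (cvg_comp (fun n => T n x) f Tx cx).
- by rewrite normrM (le_trans _ (fM (T n x)))// ler_piMl// indic_norm_le1.
Qed.

Let T_comp_ae n : {ae mu, forall x, T n (T n.+1 x) = T n x}.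
Proof. by apply: filterS ae_mass => x h; exact: T_comp. Qed.

(** The same map [T n] sends both [mu] and the next approximation to the [n]-th one, with the same
    mean property, so the coarsening results apply to either. *)
Lemma barycentre_approximation : exists (la_ : nat -> probability R R) (T : nat -> R -> R),
  [/\ forall n, [/\ measurable_fun [set: R] (T n), forall x, I (T n x) &
        finite_set (range (T n))],
      forall n B, measurable B -> la_ n B = mu (T n @^-1` B),
      forall n B, measurable B -> \int[mu]_x (\1_B (T n x) * (x - T n x)) = 0,
      forall n B, measurable B -> la_ n B = la_ n.+1 (T n @^-1` B) &
      (forall n B, measurable B ->
        \int[la_ n.+1]_x (\1_B (T n x) * (x - T n x)) = 0) /\
      weak_cvg1 I la_ mu].
Proof.
have mpre n (B : set R) : measurable B -> measurable (T n @^-1` B).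
  by move=> mB; exact: (measurable_preimage (mT _)).
exists la_, T; split; [by []|by []|exact: T_mean|move=> n B mB|].
  have mTB := mpre n _ mB.
  have e (P Q : \bar R) : P \is a fin_num -> Q \is a fin_num -> fine P = fine Q -> P = Q.
    by move=> fP fQ PQ; rewrite -(fineK fP) PQ fineK.
  apply: e; [exact: fin_num_measure|exact: fin_num_measure|].
  rewrite -/(pr (la_ n) B) -/(pr (la_ n.+1) (T n @^-1` B)) -!Rintegral_indic//.
  have m1 : measurable_fun setT (\1_B : R -> R) by exact: measurable_indic.
  have m2 : measurable_fun setT (\1_(T n @^-1` B) : R -> R) by exact: measurable_indic.
  rewrite !law_integral//; apply: ae_eq_Rintegral; [exact: measurableT_comp..|].
  apply: filterS (T_comp_ae n) => x hx.
  by rewrite !indicE; congr (nat_of_bool _)%:R; apply/idP/idP;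
    rewrite !inE /= hx.
split; [move=> n B mB|exact: la_cvg].
have m1 : measurable_fun setT (\1_B : R -> R) by exact: measurable_indic.
have mf k : measurable_fun setT (fun x => \1_B (T n x) * (T k x - T n x)).
  by apply: measurable_funM; [exact: measurableT_comp|exact: measurable_funB].
have m3 : measurable_fun setT (fun y => \1_B (T n y) * (y - T n y)).
  by apply: measurable_funM; [exact: measurableT_comp|exact: measurable_funB].
rewrite law_integral//.
transitivity (\int[mu]_x (\1_B (T n x) * (T n.+1 x - T n x))).
  apply: ae_eq_Rintegral => //.
    exact: (measurableT_comp m3 (mT n.+1)).
  by apply: filterS (T_comp_ae n) => x ->.
have iT k : mu.-integrable setT (EFin \o (fun x => x - T k x)).
  apply: (@integrable_subr _ _ _ _ (fun x : R => x)) => //.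
  have [M hM] := finite_set_norm_bound id (T_finite k).
  apply: (@bounded_fun_integrable _ _ _ _ _ M) => // x; apply: hM; by exists x.
have iB k : mu.-integrable setT (EFin \o (fun x => \1_B (T n x) * (x - T k x))).
  apply: (@integrableMbounded _ _ _ _ (fun x => \1_B (T n x)) _ 1) => //.
    exact: measurableT_comp.
  by move=> x; exact: indic_norm_le1.
(* Both displacements are measured from [x]. The first has mean 0 at level [n]; the second has mean
   0 at level [n + 1], since an event of [T n] is almost surely an event of [T n.+1]. *)
rewrite (_ : (fun x => _) = (fun x => \1_B (T n x) * (x - T n x) -
    \1_B (T n x) * (x - T n.+1 x))); last by apply/funext => x; ring.
rewrite RintegralB// T_mean// sub0r.
rewrite -[RHS]oppr0; congr (- _); rewrite -[RHS](T_mean n.+1 (mpre n _ mB)).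
apply: ae_eq_Rintegral.
- exact: (integrable_measurable (iB n.+1)).
- apply: measurable_funM; last exact: measurable_funB.
  have m2 : measurable_fun setT (\1_(T n @^-1` B) : R -> R).
    by apply: measurable_indic; exact: mpre.
  exact: measurableT_comp.
- apply: filterS (T_comp_ae n) => x hx; congr (_ * _).
  by rewrite !indicE; congr (nat_of_bool _)%:R; apply/idP/idP; rewrite !inE /= hx.
Qed.

End barycentres.

(** * Maximizers and their limits *)

Section transports.
Context (R : realType) (I : set R).
Hypotheses (I_nonempty : I !=set0) (I_open : open I) (I_itv : is_interval I).
Implicit Types (la mu : probability R R) (nu : probability (R * R)%type R).

Lemma martingale_transport_increment la mu nu (g : R -> R) (M : R) :
  finite_mean la -> finite_mean mu -> martingale_transport I la mu nu ->
  measurable_fun [set: R] g -> (forall x, `|g x| <= M) ->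
  \int[nu]_z (g z.1 * (z.2 - z.1)) = 0.
Proof.
move=> laf muf [_ n1 n2 mart] mg gM.
have h := (martingaleP n1 n2 laf muf).1 mart.
exact: (Rintegral_pull_out measurable_fst (integrable_increment n1 n2 laf muf) h mg gM).
Qed.

Section sequences.
Variables (la_ : nat -> probability R R) (la mu : probability R R).
Variable nu_ : nat -> probability (R * R)%type R.
Hypotheses (la_I : forall n, carried_by (la_ n) I) (laI : carried_by la I).
Hypothesis muI : carried_by mu I.
Hypotheses (la_f : forall n, finite_mean (la_ n)) (laf : finite_mean la).
Hypotheses (muf : finite_mean mu) (la_cvg : weak_cvg1 I la_ la).
Hypothesis nu_M : forall n, martingale_transport I (la_ n) mu (nu_ n).

Let n1 n : forall B, measurable B -> nu_ n (fst @^-1` B) = la_ n B.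
Proof. by case: (nu_M n). Qed.
Let n2 n : forall B, measurable B -> nu_ n (snd @^-1` B) = mu B.
Proof. by case: (nu_M n). Qed.

Lemma accumulation_transport (k : nat -> nat) nu :
  (forall n, (k n < k n.+1)%N) -> carried_by nu (I `*` I) ->
  weak_cvg2 I (nu_ \o k) nu -> martingale_transport I la mu nu.
Proof.
move=> kS nuI nu_cvg.
apply: (martingale_transport_closed I_nonempty I_open I_itv
  (fun n => @n1 (k n)) (fun n => @n2 (k n)) (fun n => la_I (k n)) laI muI nuI
  _ nu_cvg (fun n => la_f (k n)) laf muf).
  by move=> g /la_cvg; exact: cvg_subsequence.
move=> a b m Ia Ib; rewrite (_ : (fun n => _) = cst 0); first exact: cvg_cst.
apply/funext => n; apply: (martingale_transport_increment (la_f (k n)) muf (nu_M _)).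
  by apply: continuous_measurable_fun; exact: plateau_continuous.
by move=> x; exact: plateau_norm_le1.
Qed.

Let tight1 (e : R) : 0 < e -> exists a b : rat, [/\ I (ratr a), I (ratr b), a < b &
    forall n, 1 - e <= pr (nu_ n) (fst @^-1` `]ratr a, ratr b])].
Proof.
move=> e0; have [a [b [Ia Ib ab h]]] := weak_cvg1_tight I_nonempty I_open la_I laI la_cvg e0.
exists a, b; split => // n; rewrite /pr n1; first exact: h.
exact: measurable_itv.
Qed.

Lemma transport_compact : exists (k : nat -> nat) nu,
  [/\ forall n, (k n < k n.+1)%N, carried_by nu (I `*` I),
      weak_cvg2 I (nu_ \o k) nu & martingale_transport I la mu nu].
Proof.
have [k [nu [kS nuI nu_cvg]]] := coupling_weak_compact I_open I_itv
  n2 tight1 (carried_tight1 I_nonempty I_open muI).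
by exists k, nu; split => //; exact: (accumulation_transport kS).
Qed.

Lemma transport_tight : tight I nu_.
Proof.
move=> e e0; have e2 : 0 < e / 2 by rewrite divr_gt0.
have [a [b [Ia Ib ab h1]]] := tight1 e2.
have [c [d [Ic Id cd h2]]] := carried_tight1 I_nonempty I_open muI e2.
pose A : set R := `[ratr a, ratr b]%classic; pose B : set R := `[ratr c, ratr d]%classic.
have mA : measurable (fst @^-1` A : set (R * R)).
  by apply: (measurable_preimage measurable_fst); exact: measurable_itv.
have mB : measurable (snd @^-1` B : set (R * R)).
  by apply: (measurable_preimage measurable_snd); exact: measurable_itv.
exists (A `*` B); split.
- exact: compact_setX (@segment_compact _ _ _) (@segment_compact _ _ _).
- by move=> z [/= + +]; rewrite /A /B /= !in_itv/= => z1 z2;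
    split; [exact: (I_itv Ia Ib)|exact: (I_itv Ic Id)].
move=> n; have mAB : measurable (A `*` B) by apply: measurableX; exact: measurable_itv.
have ABE : A `*` B = fst @^-1` A `&` snd @^-1` B by [].
rewrite probability_setC// -(fineK (fin_num_measure (nu_ n) _ mAB)) -EFinB lee_fin.
rewrite -/(pr _ _) ABE.
have h3 : 1 - e / 2 <= pr (nu_ n) (fst @^-1` A).
  apply: le_trans (h1 n) _; apply: pr_le => //.
    by apply: (measurable_preimage measurable_fst); exact: measurable_itv.
  by move=> z; rewrite /A /= !in_itv/= => /andP[/ltW -> ->].
have h4 : 1 - e / 2 <= pr (nu_ n) (snd @^-1` B).
  rewrite /pr n2; last exact: measurable_itv.
  apply: le_trans h2 _; apply: pr_le; [exact: measurable_itv..|].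
  by move=> z; rewrite /B /= !in_itv/= => /andP[/ltW -> ->].
have := pr_setI_ge (nu_ n) mA mB; lra.
Qed.

End sequences.

Section optimization.
Variables (gamma phi : R -> R).
Hypothesis gamma_convex : convex_function (I : set R^o) (gamma : R^o -> R^o).
Hypothesis gamma_bounded : [bounded (gamma x : R^o) | x in I].
Hypothesis phi_concave : concave_function `[0, +oo[%classic phi.
Hypothesis phi_nd : {in `[0, 2 * supnorm I gamma] &, {homo phi : x y / x <= y}}.
Hypothesis phi_cont : {within `[0, 2 * supnorm I gamma], continuous phi}.

(** The direct method: a maximizing sequence has a weakly convergent subsequence whose limit is a
    transport, and upper semicontinuity makes it optimal. *)
Lemma maximizer_exists la mu : carried_by la I -> carried_by mu I ->
  finite_mean la -> finite_mean mu ->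
  martingale_transport I la mu !=set0 ->
  exists nu, maximizer (J I gamma phi) (martingale_transport I la mu) nu.
Proof.
move=> laI muI laf muf [nu0 nu0M].
pose j nu := fine (J I gamma phi nu).
have jE nu : martingale_transport I la mu nu -> J I gamma phi nu = (j nu)%:E.
  move=> nuM; rewrite fineK//.
  exact: (J_fin_num I_nonempty I_open gamma_convex gamma_bounded phi_concave phi_nd
    laI laf muf nuM).
pose S := [set j nu | nu in martingale_transport I la mu].
have hS : has_sup S.
  split; first by exists (j nu0), nu0.
  (* The dual bound with [p = 0] is a constant, so the supremum is finite. *)
  exists (concave_conj phi (2 * supnorm I gamma) 0) => _ [nu nuM <-].
  have p0 (x : R) : 0 <= cst (0 : R) x <= 0 by rewrite /= lexx.
  have := J_dual_le I_nonempty I_open gamma_convex gamma_bounded phi_concave phi_nd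
    laI laf muf nuM (measurable_cst _) p0.
  rewrite jE// lee_fin; move=> /le_trans; apply.
  rewrite -[leRHS](Rintegral_cst1 nu) le_eqVlt; apply/orP; left; apply/eqP.
  by apply: eq_Rintegral => z _; rewrite /= mul0r add0r.
have e_gt0 n : 0 < (n.+1%:R^-1 : R) by rewrite invr_gt0.
have /choice[nu_ hnu] n : exists nu, martingale_transport I la mu nu /\
    sup S - n.+1%:R^-1 < j nu.
  by have [_ [nu nuM <-] h] := sup_adherent (e_gt0 n) hS; exists nu.
have cst_cvg : weak_cvg1 I (fun=> la) la by move=> f _; exact: cvg_cst.
have [k [nu [kS nuI nu_cvg nuM]]] := transport_compact (fun=> laI) laI muI
  (fun=> laf) laf muf cst_cvg (fun n => (hnu n).1).
exists nu; split => // nu' nu'M; rewrite !jE// lee_fin.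
have le_sup : j nu' <= sup S by apply: ub_le_sup; [case: hS|exists nu'].
apply: le_trans le_sup _; apply/ler_addgt0Pr => e e0.
have e2 : 0 < e / 2 by rewrite divr_gt0.
have [N hN] := J_upper_semicontinuous I_nonempty I_open gamma_convex gamma_bounded
  phi_concave phi_nd phi_cont (fun=> laI) laI (fun=> laf) laf muf
  (fun n => (hnu (k n)).1) nuM nu_cvg e2.
have kn m : (m <= k m)%N by elim: m => // m IH; exact: leq_ltn_trans (kS m).
have [N' _ hN'] := near_infty_natSinv_lt (PosNum e2).
pose n := maxn N N'.
have := hN n (leq_maxl _ _); rewrite /= (jE _ (hnu (k n)).1) (jE _ nuM) -EFinD lee_fin.
have := (hnu (k n)).2.
have := hN' (k n) (leq_trans (leq_maxr _ _) (kn n)); rewrite /=.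
by move: (_.+1%:R^-1) => r r1 r2 r3; rewrite [leRHS](_ : _ = (j nu + e / 2) + e / 2); lra.
Qed.

End optimization.

End transports.

Local Open Scope ereal_scope.

Theorem theorem3p15 (R : realType) (I : set R) (gamma phi : R -> R)
    (mu1 mu2 : probability R R)
    (I_nonempty : I !=set0) (I_open : open I) (I_itv : is_interval I)
    (gamma_convex : convex_function (I : set R^o) (gamma : R^o -> R^o))
    (phi_concave : concave_function `[0%R, +oo[%classic phi)
    (mu1_I : carried_by mu1 I) (mu2_I : carried_by mu2 I)
    (mu1_mean : finite_mean mu1) (mu2_mean : finite_mean mu2)
    (mu12 : convex_order I mu1 mu2)
    (gamma_mu1 : \int[mu1]_(x in I) (Num.max (gamma x) 0)%:E < +oo)
    (gamma_mu2 : \int[mu2]_(x in I) (Num.max (gamma x) 0)%:E < +oo)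
    (gamma_bounded : [bounded (gamma x : R^o) | x in I])
    (phi_nondecreasing : {in `[0%R, (2 * supnorm I gamma)%R] &,
      {homo phi : x y / (x <= y)%R}})
    (phi_continuous :
      {within `[0%R, (2 * supnorm I gamma)%R], continuous phi})
    (phi_lipschitz :
      locally_lipschitz `]0%R, (2 * supnorm I gamma)%R] phi) :
  let M := martingale_transport I mu1 mu2 in
  exists mu1_ : nat -> probability R R,
    [/\ forall n, carried_by (mu1_ n) I /\ finitely_supported (mu1_ n),
        forall n, convex_order I (mu1_ n) (mu1_ n.+1),
        weak_cvg1 I mu1_ mu1 &
        forall n, convex_order I (mu1_ n) mu1] /\
    let maximizers (nu_ : nat -> probability (R * R)%type R) :=
      forall n, maximizer (J I gamma phi)
                  (martingale_transport I (mu1_ n) mu2) (nu_ n) in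
    (forall nu_, maximizers nu_ ->
      [/\ (forall n, J I gamma phi (nu_ n.+1) <= J I gamma phi (nu_ n)) /\
          (exists2 nustar, maximizer (J I gamma phi) M nustar &
            J I gamma phi (nu_ n) @[n --> \oo] --> J I gamma phi nustar),
          tight I nu_ &
          forall nu0, weak_accumulation_point I nu_ nu0 ->
            maximizer (J I gamma phi) M nu0]) /\
    (exists2 nu_, maximizers nu_ &
      exists nu0, weak_accumulation_point I nu_ nu0).
Proof.
have mI := open_measurable I_open.
have [mu1_ [T [T_reg la'E T_mean la'S [T_meanS mu1_cvg]]]] :=
  barycentre_approximation I_nonempty I_open I_itv mu1_I mu1_mean.
have mT n : measurable_fun setT (T n) by case: (T_reg n).
have TI n x : I (T n x) by case: (T_reg n).
have Tfin n : finite_set (range (T n)) by case: (T_reg n).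
have mu1_nI n : carried_by (mu1_ n) I := coarse_carried I_open (TI n) (la'E n).
have mu1_nf n : finite_mean (mu1_ n) := coarse_mean (mT n) (Tfin n) (la'E n).
have mu1_ns n : finitely_supported (mu1_ n).
  exists (range (T n)); first exact: Tfin.
  have mF : measurable (range (T n)).
    apply: countable_measurable; first by move=> x; exact: measurable_set1.
    exact: finite_set_countable.
  rewrite /carried_by la'E; last exact: measurableC.
  rewrite (_ : T n @^-1` _ = set0)//; apply/seteqP; split => // x /=; apply.
  by exists x.
have co_succ n : convex_order I (mu1_ n) (mu1_ n.+1).
  exact: (coarse_convex_order I_open (mu1_nI n.+1) (mu1_nf n.+1) (mT n) (TI n)
    (Tfin n) (la'S n) (T_meanS n)).
have co_mu1 n : convex_order I (mu1_ n) mu1.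
  exact: (coarse_convex_order I_open mu1_I mu1_mean (mT n) (TI n) (Tfin n)
    (la'E n) (T_mean n)).
have co_mu2 n : convex_order I (mu1_ n) mu2.
  by move=> psi cpsi; apply: (@le_trans _ _ (\int[mu1]_(x in I) (psi x)%:E));
    [exact: co_mu1|exact: mu12].
have J_fin la nu : carried_by la I -> finite_mean la ->
    martingale_transport I la mu2 nu -> J I gamma phi nu \is a fin_num.
  move=> laI laf; exact: (J_fin_num I_nonempty I_open gamma_convex gamma_bounded
    phi_concave phi_nondecreasing laI laf mu2_mean).
move=> M; exists mu1_; split; first by split.
move=> maximizers.
(* Coarsening a maximizer for the next marginal gives a competitor for the present one with no
   smaller value. *)
have max_succ nu_ : maximizers nu_ -> forall n,
    J I gamma phi (nu_ n.+1) <= J I gamma phi (nu_ n).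
  move=> hnu n; have [nuM _] := hnu n.+1; have [_ nu_max] := hnu n.
  have [nu' [nu'M le_nu']] := coarse_transport I_nonempty I_open (mu1_nI n.+1)
    (mu1_nf n.+1) (mT n) (TI n) (Tfin n) (la'S n) (T_meanS n) gamma_convex
    gamma_bounded phi_concave phi_nondecreasing phi_continuous mu2_I mu2_mean nuM.
  by apply: le_trans le_nu' _; exact: nu_max.
have max_ge nu_ : maximizers nu_ -> forall n nu, M nu ->
    J I gamma phi nu <= J I gamma phi (nu_ n).
  move=> hnu n nu nuM; have [_ nu_max] := hnu n.
  have [nu' [nu'M le_nu']] := coarse_transport I_nonempty I_open mu1_I
    mu1_mean (mT n) (TI n) (Tfin n) (la'E n) (T_mean n) gamma_convex
    gamma_bounded phi_concave phi_nondecreasing phi_continuous mu2_I mu2_mean nuM.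
  by apply: le_trans le_nu' _; exact: nu_max.
have usc nu_ k nu : maximizers nu_ -> (forall n, (k n < k n.+1)%N) ->
    weak_cvg2 I (nu_ \o k) nu -> M nu -> forall e : R, (0 < e)%R ->
    exists N, forall n, (N <= n)%N ->
    J I gamma phi (nu_ (k n)) <= J I gamma phi nu + e%:E.
  move=> hnu kS nu_cvg nuM e e0.
  exact: (J_upper_semicontinuous I_nonempty I_open gamma_convex gamma_bounded
    phi_concave phi_nondecreasing phi_continuous (fun n => mu1_nI (k n)) mu1_I
    (fun n => mu1_nf (k n)) mu1_mean mu2_mean (fun n => (hnu (k n)).1) nuM nu_cvg e0).
have acc_max nu_ nu0 : maximizers nu_ -> weak_accumulation_point I nu_ nu0 ->
    maximizer (J I gamma phi) M nu0.
  move=> hnu [nu0I [k kS nu_cvg]].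
  have nu0M : M nu0 := accumulation_transport I_nonempty I_open I_itv mu1_nI mu1_I
    mu2_I mu1_nf mu1_mean mu2_mean mu1_cvg (fun n => (hnu n).1) kS nu0I nu_cvg.
  split => // nu nuM; apply/lee_addgt0Pr => e e0.
  have [N hN] := usc _ _ _ hnu kS nu_cvg nu0M e e0.
  exact: le_trans (max_ge _ hnu (k N) _ nuM) (hN N (leqnn N)).
have acc_exists nu_ : maximizers nu_ -> exists k nu,
    [/\ forall n, (k n < k n.+1)%N, carried_by nu (I `*` I),
        weak_cvg2 I (nu_ \o k) nu & M nu].
  move=> hnu; exact: (transport_compact I_nonempty I_open I_itv mu1_nI mu1_I
    mu2_I mu1_nf mu1_mean mu2_mean mu1_cvg (fun n => (hnu n).1)).
split.
  move=> nu_ hnu; split; last by move=> nu0; exact: acc_max.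
    split; first exact: max_succ.
    have [k [nu [kS nuI nu_cvg nuM]]] := acc_exists _ hnu.
    exists nu; first by apply: (acc_max nu_) => //; split => //; exists k.
    have nu_fin := J_fin _ _ mu1_I mu1_mean nuM.
    have nu_n_fin n := J_fin _ _ (mu1_nI n) (mu1_nf n) (hnu n).1.
    rewrite -(fineK nu_fin); apply: cvg_EFin; first exact: nearW.
    apply/cvgrPdist_le => e e0; have [N hN] := usc _ _ _ hnu kS nu_cvg nuM e e0.
    exists (k N) => // n /= kNn.
    (* Monotonicity carries the upper bound at the single index [k N] of the subsequence over to all
       later indices of the whole sequence. *)
    have mono m : J I gamma phi (nu_ (k N + m)%N) <= J I gamma phi (nu_ (k N)).
      elim: m => [|m IH]; first by rewrite addn0.
      by apply: le_trans IH; rewrite addnS; exact: max_succ.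
    have h1 := le_trans (mono (n - k N)%N) (hN N (leqnn N)).
    rewrite subnKC// in h1; have h2 := max_ge _ hnu n _ nuM.
    rewrite -(fineK nu_fin) -(fineK (nu_n_fin n)) ?lee_fin in h1 h2.
    rewrite distrC ger0_norm ?subr_ge0//.
    by rewrite lerBlDl.
  exact: (transport_tight I_nonempty I_open I_itv mu1_nI mu1_I mu2_I mu1_cvg
    (fun n => (hnu n).1)).
have /choice[nu_ hnu] n : exists nu, maximizer (J I gamma phi)
    (martingale_transport I (mu1_ n) mu2) nu.
  apply: (maximizer_exists I_nonempty I_open I_itv gamma_convex gamma_bounded
    phi_concave phi_nondecreasing phi_continuous) => //.
  by have [nu nuM] := finitely_supported_strassen I_nonempty I_open I_itv
    (mu1_nI n) mu2_I mu2_mean (mu1_ns n) (co_mu2 n); exists nu.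
exists nu_ => //; have [k [nu [kS nuI nu_cvg nuM]]] := acc_exists _ hnu.
by exists nu; split => //; exists k.
Qed.
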